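(* Let $A$ be a finite-dimensional $\mathbb{Z}$-graded algebra over a field $K$ with a triangular decomposition $(A^-,T,A^+)$. Suppose that $T$ is semisimple. Let $B^{\pm}$ be the subalgebra of $A$ generated by $A^\pm$ and $T$. If $B^-\simeq (B^+)^{\circledast}$ as graded $T$-bimodules, then $A$ satisfies BGG reciprocity, i.e. $$[P(\lambda):\Delta(\mu)]=[\Delta(\mu):L(\lambda)]\qquad\text{for all }\lambda,\mu\in\operatorname{Irr}\mathcal{G}(T).$$
   Context: **Triangular decomposition.** A triangular decomposition of $A$ is a triple $(A^-,T,A^+)$ of graded subalgebras such that: (a) multiplication $A^-\otimes_K T\otimes_K A^+\to A$ is an isomorphism of vector spaces; (b) $T$ is concentrated in degree $0$, $A^+$ is supported in degrees $\ge 0$ and $A^-$ in degrees $\le 0$; (c) $A^-_0=K=A^+_0$; (d) $A^+T=TA^+$ and $A^-T=TA^-$; (e) $T$ is split over $K$, i.e. $\operatorname{End}_T(\lambda)=K$ for every simple $T$-module $\lambda$. **Notation.** $\mathcal{G}(A)$ is the category of finitely generated graded left $A$-modules with degree-preserving morphisms; $\operatorname{Irr}$ is the set of isomorphism classes of simple objects. $B^\pm=A^\pm T$ is a graded subalgebra; $T$-modules become $B^+$-modules via the quotient map $B^+\to T$ killing positive degrees. $\Delta(\lambda)=A\otimes_{B^+}\lambda$ has a simple head $L(\lambda)$; $\lambda\mapsto L(\lambda)$ is a bijection $\operatorname{Irr}\mathcal{G}(T)\to\operatorname{Irr}\mathcal{G}(A)$; $P(\lambda)$ is the projective cover of $L(\lambda)$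 in $\mathcal{G}(A)$. Each $P(\lambda)$ has a finite filtration with subquotients of the form $\Delta(\mu)$, and $[P(\lambda):\Delta(\mu)]$ is the number of times $\Delta(\mu)$ occurs (independent of the filtration); $[\Delta(\mu):L(\lambda)]$ is the composition multiplicity in $\mathcal{G}(A)$. $(-)^{\circledast}$ is the $K$-linear dual $\operatorname{Hom}_K(-,K)$ viewed as a contravariant functor exchanging left and right modules, with grading $(M^{\circledast})_i=(M_{-i})^{*}$. So $B^-\simeq(B^+)^\circledast$ as graded $T$-bimodules means $B^-_i\simeq \operatorname{Hom}_K(B^+_{-i},K)$ as $T$-bimodules for all $i\in\mathbb{Z}$, with the usual bimodule structure $(sft)(b)=f(tbs)$ for $s,t\in T$. *)

(* Defs.v *)
From HB Require Import structures.
From mathcomp Require Import all_boot all_order all_algebra all_field.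
From mathcomp Require Import boolp.

Set Implicit Arguments.
Unset Strict Implicit.
Unset Printing Implicit Defensive.

Import Order.TTheory GRing.Theory Num.Theory.
Local Open Scope ring_scope.

(** Gradings *)

Definition is_grading (K : fieldType) (V : vectType K)
    (gr : int -> {vspace V}) : Prop :=
  exists s : seq int,
    [/\ uniq s, forall i, i \notin s -> gr i = 0%VS,
        (\sum_(i <- s) gr i)%VS = fullv & directv (\sum_(i <- s) gr i)].

Definition homogeneous_subspace (K : fieldType) (V : vectType K)
    (gr : int -> {vspace V}) (U : {vspace V}) : Prop :=
  exists s : seq int, (U <= \sum_(i <- s) (U :&: gr i))%VS.

Definition graded_algebra (K : fieldType) (A : falgType K)
    (gr : int -> {vspace A}) : Prop :=
  [/\ is_grading gr, 1 \in gr 0 & forall i j, (gr i * gr j <= gr (i + j)%R)%VS].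

(* The identity of an {aspace A} may differ from that of A; here subalgebras
   are unital. *)
Definition graded_subalgebra (K : fieldType) (A : falgType K)
    (gr : int -> {vspace A}) (S : {aspace A}) : Prop :=
  1 \in S /\ homogeneous_subspace gr S.

Definition sub_grading (K : fieldType) (A : falgType K)
    (gr : int -> {vspace A}) (S : {aspace A}) (i : int) :
    {vspace subvs_of S} :=
  (linfun (vsval : subvs_of S -> A) @^-1: gr i)%VS.

(** Modules *)

(* All algebras here are finite-dimensional, so finitely generated modules are
   the modules that are finite-dimensional over K. *)
Record lmodule (K : fieldType) (R : falgType K) := LModule {
  lm_car :> vectType K;
  act : {linear R -> 'End(lm_car)};
  act1 : act 1 = \1%VF;
  actM : forall a b, act (a * b) = (act a \o act b)%VF }.
Arguments act {K R} M : rename.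

Section Modules.
Variables (K : fieldType) (R : falgType K).
Implicit Types M N : lmodule R.

Definition submodule M (U : {vspace M}) : Prop :=
  forall a x, x \in U -> act M a x \in U.

Definition simple_submodule M (U : {vspace M}) : Prop :=
  [/\ submodule U, U <> 0%VS &
      forall V : {vspace M}, submodule V -> (V <= U)%VS -> V = 0%VS \/ V = U].

Definition simple_module M : Prop := simple_submodule (fullv : {vspace M}).

Definition semisimple_module M : Prop :=
  exists s : seq {vspace M},
    [/\ forall U, U \in s -> simple_submodule U,
        (\sum_(U <- s) U)%VS = fullv & directv (\sum_(U <- s) U)].

Definition module_hom M N (f : 'Hom(M, N)) : Prop :=
  forall a x, f (act M a x) = act N a (f x).

Lemma regular_act1 : amull (1 : R) = \1%VF.
Proof. exact: amull1. Qed.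

Lemma regular_actM (a b : R) : amull (a * b) = (amull a \o amull b)%VF.
Proof. by apply/lfunP => x; rewrite comp_lfunE !lfunE /= mulrA. Qed.

Definition regular_module : lmodule R :=
  @LModule K R R (@amull K R) regular_act1 regular_actM.

Definition semisimple_algebra : Prop := semisimple_module regular_module.

Definition split_algebra : Prop :=
  forall M, simple_module M ->
  forall f : 'End(M), module_hom f -> exists c : K, f = c *: \1%VF.

End Modules.

(** The category of finitely generated graded left modules *)

Record gmodule (K : fieldType) (R : falgType K) (Rgr : int -> {vspace R}) :=
  GModule {
    gm_lmodule :> lmodule R;
    gm_gr : int -> {vspace gm_lmodule};
    gm_grP : is_grading gm_gr;
    gm_actP : forall i j a x, a \in Rgr i -> x \in gm_gr j ->
                act gm_lmodule a x \in gm_gr (i + j) }.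
Arguments gm_gr {K R Rgr} M i : rename.

Section GradedModules.
Variables (K : fieldType) (R : falgType K) (Rgr : int -> {vspace R}).
Implicit Types M N P L D : gmodule Rgr.

Definition gsubmodule M (U : {vspace M}) : Prop :=
  submodule U /\ homogeneous_subspace (gm_gr M) U.

Definition ghom M N (f : 'Hom(M, N)) : Prop :=
  module_hom f /\ forall i, (f @: gm_gr M i <= gm_gr N i)%VS.

Definition gsurj M N (f : 'Hom(M, N)) : Prop := ghom f /\ limg f = fullv.

Definition gsimple M : Prop :=
  (fullv : {vspace M}) <> 0%VS /\
  forall U : {vspace M}, gsubmodule U -> U = 0%VS \/ U = fullv.

Definition gmaximal M (U : {vspace M}) : Prop :=
  [/\ gsubmodule U, U <> fullv &
      forall V : {vspace M}, gsubmodule V -> (U <= V)%VS -> V = U \/ V = fullv].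

(* L is isomorphic to the quotient of M by its radical, the intersection of
   the maximal graded submodules *)
Definition is_head M L : Prop :=
  exists2 f : 'Hom(M, L), gsurj f &
    forall x, x \in lker f <-> forall U : {vspace M}, gmaximal U -> x \in U.

Definition gprojective P : Prop :=
  forall M N (g : 'Hom(M, N)) (f : 'Hom(P, N)), gsurj g -> ghom f ->
  exists2 h : 'Hom(P, M), ghom h & (g \o h)%VF = f.

Definition is_projective_cover P L : Prop :=
  gprojective P /\
  exists2 p : 'Hom(P, L), gsurj p &
    forall U : {vspace P}, gsubmodule U -> (U + lker p)%VS = fullv -> U = fullv.

(* U / V is isomorphic to D in the category of graded modules, for graded
   submodules V <= U of M. Only the restriction of f to U matters. *)
Definition subquotient_iso M (U V : {vspace M}) D : Prop :=
  exists f : 'Hom(M, D),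
    [/\ forall a x, x \in U -> f (act M a x) = act D a (f x),
        forall i, (f @: (U :&: gm_gr M i) <= gm_gr D i)%VS,
        (f @: U)%VS = fullv & (U :&: lker f)%VS = V].

Definition filtration (C : gmodule Rgr -> Prop) M (n : nat)
    (F : nat -> {vspace M}) : Prop :=
  [/\ F 0%N = 0%VS, F n = fullv, forall i, (i <= n)%N -> gsubmodule (F i) &
      forall i, (i < n)%N -> (F i <= F i.+1)%VS /\
        exists2 D, C D & subquotient_iso (F i.+1) (F i) D].

Definition occurrences D M (n : nat) (F : nat -> {vspace M}) : nat :=
  #|[set i : 'I_n | `[< subquotient_iso (F i.+1) (F i) D >]]|.

(* M has a filtration with subquotients in C, and D occurs m times as a
   subquotient in every such filtration *)
Definition multiplicity (C : gmodule Rgr -> Prop) M D (m : nat) : Prop :=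
  (exists n F, @filtration C M n F) /\
  (forall n F, @filtration C M n F -> occurrences D n F = m).

Definition composition_multiplicity M L (m : nat) : Prop :=
  multiplicity gsimple M L m.

End GradedModules.

(** Triangular decompositions *)

Section Triangular.
Variables (K : fieldType) (A : falgType K) (gr : int -> {vspace A}).

Definition trilinear (U V W X : vectType K) (f : U -> V -> W -> X) : Prop :=
  [/\ forall v w, linear (fun u => f u v w),
      forall u w, linear (fun v => f u v w) &
      forall u v, linear (fun w => f u v w)].

(* (X, f) is a tensor product of U, V and W over K *)
Definition is_tensor3 (U V W X : vectType K) (f : U -> V -> W -> X) : Prop :=
  trilinear f /\
  forall (Y : vectType K) (g : U -> V -> W -> Y), trilinear g ->
    exists! h : 'Hom(X, Y), forall u v w, h (f u v w) = g u v w.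

Definition triangular_decomposition (Am T Ap : {aspace A}) : Prop :=
  [/\ [/\ graded_subalgebra gr Am, graded_subalgebra gr T &
          graded_subalgebra gr Ap],
      (* the multiplication map from the tensor product to A is bijective *)
      is_tensor3 (fun (x : subvs_of Am) (t : subvs_of T) (y : subvs_of Ap) =>
                    vsval x * vsval t * vsval y),
      [/\ (T <= gr 0)%VS, forall i : int, i < 0 -> (Ap :&: gr i)%VS = 0%VS &
          forall i : int, 0 < i -> (Am :&: gr i)%VS = 0%VS],
      (Am :&: gr 0)%VS = 1%VS /\ (Ap :&: gr 0)%VS = 1%VS &
      [/\ (Ap * T)%VS = (T * Ap)%VS, (Am * T)%VS = (T * Am)%VS &
          split_algebra (subvs_of T)]].

(* The subalgebra generated by S and T *)
Definition Bsub (S T : {aspace A}) : {aspace A} := agenv_aspace (S + T).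

(* U is isomorphic to Hom_K(V, K) as a T-bimodule, where
   (s f t)(v) = f (t v s). The primed variables are s u t in U and t v s in V. *)
Definition dual_bimodule_iso (T : {aspace A}) (U V : {vspace A}) : Prop :=
  exists phi : 'Hom(subvs_of U, 'Hom(subvs_of V, K^o)),
    bijective phi /\
    forall (s t : A) (u u' : subvs_of U) (v v' : subvs_of V),
      s \in T -> t \in T ->
      vsval u' = s * vsval u * t -> vsval v' = t * vsval v * s ->
      phi u' v = phi u v'.

Definition graded_dual_bimodule_iso (T Bm Bp : {aspace A}) : Prop :=
  forall i : int, dual_bimodule_iso T (Bm :&: gr i) (Bp :&: gr (- i)).

(* The graph of the quotient map B^+ -> T killing positive degrees *)
Definition Bplus_quotient (T Ap : {aspace A}) (b : A) (t : subvs_of T) : Prop :=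
  b \in Bsub Ap T /\
  exists2 s : seq int, all (fun i : int => 0 < i) s &
    b - vsval t \in (\sum_(i <- s) (Bsub Ap T :&: gr i))%VS.

Definition balanced (T Ap : {aspace A}) (la : gmodule (sub_grading gr T))
    (V : vectType K) (f : A -> la -> V) : Prop :=
  [/\ forall x, linear (fun a => f a x), forall a, linear (f a) &
      forall a b t x, Bplus_quotient Ap b t -> f (a * b) x = f a (act la t x)].

(* D is isomorphic to the tensor product of A and la over B^+, where la is
   inflated along B^+ -> T *)
Definition is_Delta (T Ap : {aspace A}) (la : gmodule (sub_grading gr T))
    (D : gmodule gr) : Prop :=
  exists tau : A -> la -> D,
    [/\ balanced Ap tau,
        forall (V : vectType K) (f : A -> la -> V), balanced Ap f ->
          exists! h : 'Hom(D, V), forall a x, h (tau a x) = f a x,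
        forall a b x, tau (a * b) x = act D a (tau b x) &
        forall i j a x, a \in gr i -> x \in gm_gr la j ->
          tau a x \in gm_gr D (i + j)].

Definition Delta_multiplicity (T Ap : {aspace A}) (P D : gmodule gr)
    (m : nat) : Prop :=
  multiplicity
    (fun E => exists2 nu : gmodule (sub_grading gr T),
       gsimple nu & is_Delta Ap nu E) P D m.

End Triangular.

(* Main.v *)
Require Import Defs.
From HB Require Import structures.
From mathcomp Require Import all_boot all_order all_algebra all_field.
From mathcomp Require Import boolp.

(** Let [nabla] be the costandard module with the same highest weight as
    [Delta mu], the coinduced counterpart of the induced module [Delta mu]. Both
    multiplicities in the reciprocity law equal the dimension of [Hom(P, nabla)]:
    the multiplicity of [Delta mu] in [P] because standard filtrations are dual to
    costandard modules, and that of [L] in [Delta mu] because the duality of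
    [B^-] and [B^+] gives [nabla] and [Delta mu] the same composition factors.

    Weights are pairs of a primitive idempotent [e] of [T] and a degree [m],
    standing for the simple module [T e] placed in degree [m]. The standard module
    of this weight is the cyclic module [A / (A (1 - e) + Iplus)], where [Iplus]
    is the left ideal generated by the elements of positive degree ([Delta_std],
    [std_Delta]). Simple modules are cyclic as well, and isomorphisms between
    cyclic modules amount to equalities of annihilators ([giso_cyclic]). The
    module [nabla] is realised inside the dual of [A]. Let [(e, m)] be the weight
    of [Delta mu].

    - The projective cover [P] of [L] is a summand [A f] of the regular module
      ([projective_cover_summand]). Hence [Hom(P, M)] is [f M_d], its dimension
      is additive in [M], and it counts the composition factors of [M] that are
      isomorphic to [L] ([composition_multiplicity_ch]).

    - The regular module is free over [A^-], as is expressed by the maps contracting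
      the first factor of [A = A^- (x) T (x) A^+] ([contraction_free]). This property passes to the summand [P]. Adjoining
      generators in decreasing degree then produces a filtration of [P] by
      standard modules ([level_step]), in which [Delta mu] occurs as often as the
      dimension of [e (P / A P_{> m})_m] says ([Delta_filtration_count]). That
      space is dual to [Hom(P, nabla)] ([chi_nabla_cover]), so that
      [[P : Delta mu] = dim Hom(P, nabla) = [nabla : L]].

    - In degree [j] the part of [nabla] cut out by a primitive idempotent [e'] is
      dual to [e B^+_{m - j} e'] ([chi_nabla]), that of [Delta mu] is
      [e' B^-_{j - m} e] ([ch_std_corner]). The duality of [B^-] and [B^+] makes
      their dimensions equal ([dim_corner]). Thus [nabla] and [Delta mu] have the
      same graded [T]-character.

    - Simple modules and standard modules are each triangular with respect to
      highest weights, so a total character determines the number of members of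
      each isomorphism class ([characters_determine]). For standard modules this
      shows that all filtrations of [P] give the same multiplicity
      ([Delta_occurrences_unique]). For simple modules it gives
      [[nabla : L] = [Delta mu : L]] ([ch_comp]), which completes the proof. *)

Set Implicit Arguments.
Unset Strict Implicit.
Unset Printing Implicit Defensive.

Import Order.TTheory GRing.Theory Num.Theory.
Local Open Scope ring_scope.

(** * Linear algebra *)

Section LinearAlgebra.
Variable K : fieldType.
Implicit Types U V W X : vectType K.

Lemma linfun_linear V W (f : V -> W) : linear f -> linfun f =1 f.
Proof.
move=> lf.
pose g : {linear V -> W} := HB.pack f (GRing.isLinear.Build _ _ _ _ f lf).
exact: (lfunE g).
Qed.

(** The universal property of the quotient of [U] by the kernel of [f]. *)
Lemma lfun_factor V W X (f : 'Hom(V, W)) (g : 'Hom(V, X)) (U : {vspace V}) :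
    (f @: U)%VS = fullv -> (U :&: lker f <= lker g)%VS ->
  exists h : 'Hom(W, X), forall x, x \in U -> h (f x) = g x.
Proof.
move=> fU kfg; pose r := (f \o projv U)%VF.
exists (g \o projv U \o r^-1)%VF => x Ux.
have rU : limg r = fullv by rewrite limg_comp limg_proj.
rewrite !comp_lfunE; set y := projv U _.
have rx : r (r^-1%VF (f x)) = f x by rewrite limg_lfunVK // rU memvf.
rewrite comp_lfunE -/y in rx.
apply/eqP; rewrite -subr_eq0 -linearB -memv_ker.
apply: (subvP kfg); rewrite memv_cap memvB ?memv_proj //=.
by rewrite memv_ker linearB /= rx subrr.
Qed.

(** Compose the projection along [U] with a coordinate that does not vanish at
    the image of [v]. *)
Lemma functional_separation V (U : {vspace V}) v : v \notin U ->
  exists2 f : 'Hom(V, K^o), f v != 0 & forall u, u \in U -> f u = 0.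
Proof.
move=> Uv; pose g := (\1 - projv U : 'End(V))%VF.
have gE x : g x = x - projv U x by rewrite add_lfunE opp_lfunE id_lfunE.
have gv0 : g v != 0.
  by apply: contra Uv; rewrite gE subr_eq0 => /eqP ->; rewrite memv_proj.
pose c i : V -> K^o := fun x => coord (vbasis fullv) i x.
have lc i : linear (c i) by move=> a x y; rewrite /c linearP.
have [i ci] : exists i, c i (g v) != 0.
  apply/existsP; apply: contraR gv0; rewrite negb_exists => /forallP c0.
  rewrite (coord_vbasis (memvf (g v))) big1 // => i _.
  by have := c0 i; rewrite negbK /c => /eqP ->; rewrite scale0r.
exists (linfun (c i) \o g)%VF => [|u Uu]; rewrite comp_lfunE linfun_linear //.
by rewrite gE projv_id // subrr /c linear0.
Qed.

(** A pairing that is nondegenerate on the left embeds the left space in the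
    dual of the right one. *)
Lemma dimv_le_pairing V W (b : V -> W -> K) (V0 : {vspace V}) (W0 : {vspace W}) :
    (forall w, scalar (b^~ w)) -> (forall v, scalar (b v)) ->
    (forall v, v \in V0 -> (forall w, w \in W0 -> b v w = 0) -> v = 0) ->
  (\dim V0 <= \dim W0)%N.
Proof.
move=> lbl lbr ndeg.
pose f (v : V) : 'rV[K]_(\dim W0) := \row_i b v (vbasis W0)`_i.
have lf : linear f by move=> k x y; apply/rowP => i; rewrite !mxE lbl.
have k0 : (V0 :&: lker (linfun f) = 0)%VS.
  apply/eqP; rewrite -subv0; apply/subvP => v /memv_capP[V0v].
  rewrite memv_ker linfun_linear // => /eqP fv0; rewrite memv0; apply/eqP.
  apply: ndeg => // w /coord_vbasis ->.
  have lb0 : b v 0 = 0 by have := lbr v (-1) 0 0; rewrite scaler0 addr0 mulN1r addNr.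
  have lbD x y : b v (x + y) = b v x + b v y.
    by have := lbr v 1 x y; rewrite scale1r mul1r.
  rewrite (big_morph (b v) lbD lb0) big1 // => i _.
  have := lbr v (coord (vbasis W0) i w) (vbasis W0)`_i 0.
  rewrite !addr0 lb0 addr0 => ->.
  by move/rowP: fv0 => /(_ i); rewrite !mxE => ->; rewrite mulr0.
rewrite -(limg_dim_eq k0).
have := dimvS (subvf (linfun f @: V0)%VS).
by rewrite dimvf dim_matrix => h; rewrite -[leqRHS]mul1n.
Qed.

Lemma memv_sum_seq V (I : Type) (s : seq I) (x : I -> V) (Us : I -> {vspace V}) :
  (forall i, x i \in Us i) -> \sum_(i <- s) x i \in (\sum_(i <- s) Us i)%VS.
Proof.
by move=> xU; elim/big_rec2: _ => [|i U u _ uU]; [apply: mem0v | apply: memv_add].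
Qed.

Lemma directv_seq V (I : Type) (i0 : I) (s : seq I) (Us : I -> {vspace V}) :
  directv (\sum_(i <- s) Us i) = directv (\sum_(k < size s) Us (nth i0 s k)).
Proof.
rewrite !directvE /= (big_nth i0) big_mkord; congr (_ == _).
by rewrite (big_nth i0) big_mkord.
Qed.

End LinearAlgebra.

(** * Gradings *)

Section Grading.
Variables (K : fieldType) (V : vectType K) (gr : int -> {vspace V}).

(** A grading is the same as its system of projections. *)
Lemma is_grading_intro (s : seq int) (q : int -> 'End(V)) :
    uniq s -> (forall i, i \notin s -> gr i = 0%VS) ->
    (forall i x, q i x \in gr i) -> (forall x, \sum_(i <- s) q i x = x) ->
    (forall i j x, x \in gr j -> q i x = if i == j then x else 0) ->
  is_grading gr.
Proof.
move=> us s0 qgr qsum qid; exists s; split => //.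
  apply/eqP; rewrite eqEsubv subvf /=; apply/subvP => x _.
  by rewrite -(qsum x); apply: memv_sum_seq => i; apply: qgr.
rewrite (directv_seq 0); apply/directv_sum_independent => u gu su i _.
have := congr1 (q s`_i) su; rewrite linear0 linear_sum /= (bigD1 i) //=.
rewrite (qid _ _ _ (gu i _)) // eqxx big1 ?addr0 // => j ji.
by rewrite (qid _ _ _ (gu j _)) // nth_uniq // val_eqE eq_sym (negbTE ji).
Qed.

Hypothesis grP : is_grading gr.

Definition gsupp : seq int := sval (cid grP).

Lemma gsuppP : [/\ uniq gsupp, forall i, i \notin gsupp -> gr i = 0%VS,
  (\sum_(i <- gsupp) gr i)%VS = fullv & directv (\sum_(i <- gsupp) gr i)].
Proof. exact: (svalP (cid grP)). Qed.

Definition gpr (i : int) : 'End(V) :=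
  sumv_pi_for (erefl (\sum_(i <- gsupp) gr i)%VS) i.

Lemma gpr_in i v : gpr i v \in gr i.
Proof. exact: memv_sum_pi. Qed.

Lemma gpr_sum v : \sum_(i <- gsupp) gpr i v = v.
Proof.
have [us _ sf _] := gsuppP.
by apply: sumv_pi_uniq_sum; rewrite ?filter_predT ?sf ?memvf.
Qed.

Lemma gpr_id i j v : v \in gr j -> gpr i v = if i == j then v else 0.
Proof.
have [us s0 sf ds] := gsuppP => gv.
have gout k w : k \notin gsupp -> w \in gr k -> w = 0.
  by move=> /s0 ->; rewrite memv0 => /eqP.
case: (boolP (j \in gsupp)) => [js|/gout/(_ gv) ->]; last by rewrite linear0 if_same.
case: (boolP (i \in gsupp)) => [is_|ni]; last first.
  rewrite (gout _ _ ni (gpr_in i v)); case: eqP => // ij.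
  by rewrite ij js in ni.
have {ds} : directv (\sum_(k < size gsupp) gr gsupp`_k)%VS.
  by rewrite -(directv_seq 0).
pose u (k : 'I_(size gsupp)) := gpr gsupp`_k v - (if gsupp`_k == j then v else 0).
move/directv_sum_independent => /(_ u) uP.
have /(nthP 0)[k ks <-] := is_.
apply/eqP; rewrite -subr_eq0; apply/eqP; apply: (uP _ _ (Ordinal ks)) => //.
  move=> l _; rewrite memvB ?gpr_in //; case: eqP => [->|_] //; exact: mem0v.
rewrite sumrB -[RHS](subrr v); congr (_ - _).
  by rewrite -[RHS]gpr_sum [RHS](big_nth 0) [RHS]big_mkord.
have /(nthP 0)[l ls jl] := js.
rewrite (bigD1 (Ordinal ls)) //= jl eqxx big1 ?addr0 // => m ml.
by rewrite -jl nth_uniq // -[l]/(val (Ordinal ls)) val_eqE (negbTE ml).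
Qed.

Lemma gpr_notin i : i \notin gsupp -> gr i = 0%VS.
Proof. by have [_ h _ _] := gsuppP; apply: h. Qed.

Lemma homogeneousP (U : {vspace V}) :
  homogeneous_subspace gr U <-> forall i u, u \in U -> gpr i u \in U.
Proof.
split=> [[s Us] i u /(subvP Us)|Ui].
  rewrite (big_nth 0) big_mkord => /memv_sumP[w gw ->].
  rewrite linear_sum /=; apply: memv_suml => k _.
  have /memv_capP[Uw gwk] := gw k isT.
  by rewrite (gpr_id _ gwk); case: eqP; rewrite ?mem0v.
exists gsupp; apply/subvP => u Uu; rewrite -(gpr_sum u).
by apply: memv_sum_seq => i; rewrite memv_cap gpr_in Ui.
Qed.

Lemma gpr_rest j (U : {vspace V}) x :
  (forall i, i != j -> gpr i x \in U) -> x - gpr j x \in U.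
Proof.
move=> hU; rewrite -{1}(gpr_sum x); have [us _ _ _] := gsuppP.
case: (boolP (j \in gsupp)) => [js|/gpr_notin jout].
  rewrite (big_rem j) //= addrAC subrr add0r big_seq memv_suml // => i.
  by rewrite mem_rem_uniq // inE => /andP[/hU].
have x0 : gpr j x = 0 by apply/eqP; rewrite -memv0 -jout gpr_in.
rewrite x0 subr0 memv_suml // => i _; have [->|/hU //] := eqVneq i j.
by rewrite x0 mem0v.
Qed.

(** The support of a grading is finite. This is what provides highest weights
    and lets filtrations proceed by decreasing degree. *)
Lemma grading_max (Q : int -> Prop) :
    (forall i, gr i = 0%VS -> ~ Q i) -> (exists i, Q i) ->
  exists2 i, Q i & forall j, i < j -> ~ Q j.
Proof.
move=> Q0 [i0 Qi0].
have Qs i : Q i -> i \in [seq j <- gsupp | `[< Q j >]].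
  rewrite mem_filter => Qi; rewrite asboolT //=.
  by apply: contraPT Qi => /gpr_notin; apply: Q0.
have [m] : exists2 m, m \in [seq j <- gsupp | `[< Q j >]]
    & forall j, j \in [seq j <- gsupp | `[< Q j >]] -> j <= m.
  case: {Qs} [seq _ <- _ | _] (Qs _ Qi0) => // a s _.
  elim: s a => [|b s IH] a; first by exists a; rewrite ?mem_head // => j /[!inE]/eqP->.
  have [m ms mP] := IH b; case: (leP a m) => am.
    by exists m => [|j]; rewrite in_cons ?ms ?orbT // => /orP[/eqP->|/mP].
  exists a => [|j]; rewrite in_cons ?eqxx // => /orP[/eqP->|/mP jm] //.
  exact: le_trans (ltW am).
rewrite mem_filter => /andP[/asboolP Qm _] mP; exists m => // j mj /Qs/mP.
by rewrite leNgt mj.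
Qed.

End Grading.

Lemma sub_is_grading (K : fieldType) (V : vectType K) (gr : int -> {vspace V})
    (grP : is_grading gr) (W : {vspace V}) :
    (forall i x, x \in W -> gpr grP i x \in W) ->
  is_grading (fun i => linfun (vsval : subvs_of W -> V) @^-1: gr i)%VS.
Proof.
move=> Wh; have [us s0 _ _] := gsuppP grP.
pose q i : 'End(subvs_of W) :=
  (linfun (vsproj W) \o gpr grP i \o linfun (vsval : subvs_of W -> V))%VF.
have qE i x : vsval (q i x) = gpr grP i (vsval x).
  by rewrite !comp_lfunE !lfunE /= vsprojK // Wh ?subvsP.
have mem_pre i (x : subvs_of W) :
    (x \in linfun (vsval : subvs_of W -> V) @^-1: gr i)%VS = (vsval x \in gr i).
  by rewrite -memv_preim lfunE.
apply: (@is_grading_intro _ _ _ (gsupp grP) q) => //.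
- move=> i /s0 g0; apply/eqP; rewrite -subv0; apply/subvP => x.
  by rewrite mem_pre g0 !memv0 => /eqP x0; apply/eqP/subvs_inj.
- by move=> i x; rewrite mem_pre qE gpr_in.
- move=> x; apply: subvs_inj; rewrite linear_sum /= -[RHS](gpr_sum grP).
  by apply: eq_bigr => i _; rewrite qE.
- move=> i j x; rewrite mem_pre => gx; apply: subvs_inj; rewrite qE.
  by rewrite (gpr_id _ _ gx); case: eqP.
Qed.

(** * Modules and graded modules *)

Section ActLinear.
Variables (K : fieldType) (R : falgType K).
Implicit Types M N : lmodule R.

Lemma actDl M a b x : act M (a + b) x = act M a x + act M b x.
Proof. by rewrite linearD add_lfunE. Qed.
Lemma actBl M a b x : act M (a - b) x = act M a x - act M b x.
Proof. by rewrite linearB add_lfunE opp_lfunE. Qed.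
Lemma actZl M k a x : act M (k *: a) x = k *: act M a x.
Proof. by rewrite linearZ scale_lfunE. Qed.
Lemma act0l M x : act M 0 x = 0.
Proof. by rewrite linear0 zero_lfunE. Qed.
Lemma act1l M x : act M 1 x = x.
Proof. by rewrite act1 id_lfunE. Qed.
Lemma actMl M a b x : act M (a * b) x = act M a (act M b x).
Proof. by rewrite actM comp_lfunE. Qed.

Definition orb M (x : M) : 'Hom(R, M) := linfun (fun a => act M a x).

Lemma orbE M (x : M) a : orb x a = act M a x.
Proof.
by rewrite /orb linfun_linear // => k b c; rewrite linearP add_lfunE scale_lfunE.
Qed.

Lemma mem_orb M (x : M) a : act M a x \in limg (orb x).
Proof. by rewrite -orbE memv_img ?memvf. Qed.

Lemma orb_self M (x : M) : x \in limg (orb x).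
Proof. by rewrite -{1}(act1l x) mem_orb. Qed.

Lemma orb_sub M (U : {vspace M}) x : submodule U -> x \in U -> (limg (orb x) <= U)%VS.
Proof. by move=> sU Ux; apply/subvP => _ /memv_imgP[a _ ->]; rewrite orbE sU. Qed.

Lemma submodule_orb M (x : M) : submodule (limg (orb x)).
Proof. by move=> a _ /memv_imgP[b _ ->]; rewrite orbE -actMl mem_orb. Qed.

Lemma submoduleD M (U V : {vspace M}) :
  submodule U -> submodule V -> submodule (U + V)%VS.
Proof.
move=> sU sV a _ /memv_addP[u Uu [v Vv ->]].
by rewrite linearD; apply: memv_add; [apply: sU | apply: sV].
Qed.

(** The quotient [U / V] is realised on the image of [U] under a projection [r]
    with kernel [V]: the action is that of [M] followed by [r]. *)
Section Subquotient.
Variables (M : lmodule R) (U V : {vspace M}) (r : 'End(M)).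
Hypotheses (sU : submodule U) (sV : submodule V).
Hypotheses (rV : forall x, r x - x \in V) (rV0 : forall x, x \in V -> r x = 0).

Local Notation car := (subvs_of (r @: U)%VS).

Let r_mod x y : x - y \in V -> r x = r y.
Proof. by move/rV0/eqP; rewrite linearB subr_eq0 => /eqP. Qed.

Let r_id (x : car) : r (vsval x) = vsval x.
Proof. by have /memv_imgP[u _ ->] := subvsP x; apply: r_mod; apply: rV. Qed.

Let in_U (x : car) : exists2 u, u \in U & vsval x - u \in V.
Proof. by have /memv_imgP[u Uu ->] := subvsP x; exists u; rewrite ?rV. Qed.

Definition subq_fun (a : R) (x : car) : car :=
  vsproj (r @: U)%VS (r (act M a (vsval x))).

Lemma subq_funE a x : vsval (subq_fun a x) = r (act M a (vsval x)).
Proof.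
rewrite vsprojK //; have [u Uu xu] := in_U x.
have -> : r (act M a (vsval x)) = r (act M a u).
  by apply: r_mod; rewrite -linearB sV.
by rewrite memv_img ?sU.
Qed.

Definition subq_end a : 'End(car) := linfun (subq_fun a).

Lemma subq_endE a x : subq_end a x = subq_fun a x.
Proof.
rewrite /subq_end linfun_linear // => k y z; apply: subvs_inj.
rewrite subq_funE [RHS]linearP /= !subq_funE.
by rewrite -!linearP.
Qed.

Lemma subq_end_linear : linear subq_end.
Proof.
move=> k a b; apply/lfunP => x; rewrite add_lfunE scale_lfunE !subq_endE.
apply: subvs_inj; rewrite subq_funE [RHS]linearP /= !subq_funE.
by rewrite actDl actZl linearP.
Qed.

Definition subq_act : {linear R -> 'End(car)} :=
  HB.pack subq_end (GRing.isLinear.Build _ _ _ _ subq_end subq_end_linear).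

Lemma subq_act1 : subq_act 1 = \1%VF.
Proof.
apply/lfunP => x; rewrite id_lfunE subq_endE; apply: subvs_inj.
by rewrite subq_funE act1l r_id.
Qed.

Lemma subq_actM a b : subq_act (a * b) = (subq_act a \o subq_act b)%VF.
Proof.
apply/lfunP => x; rewrite comp_lfunE !subq_endE; apply: subvs_inj.
rewrite !subq_funE actMl; apply: r_mod.
by rewrite -linearB sV // -opprB memvN rV.
Qed.

Definition subq_lmodule : lmodule R := LModule subq_act1 subq_actM.

Definition subq_proj : 'Hom(M, subq_lmodule) := (linfun (vsproj (r @: U)%VS) \o r)%VF.

Lemma subq_projE x : x \in U -> vsval (subq_proj x) = r x.
Proof. by move=> Ux; rewrite comp_lfunE lfunE /= vsprojK ?memv_img. Qed.

Lemma subq_proj_img : (subq_proj @: U)%VS = fullv.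
Proof.
apply/eqP; rewrite eqEsubv subvf; apply/subvP => x _.
have /memv_imgP[u Uu xu] := subvsP x; apply/memv_imgP; exists u => //.
by apply: subvs_inj; rewrite subq_projE.
Qed.

Lemma subq_proj_ker : (V <= U)%VS -> (U :&: lker subq_proj)%VS = V.
Proof.
move=> VU; apply/vspaceP => x; rewrite memv_cap memv_ker.
apply/andP/idP => [[Ux /eqP x0]|Vx].
  have := rV x; rewrite -subq_projE // x0 /= sub0r memvN; exact.
by have Ux := subvP VU _ Vx; split=> //; apply/eqP/subvs_inj; rewrite subq_projE ?rV0.
Qed.

Lemma subq_proj_act a x : x \in U -> subq_proj (act M a x) = act subq_lmodule a (subq_proj x).
Proof.
move=> Ux; rewrite /= subq_endE; apply: subvs_inj.
rewrite subq_projE ?sU // subq_funE subq_projE //.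
by apply: r_mod; rewrite -linearB sV // -opprB memvN rV.
Qed.

End Subquotient.

End ActLinear.

Section GModules.
Variables (K : fieldType) (R : falgType K) (Rgr : int -> {vspace R}).
Implicit Types M N D X Y : gmodule Rgr.

Definition gp M (i : int) : 'End(M) := gpr (gm_grP M) i.

Lemma gp_in M i (x : M) : gp M i x \in gm_gr M i.
Proof. exact: gpr_in. Qed.
Lemma gp_id M i j (x : M) : x \in gm_gr M j -> gp M i x = if i == j then x else 0.
Proof. exact: gpr_id. Qed.
Lemma gp_same M i (x : M) : x \in gm_gr M i -> gp M i x = x.
Proof. by move/(gp_id i); rewrite eqxx. Qed.
Lemma gp_sum M (x : M) : \sum_(i <- gsupp (gm_grP M)) gp M i x = x.
Proof. exact: gpr_sum. Qed.

Lemma gp_actl M i r a (x : M) : a \in Rgr r ->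
  gp M i (act M a x) = act M a (gp M (i - r) x).
Proof.
move=> ga; rewrite -{1}(gp_sum x) !linear_sum /=.
rewrite -[in RHS](gp_sum x) !linear_sum /=; apply: eq_bigr => j _.
rewrite (gp_id _ (gm_actP ga (gp_in j x))) (gp_id _ (gp_in j x)).
by rewrite [r + j]addrC -subr_eq; case: eqP; rewrite ?linear0.
Qed.

Lemma gp_actr M (hR : is_grading Rgr) i s a (x : M) : x \in gm_gr M s ->
  gp M i (act M a x) = act M (gpr hR (i - s) a) x.
Proof.
move=> gx; rewrite -{1}(gpr_sum hR a) -!orbE !linear_sum /=.
rewrite -[in RHS](gpr_sum hR a) !linear_sum /=; apply: eq_bigr => j _.
rewrite !orbE (gp_id _ (gm_actP (gpr_in hR j a) gx)) (gpr_id _ _ (gpr_in hR j a)).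
by rewrite subr_eq; case: eqP; rewrite ?act0l.
Qed.

Lemma gp_hom M (U : {vspace M}) i x : gsubmodule U -> x \in U -> gp M i x \in U.
Proof. by case=> _ /(homogeneousP (gm_grP M)) h; apply: h. Qed.

Lemma gsubmoduleP M (U : {vspace M}) :
  submodule U -> (forall i x, x \in U -> gp M i x \in U) -> gsubmodule U.
Proof. by move=> sU hU; split=> //; apply/(homogeneousP (gm_grP M)). Qed.

Lemma gsubmodule0 M : gsubmodule (0%VS : {vspace M}).
Proof.
by apply: gsubmoduleP => [a x|i x]; rewrite !memv0 => /eqP->; rewrite linear0.
Qed.

Lemma gsubmodulef M : gsubmodule (fullv : {vspace M}).
Proof. by apply: gsubmoduleP => [a x|i x] _; rewrite memvf. Qed.

Lemma gsubmoduleD M (U V : {vspace M}) :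
  gsubmodule U -> gsubmodule V -> gsubmodule (U + V)%VS.
Proof.
move=> gU gV; apply: gsubmoduleP => [|i _ /memv_addP[u Uu [v Vv ->]]].
  exact: (submoduleD gU.1 gV.1).
by rewrite linearD; apply: memv_add; apply: gp_hom.
Qed.

Lemma gsubmodule_orb M d (x : M) : is_grading Rgr -> x \in gm_gr M d ->
  gsubmodule (limg (orb x)).
Proof.
move=> hR gx; apply: gsubmoduleP => [|i _ /memv_imgP[b _ ->]].
  exact: submodule_orb.
by rewrite orbE (gp_actr hR _ _ gx) mem_orb.
Qed.

Lemma ghom_gp M N (f : 'Hom(M, N)) i x :
  (forall i, (f @: gm_gr M i <= gm_gr N i)%VS) -> f (gp M i x) = gp N i (f x).
Proof.
move=> fg; rewrite -[in RHS](gp_sum x) !linear_sum /=.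
rewrite -{1}(gp_sum x) !linear_sum /=; apply: eq_bigr => j _.
have fj : f (gp M j x) \in gm_gr N j.
  by apply: (subvP (fg j)); rewrite memv_img ?gp_in.
by rewrite (gp_id _ fj) (gp_id _ (gp_in j x)); case: eqP; rewrite ?linear0.
Qed.

(** Projecting degree by degree onto complements of the components of [V] makes
    the projection, hence the quotient, graded. *)
Lemma subquotient_exists M (U V : {vspace M}) :
    gsubmodule U -> gsubmodule V -> (V <= U)%VS ->
  exists D, subquotient_iso U V D.
Proof.
move=> gU gV VU.
pose r : 'End(M) :=
  (\1 - \sum_(i <- gsupp (gm_grP M)) (projv (V :&: gm_gr M i)%VS \o gp M i))%VF.
have rE x : r x = x - \sum_(i <- gsupp (gm_grP M)) projv (V :&: gm_gr M i)%VS (gp M i x).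
  rewrite add_lfunE opp_lfunE id_lfunE sum_lfunE; congr (_ - _).
  by apply: eq_bigr => i _; rewrite comp_lfunE.
have pV i x : projv (V :&: gm_gr M i)%VS x \in V.
  by have /memv_capP[] := memv_proj (V :&: gm_gr M i)%VS x.
have rV x : r x - x \in V.
  by rewrite rE addrAC subrr sub0r memvN memv_suml.
have rV0 x : x \in V -> r x = 0.
  move=> Vx; rewrite rE -[X in X - _](gp_sum x) -sumrB big1 // => i _.
  by rewrite projv_id ?subrr // memv_cap gp_in gp_hom.
have rg i x : x \in gm_gr M i -> r x \in gm_gr M i.
  move=> gx; rewrite rE memvB // memv_suml // => j _.
  rewrite (gp_id _ gx); case: eqP => [->|_]; last by rewrite linear0 mem0v.
  by have /memv_capP[] := memv_proj (V :&: gm_gr M i)%VS x.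
have rgp i x : r (gp M i x) = gp M i (r x).
  by apply: ghom_gp => j; apply/subvP => _ /memv_imgP[y gy ->]; apply: rg.
have hW i x : x \in (r @: U)%VS -> gpr (gm_grP M) i x \in (r @: U)%VS.
  by move=> /memv_imgP[u Uu ->]; rewrite -[gpr _ _]/(gp M i) -rgp memv_img ?gp_hom.
pose N := subq_lmodule gU.1 gV.1 rV rV0.
have actP i j a (x : N) : a \in Rgr i ->
    x \in (linfun (vsval : subvs_of (r @: U) -> M) @^-1: gm_gr M j)%VS ->
    act N a x \in (linfun (vsval : subvs_of (r @: U) -> M) @^-1: gm_gr M (i + j))%VS.
  rewrite -!memv_preim !lfunE /= => ga gx; rewrite (subq_endE gU.1 gV.1 rV rV0).
  by rewrite (subq_funE gU.1 gV.1 rV rV0) rg // gm_actP.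
exists (@GModule K R Rgr N _ (sub_is_grading hW) actP); exists (subq_proj gU.1 gV.1 rV rV0).
split=> [a x Ux|i||].
- exact: subq_proj_act.
- apply/subvP => _ /memv_imgP[x /memv_capP[Ux gx] ->] /=.
  by rewrite -memv_preim lfunE /= subq_projE ?rg.
- exact: subq_proj_img.
- exact: subq_proj_ker.
Qed.

End GModules.

(** * Subquotients and graded characters *)

Section Characters.
Variables (K : fieldType) (R : falgType K) (Rgr : int -> {vspace R}).
Hypothesis hR : is_grading Rgr.
Implicit Types M N D X Y Z : gmodule Rgr.

Definition giso X Y : Prop :=
  exists f : 'Hom(X, Y), [/\ ghom f, lker f = 0%VS & limg f = fullv].

Lemma subq_gp M (U : {vspace M}) D (f : 'Hom(M, D)) i x :
    gsubmodule U -> (forall i, (f @: (U :&: gm_gr M i) <= gm_gr D i)%VS) ->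
  x \in U -> f (gp M i x) = gp D i (f x).
Proof.
move=> gU fg Ux; rewrite -[in RHS](gp_sum x) !linear_sum /=.
rewrite -{1}(gp_sum x) !linear_sum /=; apply: eq_bigr => j _.
have fj : f (gp M j x) \in gm_gr D j.
  by apply: (subvP (fg j)); rewrite memv_img // memv_cap gp_in gp_hom.
by rewrite (gp_id _ fj) (gp_id _ (gp_in j x)); case: eqP; rewrite ?linear0.
Qed.

(** Both sides are the quotient of [U] by the kernel, so [lfun_factor] compares
    them; counting the steps isomorphic to [Y] in a filtration thereby becomes
    counting factors up to isomorphism. *)
Lemma subquotient_iso_unique M (U V : {vspace M}) X Y :
    gsubmodule U -> subquotient_iso U V X ->
  subquotient_iso U V Y <-> giso X Y.
Proof.
move=> gU [f [fa fg fU fk]]; split=> [[g [ga gg gU' gk]]|[h [[ha hg] hk hi]]].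
  have kfg : (U :&: lker f <= lker g)%VS by rewrite fk -gk capvSr.
  have [h hf] := lfun_factor fU kfg.
  have fsurj y : exists2 x, x \in U & y = f x.
    have /memv_imgP[x Ux yx] : y \in (f @: U)%VS by rewrite fU memvf.
    by exists x.
  exists h; split; first split.
  - by move=> a y; have [x Ux ->] := fsurj y; rewrite -fa ?hf ?ga // gU.1.
  - move=> i; apply/subvP => _ /memv_imgP[y yi ->]; have [x Ux xy] := fsurj y.
    have -> : y = f (gp M i x) by rewrite (subq_gp _ gU) // -xy gp_same.
    have Ui := gp_hom i gU Ux.
    by rewrite hf //; apply: (subvP (gg i)); rewrite memv_img // memv_cap Ui gp_in.
  - apply/eqP; rewrite -subv0; apply/subvP => y; rewrite memv_ker memv0.
    have [x Ux ->] := fsurj y; rewrite hf // => gx0.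
    have: x \in (U :&: lker g)%VS by rewrite memv_cap Ux memv_ker.
    by rewrite gk -fk => /memv_capP[_]; rewrite memv_ker.
  - apply/eqP; rewrite eqEsubv subvf -gU'; apply/subvP => _ /memv_imgP[x Ux ->].
    by rewrite -hf // memv_img ?memvf.
exists (h \o f)%VF; split.
- by move=> a x Ux; rewrite !comp_lfunE fa // ha.
- by move=> i; rewrite limg_comp; apply: subv_trans (hg i); apply: limgS.
- by rewrite limg_comp fU.
- rewrite -fk; apply/vspaceP => x; rewrite !memv_cap !memv_ker comp_lfunE.
  by rewrite -memv_ker hk memv0.
Qed.

Lemma subquotient_preim M (U : {vspace M}) X (f : 'Hom(M, X)) (W : {vspace X}) :
    (forall a x, x \in U -> f (act M a x) = act X a (f x)) ->
    (forall i, (f @: (U :&: gm_gr M i) <= gm_gr X i)%VS) ->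
  gsubmodule U -> gsubmodule W -> gsubmodule (U :&: f @^-1: W)%VS.
Proof.
move=> fa fg gU gW; apply: gsubmoduleP => [a x|i x] /memv_capP[Ux].
  by rewrite -memv_preim memv_cap gU.1 // -memv_preim fa // => /(gW.1 a).
rewrite -memv_preim => Wx.
by rewrite memv_cap gp_hom // -memv_preim (subq_gp _ gU) // gp_hom.
Qed.

Lemma giso_subquotient X Y : giso X Y -> subquotient_iso (fullv : {vspace X}) 0 Y.
Proof.
case=> f [[fa fg] fk fi]; exists f; split=> //; last by rewrite capfv.
by move=> i; rewrite capfv.
Qed.

Lemma subquotient_self X : subquotient_iso (fullv : {vspace X}) 0 X.
Proof.
exists \1%VF; split=> [a x _|i||].
- by rewrite !id_lfunE.
- by rewrite lim1g capfv.
- exact: lim1g.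
by apply/vspaceP => x; rewrite capfv memv_ker id_lfunE memv0.
Qed.

Lemma giso_sym X Y : giso X Y -> giso Y X.
Proof.
move/giso_subquotient => XY.
exact/(subquotient_iso_unique _ (gsubmodulef X) XY)/subquotient_self.
Qed.

Lemma giso_trans X Y Z : giso X Y -> giso Y Z -> giso X Z.
Proof.
move/giso_subquotient => XY /(subquotient_iso_unique _ (gsubmodulef X) XY).
by move/(subquotient_iso_unique _ (gsubmodulef X) (subquotient_self X)).
Qed.

(** Both modules are the quotient of [R] by the common annihilator of their
    generators. *)
Lemma giso_cyclic X Y d (x : X) (y : Y) :
    x \in gm_gr X d -> y \in gm_gr Y d ->
    limg (orb x) = fullv -> limg (orb y) = fullv ->
    (forall a, act X a x = 0 <-> act Y a y = 0) ->
  giso X Y.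
Proof.
move=> gx gy ox oy xy.
have kxy : (fullv :&: lker (orb x) <= lker (orb y))%VS.
  by apply/subvP => a; rewrite capfv !memv_ker !orbE => /eqP/xy/eqP.
have [h hx] := lfun_factor ox kxy.
have {}hx a : h (act X a x) = act Y a y by rewrite -!orbE hx ?memvf.
have cyc z : exists a, z = act X a x.
  have: z \in limg (orb x) by rewrite ox memvf.
  by case/memv_imgP => a _ ->; exists a; rewrite orbE.
exists h; split; first split.
- by move=> a z; have [b ->] := cyc z; rewrite -actMl !hx actMl.
- move=> i; apply/subvP => _ /memv_imgP[z zi ->]; have [a za] := cyc z.
  have -> : z = act X (gpr hR (i - d) a) x by rewrite -(gp_actr hR) // -za gp_same.
  by rewrite hx -(gp_actr hR) // gp_in.
- apply/eqP; rewrite -subv0; apply/subvP => z; have [a ->] := cyc z.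
  by rewrite memv_ker memv0 hx => /eqP/xy ->.
- apply/eqP; rewrite eqEsubv subvf -oy; apply/subvP => _ /memv_imgP[a _ ->].
  by rewrite orbE -hx memv_img ?memvf.
Qed.

(** The dimension of [e U_j]. For an idempotent [e] of degree 0 the functor
    [M |-> e M_j] is exact, so these numbers are additive; they form the graded
    character of [M]. *)
Definition chi M (e : R) (j : int) (U : {vspace M}) : nat :=
  \dim (act M e @: (U :&: gm_gr M j))%VS.

Definition ch M e j := chi e j (fullv : {vspace M}).

Lemma mem_eM M (e : R) j (U : {vspace M}) x : e \in Rgr 0 -> e * e = e ->
    gsubmodule U ->
  (x \in act M e @: (U :&: gm_gr M j))%VS =
  [&& x \in U, x \in gm_gr M j & act M e x == x].
Proof.
move=> e0 ee gU; apply/memv_imgP/and3P => [[y /memv_capP[Uy yj] ->]|[Ux xj /eqP ex]].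
  by split; rewrite ?gU.1 // -?actMl ?ee // -[j]add0r gm_actP.
by exists x; rewrite ?memv_cap ?Ux.
Qed.

Lemma chi_exact M (U V : {vspace M}) D e j :
    e \in Rgr 0 -> e * e = e -> gsubmodule U -> gsubmodule V ->
  subquotient_iso U V D -> chi e j U = (chi e j V + ch D e j)%N.
Proof.
move=> e0 ee gU gV [f [fa fg fU fk]].
rewrite /ch /chi -[LHS](limg_ker_dim f); congr addn; congr (\dim _).
  apply/vspaceP => x; rewrite memv_cap !mem_eM // -fk memv_cap.
  by case: (x \in U) => //=; rewrite andbC.
apply/vspaceP => y; rewrite mem_eM ?memvf //=; last exact: gsubmodulef.
apply/memv_imgP/andP => [[x + ->]|[yj /eqP ey]].
  rewrite mem_eM // => /and3P[Ux xj /eqP ex]; rewrite -fa // ex; split=> //.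
  by apply: (subvP (fg j)); rewrite memv_img // memv_cap Ux.
have /memv_imgP[x Ux yx] : y \in (f @: U)%VS by rewrite fU memvf.
have Uxj := gp_hom j gU Ux.
exists (act M e (gp M j x)); last by rewrite fa // (subq_gp _ gU) // -yx gp_same.
by rewrite memv_img // memv_cap gp_hom // gp_in.
Qed.

Lemma chi0 M e j : chi e j (0%VS : {vspace M}) = 0%N.
Proof. by rewrite /chi cap0v limg0 dimv0. Qed.

Lemma ch_giso X Y e j : e \in Rgr 0 -> e * e = e -> giso X Y -> ch X e j = ch Y e j.
Proof.
move=> e0 ee /giso_subquotient i; rewrite /ch (chi_exact _ _ _ _ _ i) //.
- by rewrite chi0.
- exact: gsubmodulef.
- exact: gsubmodule0.
Qed.

Lemma ch_gt0 M e j x : x \in gm_gr M j -> act M e x != 0 -> (0 < ch M e j)%N.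
Proof.
move=> xj ex; rewrite /ch /chi capfv lt0n dimv_eq0; apply: contra ex => /eqP e0.
by rewrite -memv0 -e0 memv_img.
Qed.

Lemma ch_neq0 M e j : e \in Rgr 0 -> e * e = e -> ch M e j <> 0%N ->
  exists2 x, x \in gm_gr M j & act M e x = x /\ x != 0.
Proof.
move=> e0 ee; rewrite /ch /chi => /eqP; rewrite dimv_eq0 -subv0 => /subvPn[x].
rewrite mem_eM ?memvf //; last exact: gsubmodulef.
by case/and3P=> _ xj /eqP ex; rewrite memv0; exists x.
Qed.

(** * Filtrations *)

Lemma telescope_nat (m c : nat -> nat) n :
    (forall i, (i < n)%N -> m i.+1 = (m i + c i)%N) ->
  m n = (m 0 + \sum_(i < n) c i)%N.
Proof.
elim: n => [|n IH] mS; first by rewrite big_ord0 addn0.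
by rewrite big_ord_recr /= mS // IH ?addnA // => i /ltnW; apply: mS.
Qed.

Section Filtrations.
Variable C : gmodule Rgr -> Prop.

Lemma filtration_factors M n F : filtration C (M := M) n F ->
  exists D : 'I_n -> gmodule Rgr,
    forall i : 'I_n, C (D i) /\ subquotient_iso (F i.+1) (F i) (D i).
Proof.
case=> _ _ _ Fs.
have h (i : 'I_n) : exists D, C D /\ subquotient_iso (F i.+1) (F i) D.
  by have [_ [D CD sD]] := Fs i (ltn_ord i); exists D.
by have [D DP] := choice h; exists D.
Qed.

Lemma ch_filtration M n F (D : 'I_n -> gmodule Rgr) e j :
    e \in Rgr 0 -> e * e = e -> filtration C (M := M) n F ->
    (forall i : 'I_n, subquotient_iso (F i.+1) (F i) (D i)) ->
  ch M e j = (\sum_i ch (D i) e j)%N.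
Proof.
move=> e0 ee [F0 Fn Fg _] Fs; pose c i := oapp (fun k => ch (D k) e j) 0%N (insub i).
have cE (k : 'I_n) : c k = ch (D k) e j by rewrite /c valK.
rewrite -(eq_bigr _ (fun k _ => cE k)) /ch -Fn.
rewrite (@telescope_nat (fun k => chi e j (F k)) c) ?F0 ?chi0 // => k kn.
rewrite (chi_exact j e0 ee _ _ (Fs (Ordinal kn))) -?(cE (Ordinal kn)) //.
- exact: Fg.
- exact/Fg/ltnW.
Qed.

Lemma occurrences_sum M n F (D : 'I_n -> gmodule Rgr) X :
    filtration C (M := M) n F ->
    (forall i : 'I_n, subquotient_iso (F i.+1) (F i) (D i)) ->
  occurrences X n F = (\sum_i `[< giso (D i) X >])%N.
Proof.
case=> _ _ Fg _ Fs; rewrite /occurrences -sum1_card big_mkcond /=.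
apply: eq_bigr => i _; rewrite inE -(asbool_equiv_eq (subquotient_iso_unique X _ (Fs i))).
  by case: asboolP.
exact: Fg.
Qed.

(** Filtrations are built upwards from 0, one step at a time; [S F F'] is what
    is required of consecutive terms and [Inv] an invariant of the terms. *)
Lemma chain_exists M (Inv : {vspace M} -> Prop) (S : {vspace M} -> {vspace M} -> Prop) :
    Inv 0%VS ->
    (forall F : {vspace M}, gsubmodule F -> Inv F -> F <> fullv ->
      exists F' : {vspace M},
        [/\ gsubmodule F', Inv F', (F <= F')%VS, F <> F' & S F F']) ->
  exists n F, [/\ F 0%N = 0%VS, F n = fullv, forall i, (i <= n)%N -> gsubmodule (F i)
    & forall i, (i < n)%N -> (F i <= F i.+1)%VS /\ S (F i) (F i.+1)].
Proof.
move=> Inv0 step.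
suff build k (F : {vspace M}) : gsubmodule F -> Inv F ->
    (\dim (fullv : {vspace M}) - \dim F < k)%N ->
  exists n G, [/\ G 0%N = F, G n = fullv, forall i, (i <= n)%N -> gsubmodule (G i)
    & forall i, (i < n)%N -> (G i <= G i.+1)%VS /\ S (G i) (G i.+1)].
  by apply: (build _ _ (gsubmodule0 M) Inv0 (ltnSn _)).
elim: k F => [//|k IH] F gF IF dF; have [Ff|Ff] := EM (F = fullv).
  by exists 0%N, (fun=> F); split.
have [F' [gF' IF' FF' neF SF]] := step F gF IF Ff.
have [|n [G [G0 Gn Gg Gs]]] := IH F' gF' IF'.
  have dFF' : (\dim F < \dim F')%N.
    by rewrite ltn_neqAle dimvS // andbT (dimv_leqif_eq FF'); apply/eqP.
  rewrite -ltnS; apply: leq_trans dF; rewrite !ltnS ltn_sub2l //.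
  by apply: leq_trans dFF' _; apply/dimvS/subvf.
exists n.+1, (fun i => if i is i'.+1 then G i' else F); split=> //.
- by case.
- by case=> [|i] /= iN; [rewrite G0 | apply: Gs].
Qed.

End Filtrations.

(** A family of modules whose members are recognised among themselves by their
    weight (an idempotent [e] and a degree [d] above which the module vanishes)
    is determined up to isomorphism, with multiplicities, by its total
    character: one splits off a member of maximal weight and proceeds by
    induction. Applied to simple modules this contains the Jordan-Hoelder
    theorem; applied to standard modules it shows that their multiplicities do
    not depend on the filtration. *)
Section Triangularity.
Variables (C : gmodule Rgr -> Prop) (E : R -> Prop) (wt : gmodule Rgr -> R * int).
Hypothesis EP : forall e, E e -> e \in Rgr 0 /\ e * e = e.
Hypothesis wtP : forall X, C X ->
  [/\ E (wt X).1,
      forall j : int, (wt X).2 < j -> gm_gr X j = 0%VS,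
      ch X (wt X).1 (wt X).2 <> 0%N &
      forall Y, C Y -> (forall j : int, (wt X).2 < j -> gm_gr Y j = 0%VS) ->
        ch Y (wt X).1 (wt X).2 <> 0%N -> giso X Y].

Definition same_ch (I J : finType) (X : I -> gmodule Rgr) (Y : J -> gmodule Rgr)
    (A : {set I}) (B : {set J}) : Prop :=
  forall e j, E e -> (\sum_(i in A) ch (X i) e j = \sum_(i in B) ch (Y i) e j)%N.

(** The weight of [X i] occurs in the total character of the other family, in
    some [Y j]; maximality of its degree makes it the weight of [Y j] too. *)
Lemma triangular_match (I J : finType) (X : I -> gmodule Rgr) (Y : J -> gmodule Rgr)
    (A : {set I}) (B : {set J}) i :
    (forall i, C (X i)) -> (forall i, C (Y i)) -> same_ch X Y A B -> i \in A ->
    (forall j, j \in B -> (wt (Y j)).2 <= (wt (X i)).2) ->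
  exists2 j, j \in B & giso (X i) (Y j).
Proof.
move=> CX CY s iA iB; have [Ee Xt Xn Xu] := wtP (CX i).
have /eqP := s _ (wt (X i)).2 Ee; rewrite (bigD1 i) //= => sN.
have [j jB jn] : exists2 j, j \in B & ch (Y j) (wt (X i)).1 (wt (X i)).2 <> 0%N.
  apply: contrapT => no; move: sN; rewrite [X in _ == X]big1 => [|j jB].
    by rewrite addn_eq0 => /andP[/eqP/Xn].
  by apply: contrapT => jn; apply: no; exists j.
exists j => //; apply: Xu jn => // k ik.
have [_ Yt _ _] := wtP (CY j).
by apply: Yt; apply: le_lt_trans ik; apply: iB.
Qed.

Lemma triangularity_sets (w : gmodule Rgr -> nat) (I J : finType)
    (X : I -> gmodule Rgr) (Y : J -> gmodule Rgr) (A : {set I}) (B : {set J}) :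
    (forall X Y, C X -> C Y -> giso X Y -> w X = w Y) ->
    (forall i, C (X i)) -> (forall i, C (Y i)) -> same_ch X Y A B ->
  (\sum_(i in A) w (X i) = \sum_(i in B) w (Y i))%N.
Proof.
move=> wi CX CY.
have rm i j (A' : {set I}) (B' : {set J}) : i \in A' -> j \in B' -> w (X i) = w (Y j) ->
    (forall e k, E e -> ch (X i) e k = ch (Y j) e k) ->
    (same_ch X Y (A' :\ i) (B' :\ j) ->
      (\sum_(k in A' :\ i) w (X k) = \sum_(k in B' :\ j) w (Y k))%N) ->
    same_ch X Y A' B' -> (\sum_(i in A') w (X i) = \sum_(i in B') w (Y i))%N.
  move=> iA jB wij cij IH s; rewrite (big_setD1 i iA) (big_setD1 j jB) wij; congr addn; apply: IH.
  move=> e k Ee; have := s e k Ee.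
  by rewrite (big_setD1 i iA) (big_setD1 j jB) cij // => /addnI.
move: {2}#|A| (erefl #|A|) => n.
elim: n A B => [|n IH] A B cA s.
  have A0 : A = set0 by apply/eqP; rewrite -cards_eq0 cA.
  rewrite A0 big_set0; case: (set_0Vmem B) => [->|[j jB]]; first by rewrite big_set0.
  have [Ee _ Yn _] := wtP (CY j); have := s _ (wt (Y j)).2 Ee.
  rewrite A0 big_set0 (big_setD1 j) //= => /esym/eqP.
  by rewrite addn_eq0 => /andP[/eqP/Yn].
have [i0 i0A] : exists i, i \in A by apply/card_gt0P; rewrite cA.
have [j0 j0B] : exists j, j \in B.
  case: (set_0Vmem B) => [B0|[j jB]]; last by exists j.
  have [Ee _ Xn _] := wtP (CX i0); have := s _ (wt (X i0)).2 Ee.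
  rewrite B0 big_set0 (big_setD1 i0) //= => /eqP.
  by rewrite addn_eq0 => /andP[/eqP/Xn].
have [i iA iM] := arg_maxP (fun i => (wt (X i)).2) i0A.
have [j jB jM] := arg_maxP (fun j => (wt (Y j)).2) j0B.
have cD k : k \in A -> #|A :\ k| = n.
  by move=> kA; apply/eqP; rewrite -eqSS -cA (cardsD1 k A) kA.
have [ji|ij] := leP (wt (Y j)).2 (wt (X i)).2.
  have [|k kB ik] := triangular_match CX CY s iA.
    by move=> k kB; apply: le_trans ji; apply: jM.
  apply: (rm i k) => //; first exact: wi.
    by move=> e l /EP[e0 ee]; apply: ch_giso.
  by apply: IH; rewrite cD.
have s' : same_ch Y X B A by move=> e k Ee; rewrite s.
have [|k kA jk] := triangular_match CY CX s' jB.
  by move=> k kA; apply: le_trans (ltW ij); apply: iM.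
apply: (rm k j) => //; first exact/esym/wi.
  by move=> e l /EP[e0 ee]; apply/esym/ch_giso.
by apply: IH; rewrite cD.
Qed.

Lemma triangularity (w : gmodule Rgr -> nat) (I J : finType)
    (X : I -> gmodule Rgr) (Y : J -> gmodule Rgr) :
    (forall X Y, C X -> C Y -> giso X Y -> w X = w Y) ->
    (forall i, C (X i)) -> (forall i, C (Y i)) ->
    (forall e j, E e -> (\sum_i ch (X i) e j = \sum_i ch (Y i) e j)%N) ->
  (\sum_i w (X i) = \sum_i w (Y i))%N.
Proof.
move=> wi CX CY s.
have := @triangularity_sets w I J X Y [set: I] [set: J] wi CX CY.
rewrite !(eq_bigl _ _ (in_setT (T := _))); apply=> e j Ee.
by rewrite !(eq_bigl _ _ (in_setT (T := _))) s.
Qed.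

End Triangularity.

Lemma characters_determine (C : gmodule Rgr -> Prop) (E : R -> Prop)
    (w : gmodule Rgr -> nat) (I J : finType)
    (X : I -> gmodule Rgr) (Y : J -> gmodule Rgr) :
    (forall e, E e -> e \in Rgr 0 /\ e * e = e) ->
    (forall X, C X -> exists e d, [/\ E e,
      forall j : int, d < j -> gm_gr X j = 0%VS, ch X e d <> 0%N &
      forall Y, C Y -> (forall j : int, d < j -> gm_gr Y j = 0%VS) ->
        ch Y e d <> 0%N -> giso X Y]) ->
    (forall X Y, C X -> C Y -> giso X Y -> w X = w Y) ->
    (forall i, C (X i)) -> (forall i, C (Y i)) ->
    (forall e j, E e -> (\sum_i ch (X i) e j = \sum_i ch (Y i) e j)%N) ->
  (\sum_i w (X i) = \sum_i w (Y i))%N.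
Proof.
move=> EP wt wi CX CY s.
have /choice[p pP] : forall X, exists p : R * int, C X -> [/\ E p.1,
      forall j : int, p.2 < j -> gm_gr X j = 0%VS, ch X p.1 p.2 <> 0%N &
      forall Y, C Y -> (forall j : int, p.2 < j -> gm_gr Y j = 0%VS) ->
        ch Y p.1 p.2 <> 0%N -> giso X Y].
  move=> Z; have [CZ|CZ] := EM (C Z); last by exists (0, 0).
  by have [e [d h]] := wt Z CZ; exists (e, d).
exact: (triangularity EP pP wi CX CY s).
Qed.

(** * Composition series *)

(** Each step is a graded submodule of least dimension above the previous one. *)
Lemma composition_series_exists M : exists n F, filtration (@gsimple K R Rgr) (M := M) n F.
Proof.
have [|n [F [F0 Fn Fg Fs]]] := @chain_exists M (fun=> True)
    (fun F F' => exists2 D, gsimple D & subquotient_iso F' F D) I; last first.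
  by exists n, F; split.
move=> F gF _ Ff.
pose Q (k : nat) := `[< exists F' : {vspace M},
  [/\ gsubmodule F', (F <= F')%VS, F <> F' & \dim F' = k] >].
have exQ : exists k, Q k.
  exists (\dim (fullv : {vspace M})); apply/asboolP; exists fullv; split=> //.
    exact: gsubmodulef.
  exact: subvf.
case: (ex_minnP exQ) => k /asboolP[F' [gF' FF' neF dF']] kmin.
exists F'; split=> //; have [D sD] := subquotient_exists gF' gF FF'.
exists D => //; have [f [fa fg fU fk]] := sD; split.
  move=> D0; apply: neF; rewrite -fk; apply/capv_idPl.
  by rewrite lkerE fU D0.
move=> W gW; have gW' := subquotient_preim fa fg gF' gW.
pose W' := (F' :&: f @^-1: W)%VS.
have FW' : (F <= W')%VS.
  apply/subvP => x Fx; rewrite memv_cap (subvP FF') //= -memv_preim.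
  by move: Fx; rewrite -fk => /memv_capP[_]; rewrite memv_ker => /eqP->; rewrite mem0v.
have [FW|FW] := EM (F = W').
  left; apply/eqP; rewrite -subv0; apply/subvP => y Wy.
  have /memv_imgP[x Fx yx] : y \in (f @: F')%VS by rewrite fU memvf.
  have : x \in F by rewrite FW memv_cap Fx -memv_preim -yx.
  by rewrite -fk memv_cap memv_ker -yx memv0 => /andP[].
right; have WF' : (F' <= W')%VS.
  have WF : (W' <= F')%VS by apply: capvSl.
  rewrite -(geq_leqif (dimv_leqif_sup WF)) dF'; apply: kmin; apply/asboolP.
  by exists W'; split.
apply/eqP; rewrite eqEsubv subvf /= -fU; apply/subvP => _ /memv_imgP[x Fx ->].
by move/subvP/(_ x Fx): WF'; rewrite memv_cap -memv_preim => /andP[].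
Qed.

End Characters.

(** * Submodules generated in high degrees *)

Section Generation.
Variables (K : fieldType) (R : falgType K) (Rgr : int -> {vspace R}).
Hypothesis hR : is_grading Rgr.
Implicit Types M N : gmodule Rgr.

(** Summing cyclic submodules over homogeneous bases makes [gen_gt], the
    submodule generated in degrees greater than [j], visibly graded. *)
Definition gen_deg M i : {vspace M} :=
  (\sum_(k < \dim (gm_gr M i)) limg (orb (vbasis (gm_gr M i))`_k))%VS.

Definition gen_gt M (j : int) : {vspace M} :=
  (\sum_(i <- gsupp (gm_grP M) | j < i) gen_deg M i)%VS.

Lemma gen_gt_sub M j (U : {vspace M}) :
    (forall i a x, j < i -> x \in gm_gr M i -> act M a x \in U) ->
  (gen_gt M j <= U)%VS.
Proof.
move=> hU; rewrite /gen_gt; elim/big_ind: _ => [|V W VU WU|i ji].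
- exact: sub0v.
- by rewrite subv_add VU.
apply/subv_sumP => k _; apply/subvP => _ /memv_imgP[a _ ->]; rewrite orbE.
by apply: (hU i) => //; apply: vbasis_mem; rewrite mem_nth ?size_tuple.
Qed.

Lemma mem_gen_gt M j i a (x : M) : j < i -> x \in gm_gr M i -> act M a x \in gen_gt M j.
Proof.
move=> ji xi; case: (boolP (i \in gsupp (gm_grP M))) => [si|/gpr_notin x0]; last first.
  by move: xi; rewrite x0 memv0 => /eqP->; rewrite linear0 mem0v.
have sub : (gen_deg M i <= gen_gt M j)%VS.
  rewrite /gen_gt (big_rem i) //= ji; exact: addvSl.
apply: (subvP sub); rewrite (coord_vbasis xi) linear_sum.
apply: memv_sumr => k _; rewrite linearZ; apply: memvZ; exact: mem_orb.
Qed.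

Lemma gsubmodule_gen_gt M j : gsubmodule (gen_gt M j).
Proof.
rewrite /gen_gt; elim/big_ind: _ => [|V W gV gW|i _].
- exact: gsubmodule0.
- exact: gsubmoduleD.
rewrite /gen_deg; elim/big_ind: _ => [|V W gV gW|k _].
- exact: gsubmodule0.
- exact: gsubmoduleD.
apply: (gsubmodule_orb (d := i)) => //.
by apply: vbasis_mem; rewrite mem_nth ?size_tuple.
Qed.

Lemma deg_gen_gt M j i (x : M) : j < i -> x \in gm_gr M i -> x \in gen_gt M j.
Proof. by move=> ji xi; rewrite -(act1l x) (mem_gen_gt _ ji). Qed.

Lemma ghom_gen_gt M N (f : 'Hom(M, N)) j x :
  ghom f -> x \in gen_gt M j -> f x \in gen_gt N j.
Proof.
move=> [fa fg] xM; rewrite memv_preim; apply: subvP xM.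
apply: gen_gt_sub => i a y ji yi; rewrite -memv_preim fa; apply: (mem_gen_gt _ ji).
by apply: (subvP (fg i)); rewrite memv_img.
Qed.

End Generation.

(** * The regular module *)

Section Regular.
Variables (K : fieldType) (R : falgType K) (Rgr : int -> {vspace R}).
Hypothesis hR : graded_algebra Rgr.

Lemma alg_grading : is_grading Rgr. Proof. by case: hR. Qed.

Lemma one_deg0 : 1 \in Rgr 0. Proof. by case: hR. Qed.

Lemma deg_mul i j a b : a \in Rgr i -> b \in Rgr j -> a * b \in Rgr (i + j).
Proof. by case: hR => _ _ h ai bj; apply: (subvP (h i j)); apply: memv_mul. Qed.

Lemma shift_grading (d : int) : is_grading (fun i => Rgr (i - d)).
Proof.
have [us s0 _ _] := gsuppP alg_grading.
apply: (@is_grading_intro _ _ _ [seq i + d | i <- gsupp alg_grading]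
  (fun i => gpr alg_grading (i - d))).
- by rewrite map_inj_uniq //; apply: addIr.
- by move=> i si; apply: s0; apply: contra si => si; apply/mapP; exists (i - d); rewrite ?subrK.
- by move=> i x; apply: gpr_in.
- move=> x; rewrite big_map -[RHS](gpr_sum alg_grading).
  by apply: eq_bigr => i _; rewrite addrK.
- by move=> i j x xj; rewrite (gpr_id _ _ xj) (inj_eq (addIr _)).
Qed.

Lemma reg_actP d i j a (x : regular_module R) :
  a \in Rgr i -> x \in Rgr (j - d) -> act (regular_module R) a x \in Rgr (i + j - d).
Proof. by move=> ai xj; rewrite lfunE /= -addrA deg_mul. Qed.

(** Shifted so that the generator 1 has degree [d]. *)
Definition reg d : gmodule Rgr :=
  @GModule K R Rgr (regular_module R) _ (shift_grading d) (@reg_actP d).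

Lemma reg_act d a (x : R) : act (reg d) a x = a * x.
Proof. by rewrite /= lfunE. Qed.

Local Notation pr := (gpr alg_grading).

Lemma pr_mull i r a x : a \in Rgr r -> pr i (a * x) = a * pr (i - r) x.
Proof.
move=> ar; rewrite -{1}(gpr_sum alg_grading x) mulr_sumr linear_sum /=.
rewrite -[in RHS](gpr_sum alg_grading x) linear_sum mulr_sumr /=.
apply: eq_bigr => j _.
rewrite (gpr_id _ _ (deg_mul ar (gpr_in _ j x))) (gpr_id _ _ (gpr_in _ j x)).
by rewrite [r + j]addrC -subr_eq; case: eqP; rewrite ?mulr0.
Qed.

Lemma pr_mulr i r a x : x \in Rgr r -> pr i (a * x) = pr (i - r) a * x.
Proof.
move=> xr; rewrite -{1}(gpr_sum alg_grading a) mulr_suml linear_sum /=.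
rewrite -[in RHS](gpr_sum alg_grading a) linear_sum mulr_suml /=.
apply: eq_bigr => j _.
rewrite (gpr_id _ _ (deg_mul (gpr_in _ j a) xr)) (gpr_id _ _ (gpr_in _ j a)).
by rewrite -subr_eq; case: eqP; rewrite ?mul0r.
Qed.

(** Elements of positive degree kill the vectors of highest degree of a module,
    and hence so does the left ideal [Iplus] that they generate. *)
Definition Iplus : {vspace R} := gen_gt (reg 0) 0.

Lemma Iplus_sub (U : {vspace R}) :
    (forall i a y, 0 < i -> y \in Rgr i -> a * y \in U) -> (Iplus <= U)%VS.
Proof.
move=> hU; apply: (@gen_gt_sub _ _ _ (reg 0) 0 U) => i a x i0 xi; rewrite reg_act.
by apply: (hU i) => //; rewrite -[i]subr0.
Qed.

Lemma mem_Iplus i a y : 0 < i -> y \in Rgr i -> a * y \in Iplus.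
Proof.
move=> i0 yi; rewrite -(reg_act 0).
by apply: (@mem_gen_gt _ _ _ (reg 0) 0 i) => //=; rewrite subr0.
Qed.

Lemma Iplus_left a y : y \in Iplus -> a * y \in Iplus.
Proof.
have [h _] := gsubmodule_gen_gt alg_grading (reg 0) 0.
by rewrite -(reg_act 0) => /(h a).
Qed.

Lemma Iplus_right t y : t \in Rgr 0 -> y \in Iplus -> y * t \in Iplus.
Proof.
move=> t0 yI; have -> : y * t = amulr t y by rewrite lfunE.
rewrite memv_preim; apply: subvP yI; apply: Iplus_sub => i a z i0 zi.
rewrite -memv_preim lfunE /= -mulrA; apply: (mem_Iplus _ i0).
by rewrite -[i]addr0 deg_mul.
Qed.

Lemma Iplus_top (M : gmodule Rgr) d (x : M) a :
    x \in gm_gr M d -> (forall j : int, d < j -> gm_gr M j = 0%VS) ->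
  a \in Iplus -> act M a x = 0.
Proof.
move=> xd top aI; apply/eqP; rewrite -orbE -memv_ker; apply: subvP aI.
apply: Iplus_sub => i b y i0 yi; rewrite memv_ker orbE actMl.
have : act M y x \in gm_gr M (i + d) by apply: gm_actP.
by rewrite top ?ltrDr // memv0 => /eqP->; rewrite linear0.
Qed.

End Regular.

(** * The structure of a triangular algebra *)

Section Structure.
Variables (K : fieldType) (A : falgType K) (gr : int -> {vspace A}).
Variables (Am T Ap : {aspace A}).
Hypothesis hA : graded_algebra gr.
Hypothesis htri : triangular_decomposition gr Am T Ap.

Local Notation hgr := (alg_grading hA).
Local Notation pr := (gpr hgr).
Local Notation Ip := (Iplus hA).

Lemma one_in : [/\ 1 \in Am, 1 \in T & 1 \in Ap].
Proof. by case: htri => -[[? _] [? _] [? _]]. Qed.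

Lemma T_deg0 t : t \in T -> t \in gr 0.
Proof. by case: htri => _ _ [h _ _] _ _; apply: (subvP h). Qed.

Lemma pr_Am i u : u \in Am -> pr i u \in Am.
Proof. by case: htri => -[[_ h] _ _] *; move/(homogeneousP hgr): h; apply. Qed.

Lemma pr_Ap i u : u \in Ap -> pr i u \in Ap.
Proof. by case: htri => -[_ _ [_ h]] *; move/(homogeneousP hgr): h; apply. Qed.

Lemma Am_pos (i : int) u : 0 < i -> u \in Am -> u \in gr i -> u = 0.
Proof.
case: htri => _ _ [_ _ h] _ _ i0 uA ui; apply/eqP.
by rewrite -memv0 -(h i i0) memv_cap uA.
Qed.

Lemma Ap_neg (i : int) u : i < 0 -> u \in Ap -> u \in gr i -> u = 0.
Proof.
case: htri => _ _ [_ h _] _ _ i0 uA ui; apply/eqP.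
by rewrite -memv0 -(h i i0) memv_cap uA.
Qed.

Lemma Am_0 u : u \in Am -> u \in gr 0 -> exists k, u = k%:A.
Proof.
case: htri => _ _ _ [h _] _ uA u0; apply/vlineP.
move: (memv_cap u Am (gr 0)); rewrite h uA u0; exact: id.
Qed.

Lemma Ap_0 u : u \in Ap -> u \in gr 0 -> exists k, u = k%:A.
Proof.
case: htri => _ _ _ [_ h] _ uA u0; apply/vlineP.
move: (memv_cap u Ap (gr 0)); rewrite h uA u0; exact: id.
Qed.

Local Notation tens := (fun (x : subvs_of Am) (t : subvs_of T) (y : subvs_of Ap) =>
  vsval x * vsval t * vsval y).

(** The products [u * t * c] span: otherwise two different maps would agree on
    them, against uniqueness in the universal property. *)
Lemma A_span (W : {vspace A}) :
  (forall u t c, u \in Am -> t \in T -> c \in Ap -> u * t * c \in W) ->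
  forall a, a \in W.
Proof.
case: htri => _ [_ univ] _ _ _ hW a.
have tri0 : trilinear (fun (u : subvs_of Am) (v : subvs_of T) (w : subvs_of Ap) => 0 : A).
  by split=> x y k z z'; rewrite scaler0 addr0.
have [h [_ hu]] := univ A _ tri0.
have h0 : h = 0 by apply: hu => u v w; rewrite zero_lfunE.
have h1 : h = (\1 - projv W)%VF.
  apply: hu => u v w; rewrite add_lfunE opp_lfunE id_lfunE projv_id ?subrr //.
  by apply: hW; apply: subvsP.
have /lfunP/(_ a) := etrans (esym h1) h0.
rewrite add_lfunE opp_lfunE id_lfunE zero_lfunE => /eqP; rewrite subr_eq0 => /eqP->.
exact: memv_proj.
Qed.

(** Applying a functional to the factor [A^-] of the tensor product
    [A = A^- T A^+] gives a map [A -> T A^+ = B^+]. They play the part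
    of coordinates of [A] as a free right module over [B^+]. *)
Definition contraction (xi : 'Hom(A, K^o)) (b : 'End(A)) : Prop :=
  forall u t c, u \in Am -> t \in T -> c \in Ap -> b (u * t * c) = (xi u : K) *: (t * c).

Lemma contraction_exists xi : exists b, contraction xi b.
Proof.
case: htri => _ [_ univ] _ _ _.
have tri : trilinear (fun (u : subvs_of Am) (v : subvs_of T) (w : subvs_of Ap) =>
    (xi (vsval u) : K) *: (vsval v * vsval w)).
  split=> [v w k x y|u w k x y|u v k x y] /=.
  - by rewrite linearP scalerDl scalerA.
  - by rewrite mulrDl scalerDr -scalerAl !scalerA mulrC.
  - by rewrite mulrDr scalerDr -scalerAr !scalerA mulrC.
have [b [bE _]] := univ A _ tri.
exists b => u t c uA tT cA.
by have := bE (Subvs uA) (Subvs tT) (Subvs cA).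
Qed.

(** ** The subalgebras generated by [T] and [A^+] or [A^-] *)

Lemma Bp_prod : Bsub Ap T = (T * Ap)%VS :> {vspace A}.
Proof.
have [_ T1 A1] := one_in; case: htri => _ _ _ _ [ApT _ _].
apply/eqP; rewrite eqEsubv; apply/andP; split.
  apply: agenv_sub_modl.
    apply/subvP => x /vlineP[k ->]; apply: memvZ.
    by rewrite -[1]mulr1 memv_mul.
  rewrite prodvDl subv_add; apply/andP; split.
    by rewrite prodvA ApT -prodvA prodv_id.
  by rewrite prodvA prodv_id.
by apply: prodv_sub; apply: subv_trans (sub_agenv _); [apply: addvSr | apply: addvSl].
Qed.

Lemma Bm_prod : Bsub Am T = (Am * T)%VS :> {vspace A}.
Proof.
have [A1 T1 _] := one_in; case: htri => _ _ _ _ [_ AmT _].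
apply/eqP; rewrite eqEsubv; apply/andP; split.
  apply: agenv_sub_modr.
    apply/subvP => x /vlineP[k ->]; apply: memvZ.
    by rewrite -[1]mulr1 memv_mul.
  rewrite prodvDr subv_add; apply/andP; split.
    by rewrite -prodvA -AmT prodvA prodv_id.
  by rewrite -prodvA prodv_id.
by apply: prodv_sub; apply: subv_trans (sub_agenv _); [apply: addvSl | apply: addvSr].
Qed.

Local Notation Bp := (Bsub Ap T).
Local Notation Bm := (Bsub Am T).

Lemma Bp_ind (W : {vspace A}) :
  (forall t c, t \in T -> c \in Ap -> t * c \in W) -> forall x, x \in Bp -> x \in W.
Proof.
move=> hW x; rewrite Bp_prod; apply: subvP.
by apply/prodvP => t c; apply: hW.
Qed.

Lemma Bm_ind (W : {vspace A}) :
  (forall u t, u \in Am -> t \in T -> u * t \in W) -> forall x, x \in Bm -> x \in W.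
Proof.
move=> hW x; rewrite Bm_prod; apply: subvP.
by apply/prodvP => u t; apply: hW.
Qed.

Lemma mem_Bp t c : t \in T -> c \in Ap -> t * c \in Bp.
Proof. by move=> tT cA; rewrite Bp_prod memv_mul. Qed.

Lemma mem_Bm u t : u \in Am -> t \in T -> u * t \in Bm.
Proof. by move=> uA tT; rewrite Bm_prod memv_mul. Qed.

Lemma T_Bp t : t \in T -> t \in Bp.
Proof. by move=> tT; have [_ _ h] := one_in; rewrite -[t]mulr1 mem_Bp. Qed.

Lemma T_Bm t : t \in T -> t \in Bm.
Proof. by move=> tT; have [h _ _] := one_in; rewrite -[t]mul1r mem_Bm. Qed.

Lemma pr_Bp i x : x \in Bp -> pr i x \in Bp.
Proof.
move=> xB; rewrite memv_preim; apply: Bp_ind xB => t c tT cA.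
by rewrite -memv_preim (pr_mull _ _ _ (T_deg0 tT)) mem_Bp ?pr_Ap.
Qed.

Lemma Bp_neg (i : int) x : i < 0 -> x \in Bp -> pr i x = 0.
Proof.
move=> i0 xB; apply/eqP; rewrite -memv_ker; apply: Bp_ind xB => t c tT cA.
rewrite memv_ker (pr_mull _ _ _ (T_deg0 tT)) subr0.
by rewrite (Ap_neg i0 (pr_Ap i cA) (gpr_in _ _ _)) mulr0.
Qed.

Lemma Bp_deg0 x : x \in Bp -> pr 0 x \in T.
Proof.
move=> xB; rewrite memv_preim; apply: Bp_ind xB => t c tT cA.
rewrite -memv_preim (pr_mull _ _ _ (T_deg0 tT)) subr0.
have [k ->] := Ap_0 (pr_Ap 0 cA) (gpr_in _ _ _).
by rewrite -scalerAr mulr1 memvZ.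
Qed.

(** Induction principle for homogeneous elements: project a product of [A^-] and
    [B^+] to degree [i] and expand its first factor. The bounds on [s] hold
    because [A^-] lives in degrees at most 0 and [B^+] in degrees at least 0. *)
Lemma gr_span (W : {vspace A}) i :
    (forall s u z, i <= s -> 0 <= s -> u \in Am -> u \in gr (i - s) ->
      z \in Bp -> z \in gr s -> u * z \in W) ->
  forall x, x \in gr i -> x \in W.
Proof.
move=> hW x xi.
suff: pr i x \in W by rewrite (gpr_id _ _ xi) eqxx.
rewrite memv_preim; apply: A_span => u t c uA tT cA; rewrite -memv_preim -mulrA.
have zB := mem_Bp tT cA; rewrite -(gpr_sum hgr u) mulr_suml linear_sum memv_suml //= => r _.
have ui := gpr_in hgr r u; rewrite (pr_mull _ _ _ ui).
have [r0|r0] := ltP 0 r; first by rewrite (Am_pos r0 (pr_Am r uA) ui) mul0r mem0v.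
have [s0|s0] := ltP (i - r) 0; first by rewrite (Bp_neg s0 zB) mulr0 mem0v.
apply: (hW (i - r)) => //; rewrite ?pr_Am ?pr_Bp ?gpr_in //.
  by rewrite lerBrDl gerDr.
by rewrite opprB addrC subrK.
Qed.

Section Contraction.
Variables (xi : 'Hom(A, K^o)) (b : 'End(A)).
Hypothesis bP : contraction xi b.

Lemma contraction_Bp a : b a \in Bp.
Proof.
rewrite memv_preim; apply: A_span => u t c uA tT cA.
by rewrite -memv_preim bP // memvZ // mem_Bp.
Qed.

Lemma contraction_mulBp u x : u \in Am -> x \in Bp -> b (u * x) = (xi u : K) *: x.
Proof.
move=> uA xB; apply/eqP; rewrite -subr_eq0.
have -> : b (u * x) - (xi u : K) *: x = (b \o amull u - (xi u : K) *: \1)%VF x.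
  by rewrite add_lfunE opp_lfunE scale_lfunE id_lfunE comp_lfunE lfunE.
rewrite -memv_ker; apply: Bp_ind xB => t c tT cA.
rewrite memv_ker add_lfunE opp_lfunE scale_lfunE id_lfunE comp_lfunE lfunE /=.
by rewrite mulrA bP // subrr.
Qed.

Lemma contraction_right a x : x \in Bp -> b (a * x) = b a * x.
Proof.
move=> xB; apply/eqP; rewrite -subr_eq0.
have E a' : (b \o amulr x - (amulr x \o b))%VF a' = b (a' * x) - b a' * x.
  by rewrite add_lfunE opp_lfunE !comp_lfunE !lfunE.
rewrite -E -memv_ker; move: a; apply: A_span => u t c uA tT cA.
have tcB := mem_Bp tT cA.
rewrite memv_ker E -[u * t * c]mulrA -mulrA.
rewrite (contraction_mulBp uA (memvM tcB xB)) (contraction_mulBp uA tcB).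
by rewrite scalerAl subrr.
Qed.

(** Contraction followed by the projection [B^+ -> T]. *)
Definition tau : 'End(A) := (pr 0 \o b)%VF.

Lemma tauE a : tau a = pr 0 (b a). Proof. by rewrite comp_lfunE. Qed.

Lemma tau_T a : tau a \in T.
Proof. by rewrite tauE Bp_deg0 // contraction_Bp. Qed.

Lemma tau_mul u t : u \in Am -> t \in T -> tau (u * t) = (xi u : K) *: t.
Proof.
move=> uA tT; rewrite tauE contraction_mulBp ?T_Bp // linearZ /=.
by rewrite (gpr_id _ _ (T_deg0 tT)) eqxx.
Qed.

(** [A] is a free module over [A^-], compatibly with the filtration by the
    degrees of generators: the contractions recover the coefficients modulo
    generators of higher degree. *)
Lemma contraction_gen_gt d j (x : A) :
  x \in (gen_gt (reg hA d) j : {vspace A}) -> pr (j - d) (b x) = 0.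
Proof.
move=> xG; apply/eqP.
have -> : pr (j - d) (b x) = (pr (j - d) \o b)%VF x by rewrite comp_lfunE.
rewrite -memv_ker; apply: subvP xG.
apply: (@gen_gt_sub _ _ _ (reg hA d)) => i a y ji yi; rewrite reg_act.
have -> : a * y = amull a y by rewrite lfunE.
rewrite memv_preim; apply: gr_span yi => s u z si s0 uA us zB zs.
rewrite -memv_preim memv_ker comp_lfunE lfunE /= mulrA contraction_right //.
rewrite (pr_mulr _ _ _ zs) Bp_neg ?mul0r ?contraction_Bp // subr_lt0.
by apply: lt_le_trans si; rewrite ltrD2r.
Qed.

Lemma contraction_free d j a y : y \in gr (j - d) ->
  pr (j - d) (b (a * y)) - tau a * y \in (gen_gt (reg hA d) j : {vspace A}).
Proof.
set i := j - d => yi.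
have E x : (pr i \o b \o amull a - amull (tau a))%VF x = pr i (b (a * x)) - tau a * x.
  by rewrite add_lfunE opp_lfunE !comp_lfunE !lfunE.
rewrite -E memv_preim; apply: gr_span yi => s u z si s0 uA us zB zs.
rewrite -memv_preim E; move: si; rewrite le_eqVlt => /orP[/eqP si|si].
  rewrite -si subrr in us; have [k ->] := Am_0 uA us.
  rewrite -scalerAl mul1r -!scalerAr !linearZ /= -scalerDr memvZ //.
  by rewrite contraction_right // (pr_mulr _ _ _ zs) si subrr -tauE subrr mem0v.
have zM : z \in gm_gr (reg hA d) (s + d) by rewrite /= addrK.
have js : j < s + d by rewrite -ltrBlDr.
have inG a' : a' * z \in gen_gt (reg hA d) j.
  by have := mem_gen_gt a' js zM; rewrite reg_act.
rewrite !mulrA contraction_gen_gt ?inG // sub0r memvN; exact: inG.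
Qed.

Lemma tau_Iplus x : x \in Ip -> tau x = 0.
Proof. by rewrite tauE => /contraction_gen_gt; rewrite subr0. Qed.

End Contraction.

(** Contracting with the dual basis of a basis of [A^-] expands elements of [B^-]
    in that basis; on all of [A] it does so modulo [Iplus], because
    [c - c_0] lies in [Iplus] for [c] in [A^+]. *)
Lemma contraction_basis :
  exists (b : 'I_(\dim Am) -> 'End(A)) (xi : 'I_(\dim Am) -> 'Hom(A, K^o)),
  [/\ forall k, contraction (xi k) (b k),
   forall a, a - \sum_(k < \dim Am) (vbasis Am)`_k * tau (b k) a \in Ip &
   forall x, x \in Bm -> x = \sum_(k < \dim Am) (vbasis Am)`_k * tau (b k) x].
Proof.
pose x (k : 'I_(\dim Am)) : 'Hom(A, K^o) := linfun (fun a => coord (vbasis Am) k a : K^o).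
have xE k a : x k a = coord (vbasis Am) k a.
  by rewrite /x linfun_linear // => c y z; rewrite linearP.
have /choice[b bP] := fun k => contraction_exists (x k).
have E a : (\1 - \sum_(k < \dim Am) (amull (vbasis Am)`_k \o tau (b k)))%VF a =
    a - \sum_(k < \dim Am) (vbasis Am)`_k * tau (b k) a.
  rewrite add_lfunE opp_lfunE id_lfunE sum_lfunE; congr (_ - _).
  by apply: eq_bigr => k _; rewrite comp_lfunE lfunE.
have uE u t : u \in Am -> \sum_(k < \dim Am) (vbasis Am)`_k * ((x k u : K) *: t) = u * t.
  move=> uA; rewrite [in RHS](coord_vbasis uA) mulr_suml.
  by apply: eq_bigr => k _; rewrite xE -scalerAl scalerAr.
exists b, x; split=> // [a|y yB].
  rewrite -E memv_preim; move: a; apply: A_span => u t c uA tT cA.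
  rewrite -memv_preim E.
  have -> : \sum_(k < \dim Am) (vbasis Am)`_k * tau (b k) (u * t * c) = u * (t * pr 0 c).
    rewrite -[RHS]uE //; apply: eq_bigr => k _.
    by rewrite tauE bP // linearZ /= (pr_mull _ _ _ (T_deg0 tT)) subr0.
  rewrite mulrA -mulrBr; apply: Iplus_left.
  apply: gpr_rest => i i0; have [ilt|] := ltP i 0.
    by rewrite (Ap_neg ilt (pr_Ap i cA) (gpr_in _ _ _)) mem0v.
  rewrite le_eqVlt eq_sym (negbTE i0) /= => igt.
  by rewrite -[gpr _ i c]mul1r (mem_Iplus _ _ igt) ?gpr_in.
apply/eqP; rewrite -subr_eq0 -E -memv_ker; apply: Bm_ind yB => u t uA tT.
rewrite memv_ker E subr_eq0 -[X in X == _]uE //; apply/eqP.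
by apply: eq_bigr => k _; rewrite (tau_mul (bP k)).
Qed.

Lemma Iplus_of_tau a e :
    e \in T -> (forall xi b, contraction xi b -> tau b a * e = 0) -> a * e \in Ip.
Proof.
move=> eT h; have [b [xi [bP bI _]]] := contraction_basis.
have := Iplus_right (T_deg0 eT) (bI a).
rewrite mulrBl mulr_suml big1 ?subr0 // => k _.
by rewrite -mulrA (h _ _ (bP k)) mulr0.
Qed.

(** Thus [B^-] and [Iplus] are complementary: [tau] recovers the coefficients of
    an element of [B^-] and kills [Iplus]. *)
Lemma Bm_Iplus x : x \in Bm -> x \in Ip -> x = 0.
Proof.
move=> xB xI; have [b [xi [bP _ xE]]] := contraction_basis.
by rewrite (xE x xB) big1 // => k _; rewrite (tau_Iplus (bP k)) // mulr0.
Qed.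

Lemma T_Iplus t : t \in T -> t \in Ip -> t = 0.
Proof. by move=> tT; apply: Bm_Iplus; apply: T_Bm. Qed.

Lemma gr_Bm k a : a \in gr k -> exists x, [/\ x \in Bm, x \in gr k & a - x \in Ip].
Proof.
move=> ak; suff /memv_addP[x /memv_capP[xB xk] [y yI ->]] : a \in ((Bm :&: gr k) + Ip)%VS.
  by exists x; split=> //; rewrite addrAC subrr add0r.
apply: gr_span ak => s u z ks s0 uA us zB zs.
move: s0; rewrite le_eqVlt => /orP[/eqP s0|s0].
  rewrite -s0 subr0 in us; rewrite -s0 in zs.
  have zT : z \in T by have := Bp_deg0 zB; rewrite (gpr_id _ _ zs) eqxx.
  by apply: (subvP (addvSl _ _)); rewrite memv_cap mem_Bm // -[k]addr0 deg_mul.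
by apply: (subvP (addvSr _ _)); apply: mem_Iplus zs.
Qed.

Lemma gr0_T a : a \in gr 0 -> exists2 t, t \in T & a - t \in Ip.
Proof.
case/gr_Bm=> x [xB x0 xI]; exists x => //.
suff: pr 0 x \in T by rewrite (gpr_id _ _ x0) eqxx.
rewrite memv_preim; apply: Bm_ind xB => u t uA tT.
rewrite -memv_preim (pr_mulr _ _ _ (T_deg0 tT)) subr0.
have [k ->] := Am_0 (pr_Am 0 uA) (gpr_in _ _ _).
by rewrite -scalerAl mul1r memvZ.
Qed.

End Structure.

(** * Primitive idempotents of [T] *)

Section Idempotents.
Variables (K : fieldType) (A : falgType K) (T : {aspace A}).
Hypothesis T1 : 1 \in T.

Lemma val1_T : vsval (1 : subvs_of T) = 1.
Proof. by have := T1; rewrite -algid_eq1 => /eqP. Qed.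

(** [T e] is a simple [T]-module with endomorphism ring [K]. *)
Definition prim (e : A) : Prop :=
  [/\ e \in T, e <> 0, e * e = e,
      forall t, t \in T -> exists k : K, e * t * e = k *: e &
      forall t, t \in T -> t * e <> 0 -> exists2 s, s \in T & s * (t * e) = e].

(** For [t] in [T], right multiplication by [e t e] is an endomorphism of the
    simple module [U = T e], hence a scalar because [T] is split. *)
Lemma simple_ideal_prim (U : {vspace regular_module (subvs_of T)}) (e : subvs_of T) :
    split_algebra (subvs_of T) -> simple_submodule U -> e \in U ->
    (forall x, x \in U -> x * e = x) ->
  prim (vsval e).
Proof.
move=> splitT [sU U0 Umin] eU xe.
have aE a (x : regular_module (subvs_of T)) : act _ a x = a * x by rewrite /= lfunE.
have e0 : e <> 0.
  move=> e0; apply: U0; apply/eqP; rewrite -subv0; apply/subvP => x /xe <-.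
  by rewrite e0 mulr0 mem0v.
have ee : e * e = e by apply: xe.
have gen t : t * e <> 0 -> exists s, s * (t * e) = e.
  move=> te; pose W := limg (orb (t * e : regular_module (subvs_of T))).
  have WU : (W <= U)%VS by apply: orb_sub => //; rewrite -aE; apply: sU.
  case: (Umin W (@submodule_orb _ _ (regular_module _) _) WU) => [W0|WE].
    by case: te; apply/eqP; rewrite -memv0 -W0; apply: (@orb_self _ _ (regular_module _)).
  have : e \in W by rewrite WE.
  case/memv_imgP => s _ es; exists s; rewrite -aE.
  by rewrite -(orbE (t * e : regular_module _)); apply: esym.
split; first exact: subvsP.
- by move/(@subvs_inj _ _ _ e 0)/e0.
- exact: (congr1 vsval ee).
- move=> t tT; pose z := e * Subvs tT * e.
  suff [k kP] : exists k, z = k *: e by exists k; apply: (congr1 vsval kP).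
  have sV : submodule (0%VS : {vspace regular_module (subvs_of T)}).
    by move=> a x; rewrite !memv0 => /eqP->; rewrite linear0.
  have r1 (x : regular_module (subvs_of T)) : \1%VF x - x \in 0%VS.
    by rewrite id_lfunE subrr mem0v.
  have r2 (x : regular_module (subvs_of T)) : x \in 0%VS -> \1%VF x = 0.
    by rewrite id_lfunE memv0 => /eqP.
  pose N := subq_lmodule sU sV r1 r2; pose q := subq_proj sU sV r1 r2.
  have qU : (q @: U)%VS = fullv := subq_proj_img sU sV r1 r2.
  have qk : (U :&: lker q)%VS = 0%VS by apply: subq_proj_ker; apply: sub0v.
  have qa a x : x \in U -> q (a * x) = act N a (q x).
    by move=> xU; rewrite -aE; apply: subq_proj_act.
  have qs y : exists2 x, x \in U & y = q x.
    have /memv_imgP[x xU ->] : y \in (q @: U)%VS by rewrite qU memvf.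
    by exists x.
  have zU x : x * z \in U by rewrite /z mulrA -aE; apply: (sU _ _ eU).
  have simpleN : simple_module N.
    split=> [a x _||W sW _]; first exact: memvf.
      move=> N0; apply: U0; rewrite -qk; apply/esym/capv_idPl.
      by rewrite lkerE qU N0.
    have sW' : submodule (U :&: q @^-1: W)%VS.
      move=> a x /memv_capP[xU]; rewrite -memv_preim memv_cap sU //= => qW.
      by rewrite -memv_preim aE qa //; apply: sW.
    have mW y : y \in W -> exists2 x, x \in (U :&: q @^-1: W)%VS & y = q x.
      by have [x xU ->] := qs y => qxW; exists x; rewrite // memv_cap xU -memv_preim.
    case: (Umin _ sW' (capvSl _ _)) => WE; [left|right]; apply/eqP.
      rewrite -subv0; apply/subvP => y /mW[x]; rewrite WE memv0 => /eqP-> ->.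
      by rewrite linear0 mem0v.
    rewrite eqEsubv subvf; apply/subvP => y _; have [x xU ->] := qs y.
    by move: xU; rewrite -{1}WE memv_cap -memv_preim => /andP[].
  have kq : (U :&: lker q <= lker (q \o amulr z))%VS by rewrite qk sub0v.
  have [h hq] := lfun_factor qU kq.
  have {}hq x : x \in U -> h (q x) = q (x * z).
    move=> xU; rewrite hq // comp_lfunE; congr (q _); exact: lfunE.
  have hh : module_hom h.
    move=> a y; have [x xU ->] := qs y.
    rewrite -qa // !hq //; first by rewrite -mulrA qa.
    by rewrite -aE; apply: (sU _ _ xU).
  have [k kE] := splitT N simpleN h hh; exists k.
  have ez : e * z = z by rewrite /z !mulrA ee.
  have zzU : z \in U by have := zU e; rewrite ez.
  have qz : q z = k *: q e by rewrite -[in LHS]ez -hq // kE scale_lfunE id_lfunE.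
  apply/eqP; rewrite -subr_eq0 -memv0 -qk memv_cap memvB ?memvZ //=.
  by rewrite memv_ker linearB linearZ /= qz subrr.
move=> t tT te; case: (gen (Subvs tT)) => [te0|s se].
  exact: te (congr1 vsval te0).
by exists (vsval s); [apply: subvsP | apply: (congr1 vsval se)].
Qed.

(** The components of 1 in a decomposition of [T] into simple left ideals. *)
Lemma prim_sum : semisimple_algebra (subvs_of T) -> split_algebra (subvs_of T) ->
  exists es : seq A, (forall e, e \in es -> prim e) /\ \sum_(e <- es) e = 1.
Proof.
case=> s [sS sF sD] splitT.
have aE a (x : regular_module (subvs_of T)) : act _ a x = a * x by rewrite /= lfunE.
move: sF sD; rewrite (directv_seq 0%VS) (big_nth 0%VS) big_mkord => sF.
move/directv_sum_independent => ind.
have {}sS (k : 'I_(size s)) : simple_submodule (nth 0%VS s k) by apply: sS; rewrite mem_nth.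
have /memv_sumP[w wU w1] : (1 : subvs_of T) \in (\sum_(k < size s) nth 0 s k)%VS.
  by rewrite sF memvf.
have xw k x : x \in nth 0%VS s (k : 'I_(size s)) -> x * w k = x.
  move=> xU; pose u j := x * w j - (if j == k then x else 0).
  have u0 : u k = 0.
    apply: ind => // [j _|].
      rewrite /u memvB //; first by rewrite -aE; have [h _ _] := sS j; apply/h/wU.
      by case: eqP => [->|_] //; rewrite mem0v.
    rewrite sumrB -mulr_sumr -w1 mulr1 (bigD1 k) //= eqxx big1 ?addr0 ?subrr //.
    by move=> j /negbTE->.
  by move/eqP: u0; rewrite /u eqxx subr_eq0 => /eqP.
exists [seq vsval (w k) | k <- enum 'I_(size s)]; split.
  move=> _ /mapP[k _ ->]; apply: (simple_ideal_prim splitT (sS k) (wU k isT)).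
  exact: xw.
rewrite big_map big_enum /= -val1_T w1.
by rewrite linear_sum.
Qed.

End Idempotents.

(** * Standard modules *)

Section Standard.
Variables (K : fieldType) (A : falgType K) (gr : int -> {vspace A}).
Variables (Am T Ap : {aspace A}).
Hypothesis hA : graded_algebra gr.
Hypothesis htri : triangular_decomposition gr Am T Ap.
Hypothesis hT : semisimple_algebra (subvs_of T).

Local Notation hgr := (alg_grading hA).
Local Notation pr := (gpr hgr).
Local Notation Ip := (Iplus hA).

(** Since 1 is a sum of primitive idempotents, one of them moves [x] out of [F]. *)
Lemma prim_detect (M : lmodule A) (F : {vspace M}) x :
  x \notin F -> exists2 e, prim T e & act M e x \notin F.
Proof.
move=> xF; have [_ T1 _] := one_in htri; have splitT : split_algebra (subvs_of T).
  by case: htri => _ _ _ _ [].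
have [es [esP es1]] := prim_sum T1 hT splitT.
apply: contrapT => no; move/negP: xF; apply.
rewrite -(act1l x) -es1 -orbE linear_sum big_seq memv_suml //= => e ein.
by rewrite orbE; apply: contrapT => /negP ex; apply: no; exists e => //; apply: esP.
Qed.

Lemma prim_deg0 e : prim T e -> e \in gr 0.
Proof. by case=> eT _ _ _ _; apply: (T_deg0 htri). Qed.

Lemma prim_idem e : prim T e -> e * e = e.
Proof. by case. Qed.

(** [D] is isomorphic to [A / (A (1 - e) + Iplus)], that is to the standard
    module induced from [T e] in degree [d], with [w] the image of 1. *)
Definition std (e : A) (d : int) (D : gmodule gr) (w : D) : Prop :=
  [/\ w \in gm_gr D d, limg (orb w) = fullv &
      forall a, act D a w = 0 <-> a * e \in Ip].

Section StdFacts.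
Variables (e : A) (d : int) (D : gmodule gr) (w : D).
Hypotheses (eP : prim T e) (wP : std e d w).

Lemma std_id : act D e w = w.
Proof.
have [_ _ ann] := wP; apply/eqP; rewrite eq_sym -subr_eq0 -[w in w - _]act1l -actBl.
by apply/eqP/ann; rewrite mulrBl mul1r prim_idem ?subrr ?mem0v.
Qed.

Lemma std_neq0 : w != 0.
Proof.
have [_ _ ann] := wP; have [eT e0 _ _ _] := eP.
apply: contra_notN e0 => /eqP w0; apply: (T_Iplus htri (hA := hA)) => //.
by rewrite -[e]mul1r; apply/ann; rewrite w0 linear0.
Qed.

Lemma std_cyclic y : exists a, y = act D a w.
Proof.
have [_ cyc _] := wP; have: y \in limg (orb w) by rewrite cyc memvf.
by case/memv_imgP => a _ ->; exists a; rewrite orbE.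
Qed.

Lemma std_deg j y : y \in gm_gr D j -> exists2 a, a \in gr (j - d) & y = act D a w.
Proof.
have [wd _ _] := wP => yj; have [a ya] := std_cyclic y.
exists (pr (j - d) a); first exact: gpr_in.
by rewrite -(gp_actr hgr) // -ya gp_same.
Qed.

Lemma std_Iplus a : a \in Ip -> act D a w = 0.
Proof.
by have [_ _ ann] := wP => aI; apply/ann; rewrite Iplus_right // prim_deg0.
Qed.

Lemma std_top (j : int) : d < j -> gm_gr D j = 0%VS.
Proof.
move=> dj; apply/eqP; rewrite -subv0; apply/subvP => y /std_deg[a aj ->].
rewrite memv0 std_Iplus // -[a]mul1r; apply: (mem_Iplus _ _ _ aj).
by rewrite subr_gt0.
Qed.

Lemma std_deg_top y : y \in gm_gr D d -> exists2 t, t \in T & y = act D t w.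
Proof.
case/std_deg=> a; rewrite subrr => /(gr0_T hA htri)[t tT at_] ->.
exists t => //; apply/eqP; rewrite -subr_eq0 -actBl; apply/eqP; exact: std_Iplus.
Qed.

Lemma std_ch : ch D e d = 1%N.
Proof.
have [wd _ _] := wP; have [eT _ ee eTe _] := eP.
rewrite /ch /chi -[RHS]/(nat_of_bool true) -std_neq0 -dim_vline; congr (\dim _).
apply/vspaceP => y; rewrite mem_eM ?memvf ?prim_deg0 //=; last exact: gsubmodulef.
apply/andP/vlineP => [[yd /eqP ey]|[k ->]].
  have [t tT yt] := std_deg_top yd; have [k kE] := eTe t tT; exists k.
  by rewrite -ey yt -{1}std_id -!actMl kE actZl std_id.
by rewrite memvZ // linearZ /= std_id.
Qed.

End StdFacts.

Lemma std_giso e d (X Y : gmodule gr) (x : X) (y : Y) :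
  std e d x -> std e d y -> giso X Y.
Proof.
case=> xd ox ax [yd oy ay]; apply: (giso_cyclic hgr xd yd ox oy) => a.
by rewrite ax ay.
Qed.

(** If [e Y_d <> 0] at the top degree [d] of a standard module [Y] then [e] and
    the idempotent of [Y] generate isomorphic left ideals of [T]. *)
Lemma std_change e d e' d' (Y : gmodule gr) (w : Y) :
    prim T e -> prim T e' -> std e' d' w ->
    (forall j : int, d < j -> gm_gr Y j = 0%VS) -> ch Y e d <> 0%N ->
  exists y : Y, std e d y.
Proof.
move=> eP eP' wP top; have [eT _ ee eTe _] := eP; have [eT' _ ee' _ eS'] := eP'.
case/(ch_neq0 (prim_deg0 eP) ee) => y yd [ey y0].
have [wd _ ann] := wP.
have dd' : d' = d.
  case: (ltgtP d d') => // [dd|dd].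
    by move: wd (std_neq0 eP' wP); rewrite top // memv0 => ->.
  by move: yd y0; rewrite (std_top eP' wP dd) memv0 => ->.
rewrite dd' in wd wP ann; have [t tT yt] := std_deg_top eP' wP yd.
have [z zE] : {z | z = e * t * e'} by exists (e * t * e').
have zy : y = act Y z w by rewrite -ey yt -{1}(std_id eP' wP) -!actMl zE ?mulrA.
have zT : z \in T by rewrite zE !memvM.
have ez : e * z = z by rewrite zE !mulrA ee.
have ze' : z * e' = z by rewrite zE -mulrA ee'.
have [s sT sz] : exists2 s, s \in T & s * z = e'.
  have [||s sT sE] := eS' (e * t); rewrite ?memvM //.
    by move=> z0; move: y0; rewrite zy zE z0 act0l eqxx.
  by exists s; rewrite ?zE.
have [k kE] := eTe (t * e' * s) (memvM (memvM tT eT') sT).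
(* [z s e] lies in [e T e = K e], and the scalar is 1 because [s z = e']. *)
have zs : z * (s * e) = e.
  have zse : z * (s * e) = k *: e by rewrite -kE zE !mulrA.
  have z0 : z != 0 by apply: contraNneq y0 => z0; rewrite zy z0 act0l.
  have : k *: z = z by rewrite -{1}ez scalerAl -zse -!mulrA ez sz ze'.
  move/eqP; rewrite -subr_eq0 -{2}[z]scale1r -scalerBl scaler_eq0 (negbTE z0) orbF.
  by rewrite subr_eq0 => /eqP k1; rewrite zse k1 scale1r.
exists y; split=> //.
  apply/eqP; rewrite eqEsubv subvf /=; have [_ <- _] := wP.
  apply: orb_sub; first exact: submodule_orb.
  by rewrite -(std_id eP' wP) -sz actMl -zy mem_orb.
move=> a; rewrite zy -actMl ann -mulrA ze'; split=> aI.
  have -> : a * e = a * z * (s * e) by rewrite -mulrA zs.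
  apply: Iplus_right aI; exact/(T_deg0 htri)/memvM.
have -> : a * z = a * e * z by rewrite -mulrA ez.
apply: Iplus_right aI; exact: (T_deg0 htri).
Qed.

(** ** Comparison with tensor products *)

Lemma sub_T_algebra : graded_algebra (sub_grading gr T).
Proof.
have [_ T1 _] := one_in htri.
have in0 x : x \in sub_grading gr T 0.
  by rewrite -memv_preim lfunE /=; apply/(T_deg0 htri)/subvsP.
split=> // [|i j].
  apply: (sub_is_grading (grP := hgr)) => i x xT.
  rewrite (gpr_id _ _ (T_deg0 htri xT)); case: eqP => // _; exact: mem0v.
apply/prodvP => x y; rewrite -!memv_preim !lfunE /= => xi yj.
exact: (deg_mul hA xi yj).
Qed.

Local Notation gT := (sub_grading gr T).

Lemma deg0_T (x : subvs_of T) : x \in gT 0.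
Proof. by rewrite -memv_preim lfunE /=; apply/(T_deg0 htri)/subvsP. Qed.

(** [T] has degree 0, so its simple graded modules live in one degree; some
    primitive idempotent acts on them as nonzero. *)
Lemma gsimple_T (la : gmodule gT) : gsimple la ->
  exists e d x, [/\ prim T e, x \in gm_gr la d, x <> 0,
    act la (vsproj T e) x = x & limg (orb x) = fullv].
Proof.
case=> la0 lamin; have [_ T1 _] := one_in htri.
have splitT : split_algebra (subvs_of T) by case: htri => _ _ _ _ [].
have [es [esP es1]] := prim_sum T1 hT splitT.
have [d [x xd x0]] : exists d, exists2 x, x \in gm_gr la d & x != 0.
  apply: contrapT => no; apply: la0; apply/eqP; rewrite -subv0.
  apply/subvP => y _; rewrite -(gp_sum y) memv_suml // => i _.
  rewrite memv0; apply/negPn/negP => y0; apply: no; exists i.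
  by exists (gp la i y); rewrite ?gp_in.
have [e ein ex] : exists2 e, e \in es & act la (vsproj T e) x != 0.
  apply: contrapT => no; move/eqP: x0; apply.
  have E1 : (1 : subvs_of T) = \sum_(e <- es) vsproj T e.
    by rewrite -linear_sum es1 /= -(val1_T T1) vsvalK.
  rewrite -(act1l x) E1 -orbE linear_sum big_seq big1 //= => e ein.
  by rewrite orbE; apply/eqP/negPn/negP => ex; apply: no; exists e.
have eP := esP e ein; have [eT _ ee _ _] := eP.
have eeT : vsproj T e * vsproj T e = vsproj T e.
  by apply: subvs_inj; rewrite /= vsprojK.
exists e, d, (act la (vsproj T e) x); split=> //.
- by rewrite -[d]add0r gm_actP ?deg0_T.
- exact/eqP.
- by rewrite -actMl eeT.
have exd : act la (vsproj T e) x \in gm_gr la d by rewrite -[d]add0r gm_actP ?deg0_T.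
case: (lamin _ (gsubmodule_orb (alg_grading sub_T_algebra) exd)) => // o0.
by move/eqP: ex; case; apply/eqP; rewrite -memv0 -o0 orb_self.
Qed.

Section Coordinates.
Variables (la : lmodule (subvs_of T)) (e : A) (x : la).
Hypotheses (eP : prim T e) (x0 : x <> 0) (ex : act la (vsproj T e) x = x).
Hypothesis (ox : limg (orb x) = fullv).

Lemma la_cyclic y : exists t, y = act la t x.
Proof.
have: y \in limg (orb x) by rewrite ox memvf.
by case/memv_imgP => t _ ->; exists t; rewrite orbE.
Qed.

(** The isomorphism of [T x] with [T e]. *)
Lemma coordinate_exists : exists s : 'Hom(la, A), forall t, s (act la t x) = vsval t * e.
Proof.
have [eT _ _ _ eS] := eP.
pose g : 'Hom(subvs_of T, A) := (amulr e \o linfun (vsval : subvs_of T -> A))%VF.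
have gE t : g t = vsval t * e by rewrite comp_lfunE !lfunE.
have kg : (fullv :&: lker (orb x) <= lker g)%VS.
  apply/subvP => t; rewrite capfv !memv_ker orbE gE => /eqP tx.
  apply/negPn/negP => /eqP te; apply: x0.
  have [s sT sE] := eS _ (subvsP t) te.
  have eE : vsproj T e = vsproj T s * (t * vsproj T e).
    by apply: subvs_inj; rewrite /= !vsprojK.
  by rewrite -ex eE !actMl ex tx linear0.
have [h hE] := lfun_factor ox kg.
by exists h => t; rewrite -orbE hE ?memvf.
Qed.

Variable (s : 'Hom(la, A)).
Hypothesis sE : forall t, s (act la t x) = vsval t * e.

Lemma coordinate_T y : s y \in T.
Proof. by have [t ->] := la_cyclic y; rewrite sE memvM ?subvsP //; case: eP. Qed.

Lemma coordinate_act t y : s (act la t y) = vsval t * s y.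
Proof. by have [t' ->] := la_cyclic y; rewrite -actMl !sE /= mulrA. Qed.

Lemma coordinate_gen : s x = e.
Proof.
have [eT _ ee _ _] := eP.
by rewrite -[x in LHS]ex sE vsprojK.
Qed.

(** Maps out of [A / Iplus] yield balanced maps, as [B^+] acts on [T x] through
    [T] and its part of positive degree lies in [Iplus]. *)
Lemma coordinate_balanced (V : vectType K) (r : 'Hom(A, V)) :
  (forall a, a \in Ip -> r a = 0) ->
  [/\ forall y, linear (fun a => r (a * s y)), forall a, linear (fun y => r (a * s y)) &
   forall a b t y, Bplus_quotient gr Ap b t -> r (a * b * s y) = r (a * s (act la t y))].
Proof.
move=> rI; split=> [y k a b|a k y z|a b t y [bB [js jpos bt]]].
- by rewrite mulrDl -scalerAl linearP.
- by rewrite linearP mulrDr -scalerAr linearP.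
rewrite coordinate_act mulrA; apply/eqP; rewrite -subr_eq0 -linearB -mulrBl -mulrBr /=.
apply/eqP/rI; apply: Iplus_right; first exact/(T_deg0 htri)/coordinate_T.
apply: Iplus_left; move: bt; rewrite (big_nth 0) big_mkord => /memv_sumP[z zj ->].
apply: memv_suml => k _; have /memv_capP[_ zk] := zj k isT.
rewrite -[z k]mul1r; apply: (mem_Iplus _ _ _ zk).
by apply: (allP jpos); apply: mem_nth.
Qed.

End Coordinates.

Lemma Bplus_quotient_T t : Bplus_quotient gr Ap (vsval (t : subvs_of T)) t.
Proof.
split; first exact/(T_Bp htri)/subvsP.
by exists [::] => //; rewrite subrr mem0v.
Qed.

(** Elements of positive degree of [A] lie in [A B^+_{> 0}]. *)
Lemma balanced_Iplus (la : gmodule gT) (V : vectType K) (f : A -> la -> V) a y :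
  balanced Ap f -> a \in Ip -> f a y = 0.
Proof.
case=> fl fr fb aI.
have E : linfun (f^~ y) =1 f^~ y by apply: linfun_linear.
rewrite -E; apply/eqP; rewrite -memv_ker; apply: subvP aI.
apply: Iplus_sub => i b z i0 zi.
have -> : b * z = amull b z by rewrite lfunE.
rewrite memv_preim; apply: (gr_span hA htri) zi => s u v si s0 uA us vB vs.
rewrite -memv_preim memv_ker E lfunE /= mulrA (fb _ _ 0).
  have := fr (b * u) (-1) 0 0; rewrite scaler0 addr0 scaleN1r addNr => f0.
  by rewrite act0l f0.
split=> //; exists [:: s]; first by rewrite /= (lt_le_trans i0 si).
have -> : v - vsval (0 : subvs_of T) = v by rewrite /= subr0.
by rewrite big_seq1 memv_cap vB.
Qed.

(** The vector [w] is [1 (x) x]. The universal property, applied to a balanced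
    map with values in [A / Iplus], shows that its annihilator is not larger. *)
Lemma Delta_std (la : gmodule gT) (D : gmodule gr) : gsimple la -> is_Delta Ap la D ->
  exists e d (w : D), prim T e /\ std e d w.
Proof.
case/gsimple_T=> e [d [x [eP xd x0 ex ox]]] [tau [taub univ tauM taug]].
have [eT _ ee _ _] := eP; have [_ _ fb] := taub.
pose w := tau 1 x.
have wE a : act D a w = tau a x by rewrite /w -tauM mulr1.
exists e, d, w; split=> //; split.
- by have := taug _ _ _ _ (one_deg0 hA) xd; rewrite add0r.
- (* The tensors span: 0 and a projection killing them agree on all of them. *)
  have b0 : balanced Ap (fun (a : A) (y : la) => 0 : D).
    by split=> // y k z z'; rewrite scaler0 addr0.
  have [h [_ hu]] := univ D _ b0.
  have h0 : h = 0 by apply: hu => a y; rewrite zero_lfunE.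
  have h1 : h = (\1 - projv (limg (orb w)))%VF.
    apply: hu => a y; rewrite add_lfunE opp_lfunE id_lfunE projv_id ?subrr //.
    have [t ->] := la_cyclic ox y.
    by rewrite -(fb _ _ _ _ (Bplus_quotient_T t)) -wE mem_orb.
  apply/eqP; rewrite eqEsubv subvf; apply/subvP => y _.
  have /lfunP/(_ y) := etrans (esym h1) h0.
  rewrite add_lfunE opp_lfunE id_lfunE zero_lfunE => /eqP; rewrite subr_eq0 => /eqP->.
  exact: memv_proj.
move=> a; have exE : tau a x = tau (a * e) x.
  have := fb a _ _ x (Bplus_quotient_T (vsproj T e)).
  by rewrite ex vsprojK.
rewrite wE exE; split=> [ax|aI]; last exact: balanced_Iplus aI.
have [s sE] := coordinate_exists eP x0 ex ox.
pose r : 'End(A) := (\1 - projv Ip)%VF.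
have rE b : r b = b - projv Ip b by rewrite add_lfunE opp_lfunE id_lfunE.
have rI b : b \in Ip -> r b = 0 by rewrite rE => /projv_id->; rewrite subrr.
have rb : balanced Ap (fun (a : A) (y : la) => r (a * s y)).
  exact: (coordinate_balanced eP ox sE rI).
have [h [hE _]] := univ _ _ rb.
have := hE (a * e) x; rewrite ax linear0 (coordinate_gen eP ex sE) -mulrA ee rE.
by move/esym/eqP; rewrite subr_eq0 => /eqP->; apply: memv_proj.
Qed.

(** The simple module is the left ideal [T e], placed in degree [d]. *)
Lemma std_Delta e d (D : gmodule gr) (w : D) : prim T e -> std e d w ->
  exists2 nu : gmodule gT, gsimple nu & is_Delta Ap nu D.
Proof.
move=> eP wP; have [eT e0 ee _ eS] := eP.
pose M := reg sub_T_algebra d; pose eM : M := vsproj T e.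
have hgT := alg_grading sub_T_algebra.
have eMd : eM \in gm_gr M d by rewrite /= subrr deg0_T.
pose U := limg (orb eM); have gU : gsubmodule U := gsubmodule_orb hgT eMd.
have [nu [f [fa fg fU fk]]] := subquotient_exists gU (gsubmodule0 M) (sub0v U).
have UP y : y \in U -> exists t, y = act M t eM.
  by case/memv_imgP => t _ ->; exists t; rewrite orbE.
have eU : eM \in U := orb_self eM.
pose x := f eM.
have xd : x \in gm_gr nu d by apply: (subvP (fg d)); rewrite memv_img // memv_cap eU.
have ox : limg (orb x) = fullv.
  apply/eqP; rewrite eqEsubv subvf -fU; apply/subvP => _ /memv_imgP[y /UP[t ->] ->].
  by rewrite fa // mem_orb.
have x0 : x <> 0.
  move=> x0; have : eM \in (U :&: lker f)%VS by rewrite memv_cap eU memv_ker -/x x0 eqxx.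
  rewrite fk memv0 => /eqP/(congr1 (vsval : subvs_of T -> A)).
  by rewrite /= vsprojK.
have ex : act nu (vsproj T e) x = x.
  rewrite /x -fa //; congr (f _); rewrite reg_act; apply: subvs_inj.
  by rewrite /= vsprojK.
have [s sE] := coordinate_exists eP x0 ex ox.
have wI a : a \in Ip -> orb w a = 0 by move=> aI; rewrite orbE (std_Iplus eP wP).
exists nu.
  split=> [nu0|W gW]; first by apply: x0; apply/eqP; rewrite -memv0 -nu0 memvf.
  have [->|W0] := eqVneq W 0%VS; [by left | right].
  have /subvPn[y Wy y0] : ~~ (W <= 0)%VS by rewrite subv0.
  have [t yt] := la_cyclic ox y.
  have te : vsval t * e <> 0.
    move=> te; move: y0; rewrite yt -ex -actMl memv0.
    suff -> : t * vsproj T e = 0 by rewrite act0l eqxx.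
    by apply: subvs_inj; rewrite /= vsprojK.
  have [s' sT s'E] := eS _ (subvsP t) te.
  apply/eqP; rewrite eqEsubv subvf -ox; apply: orb_sub; first exact: gW.1.
  rewrite -ex; have -> : vsproj T e = vsproj T s' * t * vsproj T e.
    by apply: subvs_inj; rewrite /= !vsprojK // -mulrA.
  by rewrite actMl ex actMl -yt; apply: gW.1.
exists (fun a y => act D (a * s y) w); split.
- have [b1 b2 b3] := coordinate_balanced eP ox sE wI.
  split=> [y k a b|a k y z|a b t y bt]; rewrite -!(orbE w).
  + exact: b1.
  + exact: b2.
  + exact: b3.
- move=> V g gb; have [gl gr_ gbal] := gb.
  have gE : linfun (g^~ x) =1 g^~ x by apply: linfun_linear.
  have gte a t : g a (act nu t x) = g (a * (vsval t * e)) x.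
    rewrite mulrA -(vsprojK eT) (gbal _ _ _ _ (Bplus_quotient_T _)) ex.
    by rewrite (gbal _ _ _ _ (Bplus_quotient_T _)).
  have kg : (fullv :&: lker (orb w) <= lker (linfun (g^~ x)))%VS.
    apply/subvP => a; rewrite capfv !memv_ker orbE gE => /eqP aw.
    have [_ _ ann] := wP; move/ann: aw => /(balanced_Iplus x gb).
    rewrite -[in X in X -> _]ex => <-.
    by rewrite ex -{1}ex gte vsprojK // ee.
  have [_ ow _] := wP; have [h hE] := lfun_factor ow kg.
  have {}hE a : h (act D a w) = g a x by rewrite -orbE hE ?memvf.
  exists h; split=> [a y|h' h'E].
    by have [t ->] := la_cyclic ox y; rewrite sE hE gte.
  apply/lfunP => y; have [a ->] := std_cyclic wP y.
  by rewrite hE -h'E (coordinate_gen eP ex sE) actMl (std_id eP wP).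
- by move=> a b y; rewrite -mulrA actMl.
- move=> i j a y ai yj; have [wd _ _] := wP.
  have [jd|jd] := eqVneq j d.
    rewrite jd gm_actP // -[i]addr0 deg_mul // (T_deg0 htri) //.
    exact: (coordinate_T eP ox sE).
  suff -> : y = 0 by rewrite linear0 mulr0 act0l mem0v.
  have [t yt] := la_cyclic ox y.
  have : y \in gm_gr nu d by rewrite yt -[d]add0r gm_actP ?deg0_T.
  by move/(gp_id j); rewrite (gp_same yj) (negbTE jd).
Qed.

End Standard.

(** * Simple modules and projective covers *)

Section SimpleProjective.
Variables (K : fieldType) (A : falgType K) (gr : int -> {vspace A}).
Variables (Am T Ap : {aspace A}).
Hypothesis hA : graded_algebra gr.
Hypothesis htri : triangular_decomposition gr Am T Ap.
Hypothesis hT : semisimple_algebra (subvs_of T).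

Local Notation hgr := (alg_grading hA).
Implicit Types M N X Y L P D : gmodule gr.

Lemma gsubmodule_ker M N (f : 'Hom(M, N)) : ghom f -> gsubmodule (lker f).
Proof.
case=> fa fg; apply: gsubmoduleP => [a x|i x]; rewrite !memv_ker.
  by rewrite fa => /eqP->; rewrite linear0.
by rewrite (ghom_gp _ _ fg) => /eqP->; rewrite linear0.
Qed.

Lemma gsubmodule_img M N (f : 'Hom(M, N)) (U : {vspace M}) :
  ghom f -> gsubmodule U -> gsubmodule (f @: U)%VS.
Proof.
case=> fa fg gU; apply: gsubmoduleP => [a|i] _ /memv_imgP[x Ux ->].
  by rewrite -fa memv_img // gU.1.
by rewrite -(ghom_gp _ _ fg) memv_img // gp_hom.
Qed.

Lemma ghom_orb d M (x : M) : x \in gm_gr M d -> @ghom _ _ _ (reg hA d) M (orb x).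
Proof.
move=> xd; split=> [a b|i].
  by rewrite !orbE reg_act actMl.
apply/subvP => _ /memv_imgP[a ai ->]; rewrite orbE.
by rewrite -[i](subrK d) gm_actP.
Qed.

Lemma simple_cyclic X d (x : X) :
  gsimple X -> x \in gm_gr X d -> x != 0 -> limg (orb x) = fullv.
Proof.
move=> [_ Xmin] xd x0; case: (Xmin _ (gsubmodule_orb hgr xd)) => // o0.
by move: x0; rewrite -memv0 -o0 orb_self.
Qed.

Lemma simple_weight X : gsimple X -> exists e d,
  [/\ prim T e, forall j : int, d < j -> gm_gr X j = 0%VS & ch X e d <> 0%N].
Proof.
case=> X0 _.
have [||d Xd top] := @grading_max _ _ _ (gm_grP X) (fun i => gm_gr X i <> 0%VS).
- by move=> i ->.
- apply: contrapT => no; apply: X0; apply/eqP; rewrite -subv0; apply/subvP => x _.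
  rewrite -(gp_sum x) memv_suml // => i _.
  have -> : 0%VS = gm_gr X i by apply: contrapT => Xi; apply: no; exists i => Xi'; apply: Xi.
  exact: gp_in.
have /subvPn[x xd x0] : ~~ (gm_gr X d <= 0)%VS by rewrite subv0; apply/eqP.
have [e eP ex] := prim_detect htri hT x0.
exists e, d; split=> // [j /top/contrapT //|].
by apply/eqP; rewrite -lt0n; apply: (ch_gt0 xd); rewrite -memv0.
Qed.

(** Elements of degree 0 act on highest weight vectors through [e T e = K]. *)
Lemma top_scalar e d a : prim T e -> a \in gr 0 ->
  exists k : K, forall Y (y : Y), (forall j : int, d < j -> gm_gr Y j = 0%VS) ->
    y \in gm_gr Y d -> act Y e y = y -> act Y e (act Y a y) = k *: y.
Proof.
move=> eP /(gr0_T hA htri)[t tT atI]; have [_ _ _ eTe _] := eP.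
have [k kE] := eTe t tT; exists k => Y y top yd ey.
have -> : act Y a y = act Y t y.
  by apply/eqP; rewrite -subr_eq0 -actBl (Iplus_top yd top atI).
by rewrite -{1}ey -!actMl kE actZl ey.
Qed.

(** Highest weight vectors [x] and [y] have the same annihilator. Otherwise some
    [a] of degree 0 kills [x] and fixes [y], since the elements killing [x] send
    [y] to a graded submodule; but [e a] acts by the same scalar on both. *)
Lemma simple_giso e d X Y : prim T e -> gsimple X -> gsimple Y ->
    (forall j : int, d < j -> gm_gr X j = 0%VS) ->
    (forall j : int, d < j -> gm_gr Y j = 0%VS) ->
    ch X e d <> 0%N -> ch Y e d <> 0%N ->
  giso X Y.
Proof.
move=> eP sX sY tX tY; have [e0 ee] := (prim_deg0 htri eP, prim_idem eP).
case/(ch_neq0 e0 ee)=> x xd [ex x0] /(ch_neq0 e0 ee)[y yd [ey y0]].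
have ann X' Y' (x' : X') (y' : Y') : gsimple Y' ->
    (forall j : int, d < j -> gm_gr X' j = 0%VS) ->
    (forall j : int, d < j -> gm_gr Y' j = 0%VS) ->
    x' \in gm_gr X' d -> y' \in gm_gr Y' d -> act X' e x' = x' -> act Y' e y' = y' ->
    x' != 0 -> y' != 0 -> forall a, act X' a x' = 0 -> act Y' a y' = 0.
  move=> sY' tX' tY' xd' yd' ex' ey' x0' y0' a ax.
  pose W := (orb y' @: lker (orb x'))%VS.
  have gW : gsubmodule W.
    apply: gsubmoduleP => [b|i] _ /memv_imgP[c + ->]; rewrite memv_ker orbE => /eqP cx.
      by rewrite orbE -actMl -orbE memv_img // memv_ker orbE actMl cx linear0.
    rewrite orbE (gp_actr hgr _ _ yd') -orbE memv_img // memv_ker orbE.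
    by rewrite -(gp_actr hgr _ _ xd') cx linear0.
  case: (sY'.2 _ gW) => WE.
    by apply/eqP; rewrite -memv0 -WE -orbE memv_img // memv_ker orbE ax.
  have : y' \in W by rewrite WE memvf.
  case/memv_imgP => c; rewrite memv_ker orbE => /eqP cx yc.
  have c0 := gpr_in hgr 0 c; have [k kE] := top_scalar d eP c0.
  have := kE X' x' tX' xd' ex'; rewrite -(subrr d) -(gp_actr hgr) // cx !linear0.
  move/esym/eqP; rewrite scaler_eq0 (negbTE x0') orbF => /eqP k0.
  have := kE Y' y' tY' yd' ey'; rewrite -(subrr d) -(gp_actr hgr) // -(orbE y') -yc.
  by rewrite gp_same // ey' k0 scale0r => y00; rewrite y00 eqxx in y0'.
apply: (giso_cyclic hgr xd yd); [exact: simple_cyclic xd x0|exact: simple_cyclic yd y0|].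
by move=> a; split; apply: ann.
Qed.

(** An endomorphism acts as a scalar on the line [e L_d] of highest weight
    vectors, hence everywhere. *)
Lemma simple_end L (s : 'End(L)) : gsimple L -> ghom s -> exists k : K, s = k *: \1%VF.
Proof.
move=> sL gs; have [e [d [eP top]]] := simple_weight sL.
case/(ch_neq0 (prim_deg0 htri eP) (prim_idem eP)) => v vd [ev v0].
have sv : s v \in gm_gr L d by apply: (subvP (gs.2 d)); rewrite memv_img.
have : s v \in limg (orb v) by rewrite (simple_cyclic sL vd v0) memvf.
case/memv_imgP => a _; rewrite orbE => sva.
have [k kE] := top_scalar d eP (gpr_in hgr 0 a); exists k.
have svk : s v = k *: v.
  rewrite -(kE L v top vd ev) -(subrr d) -(gp_actr hgr) // -sva gp_same //.
  by rewrite -gs.1 ev.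
have gk : ghom (s - k *: \1 : 'End(L))%VF.
  split=> [b x|i].
    rewrite !add_lfunE !opp_lfunE !scale_lfunE !id_lfunE gs.1.
    by rewrite [RHS]linearB [X in _ = _ - X]linearZ.
  apply/subvP => _ /memv_imgP[x xi ->].
  rewrite add_lfunE opp_lfunE scale_lfunE id_lfunE memvB ?memvZ //.
  by apply: (subvP (gs.2 i)); rewrite memv_img.
case: (sL.2 _ (gsubmodule_ker gk)) => kE0.
  move: v0; rewrite -memv0 -kE0 memv_ker add_lfunE opp_lfunE scale_lfunE id_lfunE.
  by rewrite svk subrr eqxx.
apply/lfunP => x; have := memvf x; rewrite -kE0 memv_ker add_lfunE opp_lfunE subr_eq0.
by move/eqP.
Qed.

(** ** The head of a standard module *)

(** A proper graded submodule of a standard module misses its top component,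
    which is simple over [T]. Proper submodules are therefore closed under sums,
    and there is a largest one. *)
Lemma is_head_simple e d D (w : D) L : prim T e -> std hA e d w -> is_head D L ->
  gsimple L.
Proof.
move=> eP wP [f [[fa fg] fi] fker].
have proper (U : {vspace D}) : gsubmodule U -> U <> fullv -> (U :&: gm_gr D d)%VS = 0%VS.
  move=> gU Uf; apply/eqP; rewrite -subv0; apply/subvP => u /memv_capP[Uu ud].
  rewrite memv0; apply/negPn/negP => u0; apply: Uf.
  have [t tT ut] := std_deg_top htri eP wP ud; have [_ _ _ _ eS] := eP.
  have [s sT sE] : exists2 s, s \in T & s * (t * e) = e.
    apply: eS => // te; move: u0.
    by rewrite ut -(std_id eP wP) -actMl te act0l eqxx.
  apply/eqP; rewrite eqEsubv subvf /=; have [_ <- _] := wP.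
  apply: orb_sub; first exact: gU.1.
  rewrite -(std_id eP wP) -sE mulrA actMl (std_id eP wP) actMl -ut.
  exact: gU.1.
have wd : w \in gm_gr D d by case: wP.
have proper' (U : {vspace D}) : gsubmodule U -> (U :&: gm_gr D d)%VS = 0%VS -> U <> fullv.
  move=> gU U0 Uf; have := std_neq0 htri eP wP.
  by rewrite -memv0 -U0 memv_cap wd Uf memvf.
have properD (U V : {vspace D}) : gsubmodule U -> gsubmodule V ->
    U <> fullv -> V <> fullv -> (U + V)%VS <> fullv.
  move=> gU gV /(proper _ gU) U0 /(proper _ gV) V0; apply: proper'.
    exact: gsubmoduleD.
  apply/eqP; rewrite -subv0; apply/subvP => x /memv_capP[/memv_addP[u Uu [v Vv ->]] xd].
  rewrite -(gp_same xd) linearD /=.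
  have: gp D d u \in (U :&: gm_gr D d)%VS by rewrite memv_cap gp_hom ?gp_in.
  have: gp D d v \in (V :&: gm_gr D d)%VS by rewrite memv_cap gp_hom ?gp_in.
  by rewrite U0 V0 !memv0 => /eqP-> /eqP->; rewrite addr0.
pose Q (k : nat) := `[< exists U : {vspace D}, [/\ gsubmodule U, U <> fullv & \dim U = k] >].
have exQ : exists k, Q k.
  exists 0%N; apply/asboolP; exists 0%VS; rewrite dimv0; split=> //.
    exact: gsubmodule0.
  by apply: proper'; [exact: gsubmodule0 | rewrite cap0v].
have ubQ k : Q k -> (k <= \dim (fullv : {vspace D}))%N.
  by move=> /asboolP[U [_ _ <-]]; apply/dimvS/subvf.
case: (ex_maxnP exQ ubQ) => k /asboolP[R [gR Rf dR]] Rmax.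
have Rtop (U : {vspace D}) : gsubmodule U -> U <> fullv -> (U <= R)%VS.
  move=> gU Uf; apply/addv_idPr/esym/eqP; rewrite eqEdim addvSr dR.
  apply: Rmax; apply/asboolP; exists (U + R)%VS; split=> //.
    exact: gsubmoduleD.
  exact: properD.
have kerR : lker f = R.
  apply/vspaceP => x; apply/idP/idP => [/fker|xR].
    apply; split=> // V gV RV; have [Vf|Vf] := EM (V = fullv); first by right.
    by left; apply/eqP; rewrite eqEsubv RV Rtop.
  apply/fker => U [gU Uf Umax].
  by case: (Umax R gR (Rtop U gU Uf)) => [<-|].
split=> [L0|W gW].
  apply: Rf; rewrite -kerR; apply/eqP; rewrite eqEsubv subvf /= lkerE fi.
  exact/eqP.
have gW' : gsubmodule (f @^-1: W)%VS.
  apply: gsubmoduleP => [a x|i x]; rewrite -!memv_preim => xW.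
    by rewrite fa; apply: gW.1.
  by rewrite (ghom_gp _ _ fg) gp_hom.
have [Wf|Wf] := EM ((f @^-1: W)%VS = fullv).
  right; apply/eqP; rewrite eqEsubv subvf -fi; apply/subvP => _ /memv_imgP[x _ ->].
  by rewrite memv_preim Wf memvf.
left; apply/eqP; rewrite -subv0; apply/subvP => y yW.
have /memv_imgP[x _ yx] : y \in limg f by rewrite fi memvf.
have : x \in R by apply: (subvP (Rtop _ gW' Wf)); rewrite -memv_preim -yx.
by rewrite -kerR memv_ker -yx memv0.
Qed.

End SimpleProjective.

(** * Projective covers *)

Section ProjectiveCover.
Variables (K : fieldType) (A : falgType K) (gr : int -> {vspace A}).
Variables (Am T Ap : {aspace A}).
Hypothesis hA : graded_algebra gr.
Hypothesis htri : triangular_decomposition gr Am T Ap.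
Hypothesis hT : semisimple_algebra (subvs_of T).

Local Notation hgr := (alg_grading hA).
Local Notation pr := (gpr hgr).
Implicit Types M N X Y L P D S : gmodule gr.

(** Modules with the same graded [T]-character have the same composition factors,
    by [characters_determine]. Idempotents [f] of degree 0 count composition
    factors, so they cannot tell such modules apart. *)
Lemma ch_comp M N f d : f \in gr 0 -> f * f = f ->
    (forall e j, prim T e -> ch M e j = ch N e j) ->
  ch M f d = ch N f d.
Proof.
move=> f0 ff MN.
have [m [F FP]] := composition_series_exists M.
have [n [G GP]] := composition_series_exists N.
have [X XP] := filtration_factors FP; have [Y YP] := filtration_factors GP.
have sX e j : e \in gr 0 -> e * e = e -> ch M e j = (\sum_i ch (X i) e j)%N.
  by move=> e0 ee; apply: (ch_filtration j e0 ee FP) => i; have [] := XP i.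
have sY e j : e \in gr 0 -> e * e = e -> ch N e j = (\sum_i ch (Y i) e j)%N.
  by move=> e0 ee; apply: (ch_filtration j e0 ee GP) => i; have [] := YP i.
rewrite sX // sY //.
apply: (@characters_determine _ _ _ (@gsimple K A gr) (prim T) (fun X => ch X f d)).
- by move=> e eP; rewrite (prim_deg0 htri eP) (prim_idem eP).
- move=> Z sZ; have [e [k [eP top ck]]] := simple_weight htri hT sZ.
  exists e, k; split=> // Z' sZ' top' ck'.
  exact: (simple_giso hA htri eP sZ sZ' top top' ck ck').
- by move=> Z Z' _ _; apply: ch_giso.
- by move=> i; have [] := XP i.
- by move=> i; have [] := YP i.
move=> e j eP; have [e0 ee] := (prim_deg0 htri eP, prim_idem eP).
by rewrite -sX // -sY //; apply: MN.
Qed.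

(** The projective cover of a simple module is a direct summand [A f] of the
    regular module: lift [A -> L] to [P] and [P -> L] to [A]. The composite
    endomorphism of [P] lies over the identity of [L], hence is surjective, and
    bijective for reasons of dimension. *)
Lemma projective_cover_summand L P (p : 'Hom(P, L)) :
    gsimple L -> gprojective P -> gsurj p ->
    (forall U : {vspace P}, gsubmodule U -> (U + lker p)%VS = fullv -> U = fullv) ->
  exists d (y : P) (h : 'Hom(P, A)), [/\ y \in gm_gr P d, p y != 0,
    @ghom _ _ _ P (reg hA d) h & forall z, act P (h z) y = z].
Proof.
move=> sL projP [pg pi] cover.
have [d [x xd x0]] : exists d, exists2 x, x \in gm_gr L d & x != 0.
  apply: contrapT => no; case: sL => L0 _; apply: L0; apply/eqP; rewrite -subv0.
  apply/subvP => y _; rewrite -(gp_sum y) memv_suml // => i _.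
  by rewrite memv0; apply/negPn/negP => y0; apply: no; exists i, (gp L i y); rewrite ?gp_in.
have ox := simple_cyclic hA sL xd x0.
have gx := ghom_orb hA xd.
have [h hg hp] := projP (reg hA d) L (orb x) p (conj gx ox) pg.
have /memv_imgP[y0 _ xy0] : x \in limg p by rewrite pi memvf.
pose y1 := gp P d y0.
have py1 : p y1 = x by rewrite /y1 (ghom_gp _ _ pg.2) -xy0 gp_same.
have y1d : y1 \in gm_gr P d by apply: gp_in.
have gy1 := ghom_orb hA y1d.
pose u : 'End(P) := (orb y1 \o (h : 'Hom(P, A)))%VF.
have uE z : u z = act P (h z : A) y1 by rewrite comp_lfunE orbE.
have pu z : p (u z) = p z.
  rewrite uE pg.1 py1 -orbE; have /lfunP/(_ z) := hp.
  by rewrite comp_lfunE.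
have gu : ghom u.
  split=> [a z|i]; first by rewrite !uE hg.1 reg_act actMl.
  rewrite limg_comp; apply: subv_trans (gy1.2 i); apply: limgS; exact: hg.2.
have ui : limg u = fullv.
  apply: cover; first exact: (gsubmodule_img gu (gsubmodulef P)).
  apply/eqP; rewrite eqEsubv subvf; apply/subvP => z _.
  rewrite -[z](subrK (u z)) addrC memv_add ?memv_img ?memvf //.
  by rewrite memv_ker linearB /= pu subrr.
have uk : lker u == 0%VS.
  have := limg_ker_dim u fullv; rewrite capfv ui => dk.
  by rewrite -dimv_eq0 -(eqn_add2r (\dim (fullv : {vspace P}))) dk.
have uK := lker0_lfunK uk; have uVK := lker0_lfunVK uk.
exists d, (u^-1%VF y1), h; split=> //.
- have E : u (gp P d (u^-1%VF y1)) = u (u^-1%VF y1).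
    by rewrite (ghom_gp _ _ gu.2) uVK gp_same.
  by rewrite -[u^-1%VF y1]uK -E uK gp_in.
- by rewrite -pu uVK py1.
by move=> z; rewrite -[RHS]uK uE -[in RHS](uVK y1) -gu.1 uK.
Qed.

Section Cover.
Variables (L P : gmodule gr) (p : 'Hom(P, L)) (d : int) (y : P) (h : 'Hom(P, A)).
Hypotheses (sL : gsimple L) (ps : gsurj p).
Hypothesis cover : forall U : {vspace P},
  gsubmodule U -> (U + lker p)%VS = fullv -> U = fullv.
Hypotheses (yd : y \in gm_gr P d) (py : p y != 0).
Hypotheses (hg : @ghom _ _ _ P (reg hA d) h) (hy : forall z, act P (h z) y = z).

Local Notation f := (h y).

Lemma h_act a z : h (act P a z) = a * h z.
Proof. by have := hg.1 a z; rewrite reg_act. Qed.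

Lemma h_deg j z : z \in gm_gr P j -> h z \in gr (j - d).
Proof. by move=> zj; apply: (subvP (hg.2 j)); rewrite memv_img. Qed.

Lemma f_deg0 : f \in gr 0.
Proof. by have := h_deg yd; rewrite subrr. Qed.

Lemma f_idem : f * f = f.
Proof. by rewrite -h_act hy. Qed.

(** As [P = A f], homomorphisms from [P] to [M] are given by vectors of [f M_d]. *)
Lemma cover_hom M (z : M) : z \in gm_gr M d -> act M f z = z ->
  exists2 F : 'Hom(P, M), ghom F & F y = z.
Proof.
move=> zd fz; exists ((orb z : 'Hom(A, M)) \o h)%VF; last by rewrite comp_lfunE orbE.
have gz := ghom_orb hA zd.
split=> [a v|i]; first by rewrite !comp_lfunE !orbE h_act actMl.
by rewrite limg_comp; apply: subv_trans (gz.2 i); apply: limgS; apply: hg.2.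
Qed.

Lemma ghom_simple S (S' : gmodule gr) (s : 'Hom(S, S')) :
    gsimple S -> gsimple S' -> ghom s -> s != 0 ->
  lker s = 0%VS /\ limg s = fullv.
Proof.
move=> [_ sS] [_ sS'] gs s0; split.
  case: (sS _ (gsubmodule_ker gs)) => // kf; move: s0; apply: contraNeq => _.
  by apply/eqP/lfunP => x; apply/eqP; rewrite zero_lfunE -memv_ker kf memvf.
case: (sS' _ (gsubmodule_img gs (gsubmodulef S))) => // i0.
move: s0; apply: contraNeq => _; apply/eqP/lfunP => x; apply/eqP.
by rewrite zero_lfunE -memv0 -i0 memv_img ?memvf.
Qed.

(** A nonzero map from [P] to a simple module factors the projection to [L],
    since [P] has a unique maximal graded submodule. *)
Lemma cover_simple S (F : 'Hom(P, S)) : gsimple S -> ghom F -> F y != 0 ->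
  exists s : 'Hom(S, L), [/\ ghom s, lker s = 0%VS, limg s = fullv & s (F y) = p y].
Proof.
move=> sS gF Fy.
have Fi : limg F = fullv.
  case: (sS.2 _ (gsubmodule_img gF (gsubmodulef P))) => // F0.
  by move: Fy; rewrite -memv0 -F0 memv_img ?memvf.
(* Otherwise the two kernels would together span [P]. *)
have kk : (fullv :&: lker F <= lker p)%VS.
  rewrite capfv lkerE; case: (sL.2 _ (gsubmodule_img ps.1 (gsubmodule_ker gF))) => [->//|pF].
  have : lker F = fullv.
    apply: cover; first exact: gsubmodule_ker.
    apply/eqP; rewrite eqEsubv subvf; apply/subvP => z _.
    have /memv_imgP[v Fv pzv] : p z \in (p @: lker F)%VS by rewrite pF memvf.
    rewrite -[z](subrK v) addrC memv_add // memv_ker linearB /= pzv subrr eqxx //.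
  by move=> kF; move: Fy; rewrite -memv_ker kF memvf.
have [s sE] := lfun_factor Fi kk.
have {}sE v : s (F v) = p v by rewrite sE ?memvf.
have Fs w : exists v, w = F v.
  have /memv_imgP[v _ ->] : w \in limg F by rewrite Fi memvf.
  by exists v.
have gs : ghom s.
  split=> [a w|i]; first by have [v ->] := Fs w; rewrite -gF.1 !sE ps.1.1.
  apply/subvP => _ /memv_imgP[w wi ->]; have [v wv] := Fs w.
  have -> : w = F (gp P i v) by rewrite (ghom_gp _ _ gF.2) -wv gp_same.
  by rewrite sE (ghom_gp _ _ ps.1.2) gp_in.
have s0 : s != 0.
  by apply: contraNneq py => s0; rewrite -sE s0 zero_lfunE.
have [sk si] := ghom_simple sS sL gs s0.
by exists s.
Qed.

Lemma ch_cover_L : ch L f d = 1%N.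
Proof.
have [f0 ff] := (f_deg0, f_idem).
have pyd : p y \in gm_gr L d by apply: (subvP (ps.1.2 d)); rewrite memv_img.
have fpy : act L f (p y) = p y by rewrite -ps.1.1 hy.
rewrite /ch /chi -[RHS]/(nat_of_bool true) -py -dim_vline; congr (\dim _).
apply/vspaceP => z; rewrite mem_eM ?memvf //=; last exact: gsubmodulef.
apply/andP/vlineP => [[zd /eqP fz]|[k ->]]; last first.
  by rewrite memvZ // linearZ /= fpy.
have [->|z0] := eqVneq z 0; first by exists 0; rewrite scale0r.
have [F gF Fy] := cover_hom zd fz.
have [|s [gs _ _ sF]] := cover_simple sL gF; first by rewrite Fy.
have [k sk] := simple_end hA htri hT sL gs.
move: sF; rewrite Fy sk scale_lfunE id_lfunE => kz.
have k0 : k != 0 by apply: contraNneq py => k0; rewrite -kz k0 scale0r.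
by exists k^-1; rewrite -kz scalerA mulVf // scale1r.
Qed.

Lemma ch_cover_simple S : gsimple S -> ch S f d = `[< giso S L >] :> nat.
Proof.
move=> sS; have [f0 ff] := (f_deg0, f_idem).
case: asboolP => [iso|niso] /=; first by rewrite (ch_giso _ f0 ff iso) ch_cover_L.
apply: contrapT => /(ch_neq0 f0 ff)[z zd [fz z0]]; apply: niso.
have [F gF Fy] := cover_hom zd fz.
have [|s [gs sk si _]] := cover_simple sS gF; first by rewrite Fy.
by exists s.
Qed.

(** By exactness of [Hom(P, -)], which takes dimension 1 on [L] and 0 on the other
    simple modules. *)
Lemma composition_multiplicity_ch M : composition_multiplicity M L (ch M f d).
Proof.
split=> [|n F FP]; first exact: composition_series_exists.
have [D DP] := filtration_factors FP.
have Ds (i : 'I_n) : subquotient_iso (F i.+1) (F i) (D i) by have [] := DP i.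
rewrite (occurrences_sum _ FP Ds) (ch_filtration _ f_deg0 f_idem FP Ds).
by apply: eq_bigr => i _; rewrite ch_cover_simple //; have [] := DP i.
Qed.

(** ** Standard filtrations *)

(** A summand of the regular module inherits its freeness over [A^-]. *)
Lemma cover_free xi b j : contraction Am T Ap xi b ->
  exists Th : 'End(P), (forall q, q \in gen_gt P j -> Th q = 0) /\
    forall a q, q \in gm_gr P j -> Th (act P a q) - act P (tau hA b a) q \in gen_gt P j.
Proof.
move=> bP; pose Th : 'End(P) := (orb y \o (pr (j - d) \o b \o h))%VF.
have E q : Th q = act P (pr (j - d) (b (h q))) y by rewrite !comp_lfunE orbE.
exists Th; split=> [q /(ghom_gen_gt hg)|a q qj].
  by rewrite E => /(contraction_gen_gt htri bP) ->; rewrite act0l.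
have := contraction_free hA htri bP a (h_deg qj).
move/(ghom_gen_gt (ghom_orb hA yd)); rewrite orbE actBl.
by rewrite -h_act -E -h_act hy.
Qed.

(** What is kept of the terms [F] of the standard filtration: [F] contains all
    generators of degree greater than [j] and modulo those it is the span of
    [A F_j]. *)
Definition level j (F : {vspace P}) : Prop :=
  (gen_gt P j <= F)%VS /\
  forall W : {vspace P}, (forall a z, z \in F -> z \in gm_gr P j -> act P a z \in W) ->
    (gen_gt P j <= W)%VS -> (F <= W)%VS.

Lemma level0 : exists j, level j 0%VS.
Proof.
suff [j jP] : exists j, forall i : int, j < i -> gm_gr P i = 0%VS.
  exists j; split=> [|W _ _]; last exact: sub0v.
  apply: gen_gt_sub => i a x ji; rewrite jP // memv0 => /eqP->.
  by rewrite linear0 mem0v.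
have [ne|no] := EM (exists i, gm_gr P i <> 0%VS).
  have [|j _ top] := @grading_max _ _ _ (gm_grP P) (fun i => gm_gr P i <> 0%VS) _ ne.
    by move=> i ->.
  by exists j => i /top/contrapT.
by exists 0 => i _; apply: contrapT => Pi; apply: no; exists i.
Qed.

(** The next term adjoins [A u] with [u = e u] of the largest missing degree [j].
    The quotient is a standard module: if [a u] lies in [F] then so does
    [tau a u] for every contraction, by freeness over [A^-], and since [T e] is
    simple this forces [tau a e = 0]. *)
Lemma level_step (F : {vspace P}) j0 : gsubmodule F -> level j0 F -> F <> fullv ->
  exists j e (u : P) D (w : D), let F' := (F + limg (orb u))%VS in
    [/\ [/\ gsubmodule F', (F <= F')%VS & F <> F'], level j F',
        [/\ u \in gm_gr P j, forall i : int, j < i -> (gm_gr P i <= F)%VS &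
            (gen_gt P j <= F)%VS],
        prim T e /\ std hA e j w & subquotient_iso F' F D].
Proof.
move=> gF [j0F j0W] Ff.
have [||j Pj top] := @grading_max _ _ _ (gm_grP P) (fun i => ~ (gm_gr P i <= F)%VS).
- by move=> i ->; rewrite sub0v.
- apply: contrapT => no; apply: Ff; apply/eqP; rewrite eqEsubv subvf.
  apply/subvP => x _; rewrite -(gp_sum x) memv_suml // => i _.
  have Pi : (gm_gr P i <= F)%VS by apply: contrapT => Pi; apply: no; exists i.
  exact: (subvP Pi _ (gp_in i x)).
have {}top (i : int) : j < i -> (gm_gr P i <= F)%VS by move/top/contrapT.
have jj0 : j <= j0.
  rewrite leNgt; apply/negP => j0j; apply: Pj; apply: subv_trans j0F.
  by apply/subvP => x; apply: deg_gen_gt.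
have jF : (gen_gt P j <= F)%VS.
  by apply: gen_gt_sub => i a x /top/subvP Pi /Pi; apply: gF.1.
have jW (W : {vspace P}) : (forall a z, z \in F -> z \in gm_gr P j -> act P a z \in W) ->
    (gen_gt P j <= W)%VS -> (F <= W)%VS.
  move=> hW gW; apply: j0W => [a z zF zj0|].
    move: jj0; rewrite le_eqVlt => /orP[/eqP jj|jj]; first by apply: hW; rewrite ?jj.
    by apply: (subvP gW); apply: mem_gen_gt zj0.
  apply: subv_trans gW; apply: gen_gt_sub => i a x ji xi.
  exact: (mem_gen_gt _ (le_lt_trans jj0 ji) xi).
have /subvPn[x0 x0j x0F] : ~~ (gm_gr P j <= F)%VS by apply/negP.
have [e eP uF] := prim_detect htri hT x0F.
have [eT _ ee _ eS] := eP; have e0 := prim_deg0 htri eP.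
pose u := act P e x0; have uj : u \in gm_gr P j by rewrite -[j]add0r gm_actP.
have eu : act P e u = u by rewrite /u -actMl ee.
pose F' := (F + limg (orb u))%VS.
have gF' : gsubmodule F' := gsubmoduleD gF (gsubmodule_orb hgr uj).
have FF' : (F <= F')%VS := addvSl _ _.
have uF' : u \in F' by apply: (subvP (addvSr _ _)); apply: orb_self.
have [D [g [ga gg gU gk]]] := subquotient_exists gF' gF FF'.
have wj : g u \in gm_gr D j by apply: (subvP (gg j)); rewrite memv_img // memv_cap uF'.
have gF0 z : z \in F -> g z = 0.
  by rewrite -gk => /memv_capP[_]; rewrite memv_ker => /eqP.
exists j, e, u, D, (g u); split=> //.
- by split=> // FE; move/negP: uF; apply; rewrite FE.
- split=> [|W hW gW]; first exact: subv_trans FF'.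
  rewrite subv_add jW //=; last by move=> a z zF; apply/hW/(subvP FF').
  by apply/subvP => _ /memv_imgP[a _ ->]; rewrite orbE hW.
- split=> //; split=> //.
    apply/eqP; rewrite eqEsubv subvf -gU; apply/subvP => _ /memv_imgP[z zF' ->].
    move: zF' => /memv_addP[v vF [_ /memv_imgP[a _ ->] ->]].
    by rewrite linearD /= gF0 // add0r orbE ga // mem_orb.
  move=> a; rewrite -ga //; split=> [gau|aeI]; last first.
    apply: gF0; rewrite -eu -actMl; apply: (subvP jF).
    rewrite -orbE memv_preim; apply: subvP aeI; apply: Iplus_sub => i c z i0 zi.
    rewrite -memv_preim orbE actMl; apply: (@mem_gen_gt _ _ _ P j (i + j)).
      by rewrite ltrDr.
    exact: gm_actP.
  have auF : act P a u \in F by rewrite -gk memv_cap gF'.1 // memv_ker gau eqxx.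
  apply: (Iplus_of_tau htri eT) => xi b bP; apply: contrapT => te.
  have [Th [Th0 ThE]] := cover_free j bP.
  have ThF z : z \in F -> Th z \in F.
    move=> zF; rewrite memv_preim; apply: (subvP (jW _ _ _)) zF => [c v vF vj|].
      rewrite -memv_preim -[Th _](subrK (act P (tau hA b c) v)).
      by rewrite memvD ?gF.1 // (subvP jF) ?ThE.
    by apply/subvP => v /Th0 Tv; rewrite -memv_preim Tv mem0v.
  have tuF : act P (tau hA b a) u \in F.
    rewrite -[act P _ u](subKr (Th (act P a u))) memvB ?ThF //.
    exact: (subvP jF _ (ThE a u uj)).
  have [s _ sE] := eS _ (tau_T hA htri bP a) te.
  move/negP: uF; apply; rewrite -/u -eu -sE !actMl eu.
  exact: gF.1.
by exists g.
Qed.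

End Cover.
End ProjectiveCover.

(** * Multiplicities of standard modules *)

Section DeltaMultiplicity.
Variables (K : fieldType) (A : falgType K) (gr : int -> {vspace A}).
Variables (Am T Ap : {aspace A}).
Hypothesis hA : graded_algebra gr.
Hypothesis htri : triangular_decomposition gr Am T Ap.
Hypothesis hT : semisimple_algebra (subvs_of T).
Implicit Types M N X Y Z P D : gmodule gr.

Definition is_std D : Prop :=
  exists2 nu : gmodule (sub_grading gr T), gsimple nu & is_Delta Ap nu D.

Lemma is_stdP D : is_std D <-> exists e d (w : D), prim T e /\ std hA e d w.
Proof.
split=> [[nu nus nuD]|[e [d [w [eP wP]]]]]; first exact: (Delta_std hA htri hT nus nuD).
exact: (std_Delta htri eP wP).
Qed.

Lemma std_weight e d X (x : X) Y : prim T e -> std hA e d x -> is_std Y ->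
    (forall j : int, d < j -> gm_gr Y j = 0%VS) -> ch Y e d <> 0%N ->
  giso X Y.
Proof.
move=> eP xP /is_stdP[e' [d' [w [eP' wP]]]] top cY.
have [y yP] := std_change htri eP eP' wP top cY.
exact: (std_giso xP yP).
Qed.

Lemma Delta_occurrences_unique M X n F m G :
    filtration is_std (M := M) n F -> filtration is_std (M := M) m G ->
  occurrences X n F = occurrences X m G.
Proof.
move=> FP GP.
have [Y YP] := filtration_factors FP; have [Z ZP] := filtration_factors GP.
have Ys (i : 'I_n) : subquotient_iso (F i.+1) (F i) (Y i) by have [] := YP i.
have Zs (i : 'I_m) : subquotient_iso (G i.+1) (G i) (Z i) by have [] := ZP i.
rewrite (occurrences_sum X FP Ys) (occurrences_sum X GP Zs).
apply: (@characters_determine _ _ _ is_std (prim T) (fun D => nat_of_bool `[< giso D X >])).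
- by move=> e eP; rewrite (prim_deg0 htri eP) (prim_idem eP).
- move=> D /is_stdP[e [d [w [eP wP]]]]; exists e, d; split=> //.
  + by move=> j; apply: (std_top htri eP wP).
  + by rewrite (std_ch htri eP wP).
  by move=> D' D'std top cD'; apply: (std_weight eP wP).
- move=> D D' _ _ iso; congr nat_of_bool; apply: asbool_equiv_eq.
  by split; apply: giso_trans => //; apply: giso_sym.
- by move=> i; have [] := YP i.
- by move=> i; have [] := ZP i.
move=> e j eP; have [e0 ee] := (prim_deg0 htri eP, prim_idem eP).
by rewrite -(ch_filtration j e0 ee FP Ys) -(ch_filtration j e0 ee GP Zs).
Qed.

Section Count.
Variables (e : A) (m : int) (D : gmodule gr) (w : D).
Hypotheses (eP : prim T e) (wP : std hA e m w).

(** Among standard modules without components of degree above [m], only those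
    isomorphic to [D] meet its weight, and they do so in dimension 1. *)
Lemma std_count X : is_std X -> (forall i : int, m < i -> gm_gr X i = 0%VS) ->
  ch X e m = `[< giso X D >] :> nat.
Proof.
move=> sX top; have [e0 ee] := (prim_deg0 htri eP, prim_idem eP).
case: asboolP => [iso|niso] /=; first by rewrite (ch_giso _ e0 ee iso) (std_ch htri eP wP).
apply: contrapT => cX; apply: niso; apply: giso_sym.
exact: (std_weight eP wP).
Qed.

Lemma ch_zero X f j : gm_gr X j = 0%VS -> ch X f j = 0%N.
Proof. by move=> X0; rewrite /ch /chi X0 capv0 limg0 dimv0. Qed.

Lemma std_count_neq X e' j (x : X) : prim T e' -> std hA e' j x -> j != m -> ~ giso X D.
Proof.
move=> eP' xP jm iso; have [e0 ee] := (prim_deg0 htri eP, prim_idem eP).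
have [e0' ee'] := (prim_deg0 htri eP', prim_idem eP').
case: (ltgtP j m) jm => // [jm|mj] _.
  have := ch_giso m e0 ee iso; rewrite (std_ch htri eP wP).
  by rewrite ch_zero // (std_top htri eP' xP).
have := ch_giso j e0' ee' iso; rewrite (std_ch htri eP' xP).
by rewrite ch_zero // (std_top htri eP wP).
Qed.

Lemma chi_capE M (U V : {vspace M}) f j :
  (U :&: gm_gr M j)%VS = (V :&: gm_gr M j)%VS -> chi f j U = chi f j V.
Proof. by rewrite /chi => ->. Qed.

(** The multiplicity of [D] in a summand of the regular module is the dimension
    of [e (P / A P_{> m})_m]: of the steps of the filtration of [P], only those
    in degree [m] change it. *)
Lemma Delta_filtration_count d P (y : P) (h : 'Hom(P, A)) : y \in gm_gr P d ->
    @ghom _ _ _ P (reg hA d) h -> (forall z, act P (h z) y = z) ->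
  exists n F, filtration is_std (M := P) n F /\
    (chi e m (fullv : {vspace P}) = chi e m (gen_gt P m) + occurrences D n F)%N.
Proof.
move=> yd hg hy; have [e0 ee] := (prim_deg0 htri eP, prim_idem eP).
pose G (F : {vspace P}) := chi e m (F + gen_gt P m)%VS.
pose S (F F' : {vspace P}) := (exists2 X, is_std X & subquotient_iso F' F X) /\
  G F' = (G F + `[< subquotient_iso F' F D >])%N.
have [||n [F [F0 Fn Fg Fs]]] := @chain_exists _ _ _ P (fun F => exists j, level j F) S.
- exact: level0.
- move=> F gF [j0 lF] Ff.
  have [j [e' [u [X [x [[gF' FF' neF] lF' [uj top jF] [eP' xP] sX]]]]]] :=
    level_step htri hT yd hg hy gF lF Ff.
  exists (F + limg (orb u))%VS; split=> //; first by exists j.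
  have stdX : is_std X by apply/is_stdP; exists e', j, x.
  split; first by exists X.
  rewrite (asbool_equiv_eq (subquotient_iso_unique D gF' sX)).
  have [jm|jm] := eqVneq j m; last first.
    have -> : `[< giso X D >] = false.
      by apply/negbTE/asboolPn; apply: std_count_neq eP' xP jm.
    (* If [j < m] then [F] already contains [P_m]; if [j > m] then [u] lies in
       [A P_{> m}]. *)
    rewrite addn0 /G; case: (ltgtP j m) jm => // [jm|mj] _.
      have full (V : {vspace P}) : (F <= V)%VS -> (V :&: gm_gr P m)%VS = gm_gr P m.
        by move=> FV; apply/capv_idPr; apply: subv_trans (top m jm) FV.
      apply: chi_capE; rewrite !full //; first exact: addvSl.
      by apply: subv_trans FF' _; apply: addvSl.
    congr chi; apply/eqP; rewrite eqEsubv; apply/andP; split; last exact: addvS.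
    rewrite !subv_add addvSl addvSr /= andbT.
    apply: subv_trans (addvSr F _); apply: orb_sub.
      by have [] := gsubmodule_gen_gt (alg_grading hA) P m.
    exact: deg_gen_gt mj uj.
  (* [F] contains [A P_{> m}], so that [G] is the character of [F] itself. *)
  subst j.
  have abs (V : {vspace P}) : (F <= V)%VS -> (V + gen_gt P m)%VS = V.
    by move=> FV; apply/addv_idPl; apply: subv_trans jF FV.
  rewrite /G !abs // (chi_exact m e0 ee gF' gF sX); congr addn.
  apply: std_count => // i; exact: (std_top htri eP' xP).
exists n, F; split.
  split=> // i ilt; have [FF [sX _]] := Fs i ilt; split=> //.
pose c i : nat := `[< subquotient_iso (F i.+1) (F i) D >].
have := @telescope_nat (fun k => G (F k)) c n (fun i ilt => (Fs i ilt).2.2).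
rewrite /G F0 Fn sumfv add0v => ->; congr addn.
rewrite /occurrences -sum1_card [RHS]big_mkcond /=; apply: eq_bigr => i _.
by rewrite inE /c; case: asboolP.
Qed.

End Count.
End DeltaMultiplicity.

(** * The coregular module *)

Section Coregular.
Variables (K : fieldType) (A : falgType K) (gr : int -> {vspace A}).
Hypothesis hA : graded_algebra gr.
Local Notation hgr := (alg_grading hA).
Local Notation pr := (gpr hgr).
Local Notation dualA := 'Hom(A, K^o).

Definition precomp (s : 'End(A)) : 'End(dualA) := linfun (fun g : dualA => (g \o s)%VF).

Lemma precompE s g x : precomp s g x = g (s x).
Proof.
rewrite /precomp linfun_linear ?comp_lfunE // => k a b.
by rewrite comp_lfunDl comp_lfunZl.
Qed.

Lemma coreg_linear : linear (fun a => precomp (amulr a)).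
Proof.
move=> k a b; apply/lfunP => g; apply/lfunP => x.
rewrite add_lfunE scale_lfunE add_lfunE scale_lfunE !precompE !lfunE /=.
by rewrite mulrDr -scalerAr linearP.
Qed.

Definition coreg_act : {linear A -> 'End(dualA)} :=
  HB.pack (fun a => precomp (amulr a))
    (GRing.isLinear.Build _ _ _ _ (fun a => precomp (amulr a)) coreg_linear).

Lemma coreg_act1 : coreg_act 1 = \1%VF.
Proof.
apply/lfunP => g; apply/lfunP => x; rewrite id_lfunE /= precompE lfunE /=.
by rewrite mulr1.
Qed.

Lemma coreg_actM a b : coreg_act (a * b) = (coreg_act a \o coreg_act b)%VF.
Proof.
apply/lfunP => g; apply/lfunP => x; rewrite comp_lfunE /= !precompE !lfunE /=.
by rewrite mulrA.
Qed.

Definition coreg_lmodule : lmodule A := LModule coreg_act1 coreg_actM.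

Lemma coreg_actE a (g : coreg_lmodule) x :
  (act coreg_lmodule a g : dualA) x = (g : dualA) (x * a).
Proof. by rewrite /= precompE lfunE. Qed.

(** The dual grading, shifted so that functionals supported in degree 0 have
    degree [m]. *)
Definition coreg_gr (m j : int) : {vspace dualA} := limg (precomp (pr (m - j))).

Lemma pr_pr i x : pr i (pr i x) = pr i x.
Proof. by rewrite (gpr_id _ _ (gpr_in _ i x)) eqxx. Qed.

Lemma coreg_grP m j (g : dualA) : reflect (forall x, g (pr (m - j) x) = g x) (g \in coreg_gr m j).
Proof.
apply: (iffP memv_imgP) => [[g' _ ->] x|gx]; first by rewrite !precompE pr_pr.
by exists g; rewrite ?memvf //; apply/lfunP => x; rewrite precompE gx.
Qed.

Lemma coreg_grading m : is_grading (coreg_gr m).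
Proof.
have [us s0 _ _] := gsuppP hgr.
apply: (@is_grading_intro _ _ _ [seq m - i | i <- gsupp hgr] (fun j => precomp (pr (m - j)))).
- by rewrite map_inj_uniq // => i j /addrI/oppr_inj.
- move=> j js; have j0 : gr (m - j) = 0%VS.
    apply: s0; apply: contra js => js; apply/mapP; exists (m - j) => //.
    by rewrite opprB addrCA subrr addr0.
  apply/eqP; rewrite -subv0; apply/subvP => g /coreg_grP gj.
  rewrite memv0; apply/eqP/lfunP => x; rewrite -gj zero_lfunE.
  have -> : pr (m - j) x = 0 by apply/eqP; rewrite -memv0 -j0 gpr_in.
  by rewrite linear0.
- by move=> j g; rewrite memv_img ?memvf.
- move=> g; rewrite big_map; apply/lfunP => x; rewrite sum_lfunE.
  rewrite -[in RHS](gpr_sum hgr x) linear_sum; apply: eq_bigr => i _.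
  by rewrite precompE opprB addrCA subrr addr0.
move=> i j g /coreg_grP gj; apply/lfunP => x; rewrite precompE -gj.
rewrite (gpr_id _ _ (gpr_in _ (m - i) x)) (inj_eq (addrI _)) (inj_eq oppr_inj) eq_sym.
by case: eqP => [->|_]; rewrite ?gj // zero_lfunE linear0.
Qed.

Lemma coreg_actP m i j a (g : coreg_lmodule) :
  a \in gr i -> g \in coreg_gr m j -> act coreg_lmodule a g \in coreg_gr m (i + j).
Proof.
move=> ai /coreg_grP gj; apply/coreg_grP => x.
rewrite !coreg_actE -(gj (x * a)) (pr_mulr _ _ _ ai) -(gj (_ * a)) (pr_mulr _ _ _ ai).
have -> : m - j - i = m - (i + j) by rewrite opprD [- i + _]addrC addrA.
by rewrite pr_pr.
Qed.

Definition coreg m : gmodule gr :=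
  @GModule K A gr coreg_lmodule _ (coreg_grading m) (@coreg_actP m).

Definition annihilator (W : {vspace A}) : {vspace dualA} := lker (precomp (projv W)).

Lemma annihilatorP (W : {vspace A}) (g : dualA) :
  reflect (forall x, x \in W -> g x = 0) (g \in annihilator W).
Proof.
rewrite memv_ker; apply: (iffP eqP) => [g0 x Wx|g0].
  by rewrite -(projv_id Wx) -precompE g0 zero_lfunE.
by apply/lfunP => x; rewrite precompE zero_lfunE g0 ?memv_proj.
Qed.

End Coregular.

(** * Costandard modules and reciprocity *)

Section Costandard.
Variables (K : fieldType) (A : falgType K) (gr : int -> {vspace A}).
Variables (Am T Ap : {aspace A}).
Hypothesis hA : graded_algebra gr.
Hypothesis htri : triangular_decomposition gr Am T Ap.

Local Notation hgr := (alg_grading hA).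
Local Notation pr := (gpr hgr).
Local Notation Bp := (Bsub Ap T).
Local Notation Bm := (Bsub Am T).

(** The counterpart of [Iplus] on the other side: a right ideal, complementary to
    [B^+]. *)
Definition Iminus : {vspace A} :=
  (\sum_(i <- gsupp hgr | (i < 0)%R) (Am :&: gr i) * fullv)%VS.

Lemma mem_Iminus (i : int) u a : i < 0 -> u \in Am -> u \in gr i -> u * a \in Iminus.
Proof.
move=> i0 uA ui; case: (boolP (i \in gsupp hgr)) => [si|/gpr_notin g0]; last first.
  by move: ui; rewrite g0 memv0 => /eqP->; rewrite mul0r mem0v.
rewrite /Iminus (big_rem i) //= i0; apply: (subvP (addvSl _ _)).
by rewrite memv_mul ?memvf // memv_cap uA.
Qed.

Lemma Iminus_sub (W : {vspace A}) :
    (forall (i : int) u a, i < 0 -> u \in Am -> u \in gr i -> u * a \in W) ->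
  (Iminus <= W)%VS.
Proof.
move=> hW; rewrite /Iminus; elim/big_ind: _ => [|U V UW VW|i i0].
- exact: sub0v.
- by rewrite subv_add UW.
by apply/prodvP => u a /memv_capP[uA ui] _; apply: hW ui.
Qed.

(** The projection of [A] onto [B^+] along [Iminus] is the contraction with the
    functional that reads off the component of degree 0 in [A^-_0 = K]. *)
Lemma epsilon_exists : exists (ep : 'End(A)) (xi : 'Hom(A, K^o)),
  contraction Am T Ap xi ep /\
  [/\ forall a, ep a \in Bp /\ a - ep a \in Iminus,
      forall x, x \in Bp -> ep x = x,
      forall t a, t \in T -> ep (t * a) = t * ep a,
      forall a x, x \in Bp -> ep (a * x) = ep a * x &
      forall a, a \in Iminus -> ep a = 0].
Proof.
have [A1 _ _] := one_in htri.
have one0 : (1 : A) \notin 0%VS by rewrite memv0 oner_neq0.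
have [g g1 _] := functional_separation one0.
pose xi : 'Hom(A, K^o) := ((g 1 : K)^-1 *: (g \o pr 0))%VF.
have xiE u : u \in Am -> pr 0 u = (xi u : K)%:A.
  move=> uA; have [k uk] := Am_0 htri (pr_Am hA htri 0 uA) (gpr_in _ _ _).
  rewrite scale_lfunE comp_lfunE uk linearZ /=; congr (_ *: 1).
  by rewrite /= /GRing.scale /= mulrCA mulVf ?mulr1.
have [ep epP] := contraction_exists htri xi.
have epB := contraction_mulBp htri epP.
exists ep, xi; split=> //; split.
- move=> a; split; first exact: (contraction_Bp htri epP).
  have E x : (\1 - ep)%VF x = x - ep x by rewrite add_lfunE opp_lfunE id_lfunE.
  rewrite -E memv_preim; move: a; apply: (A_span htri) => u t c uA tT cA.
  rewrite -memv_preim E epP // -mulrA -mulr_algl -xiE // -mulrBl.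
  have -> : (u - pr 0 u) * (t * c) = amulr (t * c) (u - pr 0 u) by rewrite lfunE.
  rewrite memv_preim; apply: gpr_rest => i i0; rewrite -memv_preim lfunE /=.
  have [ilt|] := ltP 0 i.
    by rewrite (Am_pos htri ilt (pr_Am hA htri i uA) (gpr_in _ _ _)) mul0r mem0v.
  rewrite le_eqVlt (negbTE i0) /= => ilt.
  by apply: (mem_Iminus _ ilt); rewrite ?gpr_in ?(pr_Am hA htri).
- move=> x xB; rewrite -[x in LHS]mul1r epB //.
  have := xiE 1 A1; rewrite (gpr_id _ _ (one_deg0 hA)) eqxx => x1.
  by rewrite -mulr_algl -x1 mul1r.
- move=> t a tT.
  have E x : (ep \o amull t - (amull t \o ep))%VF x = ep (t * x) - t * ep x.
    by rewrite add_lfunE opp_lfunE !comp_lfunE !lfunE.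
  have epBm v x : v \in Bm -> x \in Bp -> ep (v * x) = pr 0 v * x.
    move=> vB xB; apply/eqP; rewrite -subr_eq0.
    have E' v' : (ep \o amulr x - (amulr x \o pr 0))%VF v' = ep (v' * x) - pr 0 v' * x.
      by rewrite add_lfunE opp_lfunE !comp_lfunE !lfunE.
    rewrite -E' -memv_ker; apply: (Bm_ind htri) vB => u s uA sT.
    have sB := T_Bp htri sT.
    rewrite memv_ker E' -mulrA epB ?memvM // (pr_mulr _ _ _ (T_deg0 htri sT)) subr0.
    by rewrite xiE // mulr_algl -scalerAl subrr.
  apply/eqP; rewrite -subr_eq0 -E -memv_ker; move: a.
  apply: (A_span htri) => u s c uA sT cA; have scB := mem_Bp htri sT cA.
  have uB : u \in Bm.
    by have [_ T1 _] := one_in htri; rewrite -[u]mulr1 (mem_Bm htri).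
  rewrite memv_ker E -[u * s * c]mulrA mulrA (epBm _ _ (memvM (T_Bm htri tT) uB) scB).
  by rewrite (pr_mull _ _ _ (T_deg0 htri tT)) subr0 epB // -mulr_algl -xiE // -mulrA subrr.
- by move=> a x; apply: (contraction_right htri epP).
move=> a aI; apply/eqP; rewrite -memv_ker; apply: subvP aI.
apply: Iminus_sub => i u b i0 uA ui.
have -> : u * b = amull u b by rewrite lfunE.
rewrite memv_preim; move: b; apply: (A_span htri) => v t c vA tT cA.
rewrite -memv_preim memv_ker lfunE /= !mulrA -[u * v * t * c]mulrA.
have uvA := memvM uA vA; rewrite (epB _ _ uvA (mem_Bp htri tT cA)).
rewrite -mulr_algl -xiE // (pr_mull _ _ _ ui) sub0r.
have ni : 0 < - i by rewrite oppr_gt0.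
by rewrite (Am_pos htri ni (pr_Am hA htri _ vA) (gpr_in _ _ _)) mulr0 mul0r.
Qed.

Lemma cut_deg a b x k : a \in gr 0 -> b \in gr 0 -> x \in gr k -> a * x * b \in gr k.
Proof. by move=> a0 b0 xk; rewrite -[k]add0r -[0 + k]addr0 !(deg_mul hA). Qed.

Definition corner (B : {vspace A}) (e' e : A) (k : int) : {vspace A} :=
  ((amull e' \o amulr e) @: (B :&: gr k))%VS.

Lemma cornerP (B : {aspace A}) e' e k x : e' \in gr 0 -> e \in gr 0 ->
    e' \in B -> e \in B -> e' * e' = e' -> e * e = e ->
  reflect [/\ x \in B, x \in gr k, e' * x = x & x * e = x] (x \in corner B e' e k).
Proof.
move=> e0' e0 eB' eB ee' ee; apply: (iffP memv_imgP) => [[y /memv_capP[yB yk] ->]|[xB xk ex xe]].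
  rewrite comp_lfunE !lfunE /=; split.
  - by rewrite mulrA !memvM.
  - by rewrite mulrA; apply: cut_deg.
  - by rewrite mulrA ee'.
  - by rewrite -!mulrA ee.
by exists x; rewrite ?memv_cap ?xB // comp_lfunE !lfunE /= xe ex.
Qed.

Hypothesis hB : graded_dual_bimodule_iso gr T Bm Bp.

(** The isomorphism of [B^-] with the dual of [B^+] is one of bimodules, so it
    restricts to a perfect pairing of [e' B^-_k e] with [e B^+_{-k} e']. *)
Lemma dim_corner e e' k : prim T e -> prim T e' ->
  \dim (corner Bm e' e k) = \dim (corner Bp e e' (- k)).
Proof.
move=> eP eP'; have [[e0 ee] [e0' ee']] :=
  ((prim_deg0 htri eP, prim_idem eP), (prim_deg0 htri eP', prim_idem eP')).
have [eT _ _ _ _] := eP; have [eT' _ _ _ _] := eP'.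
have [phi [phib phiT]] := hB k.
pose b (u v : A) : K := phi (vsproj _ u) (vsproj _ v).
have bl v : scalar (b^~ v).
  by move=> c u u'; rewrite /b !linearP /= add_lfunE scale_lfunE.
have br u : scalar (b u) by move=> c v v'; rewrite /b !linearP.
have cm x := @cornerP Bm e' e k x e0' e0 (T_Bm htri eT') (T_Bm htri eT) ee' ee.
have cp x := @cornerP Bp e e' (- k) x e0 e0' (T_Bp htri eT) (T_Bp htri eT') ee ee'.
have cut_p (v : subvs_of (Bp :&: gr (- k))) : e * vsval v * e' \in corner Bp e e' (- k).
  have /memv_capP[vB vk] := subvsP v; apply/cp; split.
  - exact: memvM (memvM (T_Bp htri eT) vB) (T_Bp htri eT').
  - exact: cut_deg.
  - by rewrite !mulrA ee.
  - by rewrite -!mulrA ee'.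
have cut_m (u : subvs_of (Bm :&: gr k)) : e' * vsval u * e \in corner Bm e' e k.
  have /memv_capP[uB uk] := subvsP u; apply/cm; split.
  - exact: memvM (memvM (T_Bm htri eT') uB) (T_Bm htri eT).
  - exact: cut_deg.
  - by rewrite !mulrA ee'.
  - by rewrite -!mulrA ee.
have in_p x : x \in corner Bp e e' (- k) -> x \in (Bp :&: gr (- k))%VS.
  by case/cp => xB xk _ _; rewrite memv_cap xB.
have in_m x : x \in corner Bm e' e k -> x \in (Bm :&: gr k)%VS.
  by case/cm => xB xk _ _; rewrite memv_cap xB.
apply/eqP; rewrite eqn_leq; apply/andP; split.
  apply: (dimv_le_pairing bl br) => u uc u0.
  suff : vsproj (Bm :&: gr k) u = 0.
    by move/(congr1 vsval); rewrite vsprojK ?in_m.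
  apply: (bij_inj phib); rewrite linear0; apply/lfunP => v; rewrite zero_lfunE.
  rewrite -(u0 _ (cut_p v)) /b; apply: (phiT e' e) => //.
    by rewrite vsprojK ?in_m //; case/cm: uc => _ _ -> ->.
  by rewrite vsprojK // in_p.
apply: (dimv_le_pairing (b := fun v u => b u v) br bl) => v vc v0.
apply/eqP/negPn/negP => vn0.
have sv : vsproj (Bp :&: gr (- k)) v \notin 0%VS.
  rewrite memv0; apply: contra vn0 => /eqP/(congr1 vsval).
  by rewrite vsprojK ?in_p // => ->.
have [g gv _] := functional_separation sv.
have [phi' _ phiK] := phib.
move/negP: gv; apply; apply/eqP; rewrite -[g]phiK -(v0 _ (cut_m (phi' g))) /b.
apply/esym/(phiT e' e) => //; first by rewrite vsprojK // in_m.
by rewrite vsprojK ?in_p //; case/cp: vc => _ _ -> ->.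
Qed.

(** [a |-> a w] identifies [B^- e] with [D], as [A = B^- + Iplus]. *)
Lemma ch_std_corner e m (D : gmodule gr) (w : D) e' j : prim T e -> std hA e m w -> prim T e' ->
  ch D e' j = \dim (corner Bm e' e (j - m)).
Proof.
move=> eP wP eP'; have [[e0 ee] [e0' ee']] :=
  ((prim_deg0 htri eP, prim_idem eP), (prim_deg0 htri eP', prim_idem eP')).
have [eT _ _ _ _] := eP; have [eT' _ _ _ _] := eP'.
have cm x := @cornerP Bm e' e (j - m) x e0' e0 (T_Bm htri eT') (T_Bm htri eT) ee' ee.
have [wm _ ann] := wP.
rewrite /ch /chi -[RHS](@limg_dim_eq _ _ _ (orb w)); last first.
  apply/eqP; rewrite -subv0; apply/subvP => x /memv_capP[/cm[xB _ _ xe]].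
  rewrite memv_ker orbE memv0 => /eqP/ann; rewrite xe => xI.
  by rewrite (Bm_Iplus htri xB xI).
congr (\dim _); apply/vspaceP => z; rewrite mem_eM ?memvf //=; last exact: gsubmodulef.
apply/andP/memv_imgP => [[zj /eqP ez]|[x /cm[xB xj ex xe] ->]]; last first.
  rewrite orbE -actMl ex eqxx; split=> //.
  by rewrite -[j](subrK m) gm_actP.
have [a aj za] := std_deg wP zj.
have [b [bB bj abI]] := gr_Bm hA htri aj.
have zb : z = act D b w.
  by apply/eqP; rewrite za -subr_eq0 -actBl (std_Iplus htri eP wP).
exists (e' * b * e).
  apply/cm; split.
  - exact: memvM (memvM (T_Bm htri eT') bB) (T_Bm htri eT).
  - exact: cut_deg.
  - by rewrite !mulrA ee'.
  - by rewrite -!mulrA ee.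
by rewrite orbE actMl (std_id eP wP) actMl -zb ez.
Qed.

Section Nabla.
Variables (e : A) (m : int).
Hypothesis eP : prim T e.

(** The costandard module of weight [(e, m)]: functionals on [e A] that vanish
    on the right ideal generated by the part of negative degree of [A^-]. *)
Definition nabla : {vspace coreg hA m} :=
  annihilator (limg (amull (1 - e)) + Iminus)%VS.

Lemma nablaP (g : 'Hom(A, K^o)) :
  reflect ((forall x, g (e * x) = g x) /\ (forall a, a \in Iminus -> g a = 0))
    (g \in (nabla : {vspace 'Hom(A, K^o)})).
Proof.
apply: (iffP (annihilatorP _ _)) => [g0|[ge gI] _ /memv_addP[_ /memv_imgP[x _ ->] [a aI ->]]].
  split=> [x|a aI]; last by apply: g0; apply: (subvP (addvSr _ _)).
  apply/eqP; rewrite eq_sym -subr_eq0 -linearB /=; apply/eqP/g0.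
  apply: (subvP (addvSl _ _)); apply/memv_imgP; exists x; rewrite ?memvf //.
  by rewrite lfunE /= mulrBl mul1r.
by rewrite linearD /= (gI a aI) lfunE /= mulrBl mul1r linearB /= ge subrr addr0.
Qed.

Lemma Iminus_right a b : a \in Iminus -> a * b \in Iminus.
Proof.
move=> aI; have -> : a * b = amulr b a by rewrite lfunE.
rewrite memv_preim; apply: subvP aI; apply: Iminus_sub => i u c i0 uA ui.
by rewrite -memv_preim lfunE /= -mulrA (mem_Iminus _ i0).
Qed.

Lemma Iminus_pr i a : a \in Iminus -> pr i a \in Iminus.
Proof.
move=> aI; rewrite memv_preim; apply: subvP aI; apply: Iminus_sub => j u c j0 uA uj.
by rewrite -memv_preim (pr_mull _ _ _ uj) (mem_Iminus _ j0).
Qed.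

Lemma gsubmodule_nabla : gsubmodule nabla.
Proof.
have e0 := prim_deg0 htri eP.
split.
  move=> a g /nablaP[ge gI]; apply/nablaP.
  split=> [x|b bI]; rewrite !coreg_actE; first by rewrite -mulrA ge.
  exact/gI/Iminus_right.
exists [seq m - i | i <- gsupp hgr]; apply/subvP => g /nablaP[ge gI].
have -> : g = \sum_(i <- gsupp hgr) precomp (pr i) g.
  apply/lfunP => x; rewrite sum_lfunE -[in LHS](gpr_sum hgr x) linear_sum.
  by apply: eq_bigr => i _; rewrite precompE.
rewrite big_map; apply: memv_sum_seq => k; rewrite memv_cap; apply/andP; split.
  apply/nablaP; split=> [x|a aI]; rewrite !precompE; last exact/gI/Iminus_pr.
  by rewrite (pr_mull _ _ _ e0) subr0 ge.
apply/coreg_grP => x; rewrite !precompE opprB addrCA subrr addr0.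
by rewrite pr_pr.
Qed.

Lemma mem_eNabla f j (g : 'Hom(A, K^o)) : f \in gr 0 -> f * f = f ->
  reflect [/\ g \in (nabla : {vspace 'Hom(A, K^o)}),
      forall x, g (pr (m - j) x) = g x & forall x, g (x * f) = g x]
    (g \in (act (coreg hA m) f @: (nabla :&: gm_gr (coreg hA m) j))%VS).
Proof.
move=> f0 ff; rewrite (@mem_eM _ _ _ (coreg hA m) f j nabla g f0 ff gsubmodule_nabla).
apply: (iffP and3P) => [[gn /coreg_grP gj /eqP fg]|[gn gj fg]]; split=> //.
- by move=> x; rewrite -[in RHS]fg coreg_actE.
- exact/coreg_grP.
by apply/eqP/lfunP => x; rewrite coreg_actE fg.
Qed.

(** A functional in [nabla] is determined by its values on [e B^+], as
    [A = B^+ + Iminus], and those values are arbitrary. *)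
Lemma chi_nabla e' j : prim T e' -> chi e' j nabla = \dim (corner Bp e e' (m - j)).
Proof.
move=> eP'; have [[e0 ee] [e0' ee']] :=
  ((prim_deg0 htri eP, prim_idem eP), (prim_deg0 htri eP', prim_idem eP')).
have [eT _ _ _ _] := eP; have [eT' _ _ _ _] := eP'.
have cp x := @cornerP Bp e e' (m - j) x e0 e0' (T_Bp htri eT) (T_Bp htri eT') ee ee'.
have [ep [xi [epP [epB epid epT epr epI]]]] := epsilon_exists.
pose b (g : 'Hom(A, K^o)) (v : A) : K := g v.
have bl v : scalar (b^~ v) by move=> k g g'; rewrite /b add_lfunE scale_lfunE.
have br g : scalar (b g) by move=> k v v'; rewrite /b linearP.
apply/eqP; rewrite eqn_leq; apply/andP; split.
  apply: (dimv_le_pairing bl br) => g /(mem_eNabla _ _ e0' ee')[/nablaP[ge gI] gj gf] g0.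
  apply/lfunP => x; rewrite zero_lfunE.
  have [xB xI] := epB x.
  have -> : g x = g (ep x) by apply/eqP; rewrite -subr_eq0 -linearB /= gI.
  rewrite -gj -gf -ge mulrA; apply: g0; apply/cp; split.
  - exact: memvM (memvM (T_Bp htri eT) (pr_Bp hA htri _ xB)) (T_Bp htri eT').
  - by apply: cut_deg; rewrite ?gpr_in.
  - by rewrite !mulrA ee.
  - by rewrite -!mulrA ee'.
apply: (dimv_le_pairing (b := fun v g => b g v) br bl) => v /cp[vB vj ev ve] v0.
apply/eqP/negPn/negP => vn0.
have sv : v \notin 0%VS by rewrite memv0.
have [g gv _] := functional_separation sv.
pose g' : 'Hom(A, K^o) := (g \o (amull e \o amulr e' \o ep \o pr (m - j)))%VF.
have g'E x : g' x = g (e * (ep (pr (m - j) x) * e')) by rewrite !comp_lfunE !lfunE.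
have /v0 : g' \in (act (coreg hA m) e' @: (nabla :&: gm_gr (coreg hA m) j))%VS.
  apply/(mem_eNabla _ _ e0' ee'); split.
  - apply/nablaP; split=> [x|a aI]; rewrite !g'E.
      by rewrite (pr_mull _ _ _ e0) subr0 epT // !mulrA ee.
    by rewrite epI ?mul0r ?mulr0 ?linear0 // Iminus_pr.
  - by move=> x; rewrite !g'E pr_pr.
  - move=> x; rewrite !g'E (pr_mulr _ _ _ e0') subr0 epr ?(T_Bp htri) //.
    by rewrite -[ep _ * e' * e']mulrA ee'.
rewrite /b g'E (gpr_id _ _ vj) eqxx epid // ve ev => gv0.
by rewrite gv0 eqxx in gv.
Qed.

(** With [f = h y], the space [f nabla_d = Hom(P, nabla)] is dual to
    [e (P / A P_{> m})_m]: a functional [g] in it corresponds to [v |-> g (h v)]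
    on [P_m], and the components of [A P_{> m}] in degree [m] are sent by [h] into
    [Iminus]. *)
Lemma chi_nabla_cover d (P : gmodule gr) (y : P) (h : 'Hom(P, A)) :
    y \in gm_gr P d -> @ghom _ _ _ P (reg hA d) h -> (forall z, act P (h z) y = z) ->
  (chi e m (fullv : {vspace P}) = chi e m (gen_gt P m) + chi (h y) d nabla)%N.
Proof.
move=> yd hg hy; have [e0 ee] := (prim_deg0 htri eP, prim_idem eP).
have [f0 ff] := (f_deg0 yd hg, f_idem hg hy).
have gG := gsubmodule_gen_gt hgr P m.
have [ep [xi [epP [epB epid epT epr epI]]]] := epsilon_exists.
set PM := (act P e @: (fullv :&: gm_gr P m))%VS.
set GM := (act P e @: (gen_gt P m :&: gm_gr P m))%VS.
have PMP x : reflect (x \in gm_gr P m /\ act P e x = x) (x \in PM).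
  rewrite /PM mem_eM ?memvf //=; last exact: gsubmodulef.
  by apply: (iffP andP) => -[xm /eqP ex]; split=> //; apply/eqP.
have GPM : (GM <= PM)%VS by apply: limgS; apply: capvS; rewrite ?subvf.
rewrite /chi -/PM -/GM -(dimv_cap_compl PM GM) (capv_idPr GPM); congr addn.
pose b (g : 'Hom(A, K^o)) (v : P) : K := g (h v).
have bl v : scalar (b^~ v) by move=> k g g'; rewrite /b add_lfunE scale_lfunE.
have br g : scalar (b g) by move=> k v v'; rewrite /b !linearP.
apply/eqP; rewrite eqn_leq; apply/andP; split; last first.
  apply: (dimv_le_pairing bl br) => g /(mem_eNabla _ _ f0 ff)[/nablaP[ge gI] gj gf] g0.
  apply/lfunP => x; rewrite zero_lfunE -gj.
  set x' := pr (m - d) x; pose q := act P x' y.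
  have qm : q \in gm_gr P m by rewrite -[m](subrK d) gm_actP ?gpr_in.
  have -> : g x' = g (h (act P e q)) by rewrite (h_act hg) ge (h_act hg) gf.
  have : act P e q \in (PM :\: GM + PM :&: GM)%VS.
    by rewrite addv_diff_cap /PM memv_img // capfv.
  case/memv_addP => v /g0 gv0 [v' /memv_capP[_ v'G] ->].
  rewrite /b in gv0; rewrite !linearD /= gv0 add0r.
  have : v' \in GM by [].
  rewrite /GM mem_eM // => /and3P[v'g v'm _].
  have [xB xI] := epB (h v').
  have -> : g (h v') = g (ep (h v')) by apply/eqP; rewrite -subr_eq0 -linearB /= gI.
  rewrite -gj (contraction_gen_gt htri epP) ?linear0 //.
  exact: ghom_gen_gt hg v'g.
apply: (dimv_le_pairing (b := fun v g => b g v) br bl) => v vV v0.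
apply/eqP/negPn/negP => vn0.
have /PMP[vm ev] : v \in PM := subvP (diffvSl _ _) _ vV.
have vG : v \notin gen_gt P m.
  apply: contra vn0 => vG; rewrite -memv0 -(capv_diff PM GM) memv_cap vV /=.
  by rewrite /GM mem_eM // vG vm ev eqxx.
have [g gv gG0] := functional_separation vG.
pose g' : 'Hom(A, K^o) := (g \o (act P e \o gp P m \o orb y))%VF.
have g'E x : g' x = g (act P e (gp P m (act P x y))) by rewrite !comp_lfunE orbE.
have /v0 : g' \in (act (coreg hA m) (h y) @: (nabla :&: gm_gr (coreg hA m) d))%VS.
  apply/(mem_eNabla _ _ f0 ff); split.
  - apply/nablaP; split=> [x|a aI].
      by rewrite !g'E actMl (gp_actl _ _ e0) subr0 -actMl ee.
    rewrite g'E gG0 // gG.1 // -orbE -comp_lfunE memv_preim.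
    apply: subvP aI; apply: Iminus_sub => i u c i0 uA ui.
    rewrite -memv_preim comp_lfunE orbE actMl (gp_actl _ _ ui).
    by apply: (@mem_gen_gt _ _ _ P m (m - i)); rewrite ?gp_in // ltrDl oppr_gt0.
  - by move=> x; rewrite !g'E -!(gp_actr hgr) // gp_same ?gp_in.
  - by move=> x; rewrite !g'E actMl hy.
rewrite /b g'E hy gp_same // ev => gv0.
by rewrite gv0 eqxx in gv.
Qed.

End Nabla.
End Costandard.

Theorem theorem1p3 (K : fieldType) (A : falgType K) (gr : int -> {vspace A})
    (Am T Ap : {aspace A})
    (hA : graded_algebra gr)
    (htri : triangular_decomposition gr Am T Ap)
    (hT : semisimple_algebra (subvs_of T))
    (hB : graded_dual_bimodule_iso gr T (Bsub Am T) (Bsub Ap T))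
    (la mu : gmodule (sub_grading gr T))
    (hla : gsimple la) (hmu : gsimple mu)
    (Dla Dmu L P : gmodule gr)
    (hDla : is_Delta Ap la Dla) (hDmu : is_Delta Ap mu Dmu)
    (hL : is_head Dla L) (hP : is_projective_cover P L) :
  exists n : nat,
    Delta_multiplicity T Ap P Dmu n /\ composition_multiplicity Dmu L n.
Proof.
have [e [m [w [eP wP]]]] := Delta_std hA htri hT hmu hDmu.
have [e1 [d1 [w1 [eP1 wP1]]]] := Delta_std hA htri hT hla hDla.
have sL := is_head_simple htri eP1 wP1 hL.
have [projP [p ps cover]] := hP.
have [d [y [h [yd py hg hy]]]] := projective_cover_summand hA sL projP ps cover.
have [f0 ff] := (f_deg0 yd hg, f_idem hg hy).
exists (ch Dmu (h y) d); split; last first.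
  exact: (composition_multiplicity_ch htri hT sL ps cover yd py hg hy).
have [n [F [FP Fn]]] := Delta_filtration_count htri hT eP wP yd hg hy.
have gN := gsubmodule_nabla hA htri m eP.
have [N NP] := subquotient_exists gN (gsubmodule0 _) (sub0v _).
have chN f j : f \in gr 0 -> f * f = f -> ch N f j = chi f j (nabla Am hA e m).
  by move=> f0' ff'; rewrite (chi_exact j f0' ff' gN (gsubmodule0 _) NP) chi0.
(* [nabla] and [Delta mu] have the same graded [T]-character, by the duality of
   [B^-] and [B^+]. *)
have chE e' j : prim T e' -> ch N e' j = ch Dmu e' j.
  move=> eP'; rewrite chN ?(prim_deg0 htri eP') ?(prim_idem eP') //.
  rewrite (chi_nabla hA htri m eP j eP') (ch_std_corner htri j eP wP eP').
  by rewrite (dim_corner hA htri hB) // opprB.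
have occF : occurrences Dmu n F = ch Dmu (h y) d.
  rewrite -(ch_comp hA htri hT d f0 ff chE) chN //; apply/eqP.
  rewrite -(eqn_add2l (chi e m (gen_gt P m))) -Fn.
  by rewrite (chi_nabla_cover htri m eP yd hg hy).
split; first by exists n, F.
move=> k G GP; rewrite -occF.
exact: (Delta_occurrences_unique hA htri hT _ GP FP).
Qed.
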